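(* There are polynomial-time algorithms which, given a circle intersection graph $G$, respectively: (a) output a vertex cover of $G$ of size at most $5/3$ times the minimum size of a vertex cover of $G$; (b) output a proper vertex coloring of $G$ using at most $6$ times the chromatic number of $G$ colors; (c) output an independent set of $G$ of size at least $1/5$ of the maximum size of an independent set of $G$.
   Context: A graph $G$ is a circle intersection graph if its vertices can be put in one-to-one correspondence with closed disks (circles) of arbitrary positive radii in the plane so that two vertices are adjacent if and only if the corresponding disks intersect (tangent circles are considered to intersect). *)

(* Defs.v *)
From Stdlib Require Import Reals.
From mathcomp Require Import all_boot.
Set Implicit Arguments.
Unset Strict Implicit.
Unset Printing Implicit Defensive.

Local Open Scope R_scope.
(* Circle (disk) intersection graph: there are closed disks with centers
   (x i, y i) and radii r i > 0 such that, for distinct i j, i ~ j iff the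
   disks intersect (tangency counts), i.e. dist <= r i + r j. We compare
   squared quantities (both sides nonnegative). Also e is loopless. *)
Definition is_circle_graph (n : nat) (e : rel 'I_n) : Prop :=
  (forall i, ~~ e i i) /\
  exists (x y r : 'I_n -> Reals.Rdefinitions.R),
    (forall i, 0 < r i) /\
    forall i j, i <> j ->
      (e i j <-> (x i - x j) * (x i - x j) + (y i - y j) * (y i - y j)
                   <= (r i + r j) * (r i + r j)).
Local Close Scope R_scope.

Definition is_vertex_cover (n : nat) (e : rel 'I_n) (C : {set 'I_n}) : Prop :=
  forall i j, i != j -> e i j -> (i \in C) || (j \in C).

Definition is_independent (n : nat) (e : rel 'I_n) (I : {set 'I_n}) : Prop :=
  forall i j, i \in I -> j \in I -> i != j -> ~~ e i j.

Definition is_proper_coloring (n k : nat) (e : rel 'I_n) (f : 'I_n -> 'I_k) : Prop :=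
  forall i j, i != j -> e i j -> f i != f j.

Definition colors_used (n k : nat) (f : 'I_n -> 'I_k) : nat := #|f @: [set: 'I_n]|.

Inductive sym := Blank | B0 | B1.
Inductive move := MoveL | MoveR | Stay.

(* states are 'I_(tm_nstates.+1); the start state is ord0; the machine
   halts when the transition function returns None. *)
Record TM := {
  tm_nstates : nat;
  tm_delta : 'I_tm_nstates.+1 -> sym -> option ('I_tm_nstates.+1 * sym * move)
}.

(* tape = (cells left of head, nearest first; scanned cell; cells right) *)
Definition tape := (seq sym * sym * seq sym)%type.
Definition config (M : TM) := ('I_(tm_nstates M).+1 * tape)%type.

Definition move_head (t : tape) (w : sym) (m : move) : tape :=
  let: (l, _, r) := t in
  match m with
  | Stay => (l, w, r)
  | MoveL => match l with [::] => ([::], Blank, w :: r) | a :: l' => (l', a, w :: r) end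
  | MoveR => match r with [::] => (w :: l, Blank, [::]) | a :: r' => (w :: l, a, r') end
  end.

Definition step (M : TM) (c : config M) : option (config M) :=
  let: (q, t) := c in
  let: (_, h, _) := t in
  match tm_delta q h with
  | None => None
  | Some (q', w, m) => Some (q', move_head t w m)
  end.

Fixpoint run (M : TM) (t : nat) (c : config M) : option (config M) :=
  match step c with
  | None => Some c
  | Some c' => if t is t'.+1 then run t' c' else None
  end.

Definition bit_sym (b : bool) : sym := if b then B1 else B0.

Definition init_config (M : TM) (input : seq bool) : config M :=
  (ord0, match map bit_sym input with
         | [::] => ([::], Blank, [::])
         | a :: r => ([::], a, r)
         end).

Fixpoint read_bits (s : seq sym) : seq bool :=
  match s with
  | B0 :: s' => false :: read_bits s'
  | B1 :: s' => true :: read_bits s'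
  | _ => [::]
  end.

Definition output (M : TM) (c : config M) : seq bool :=
  let: (_, (_, h, r)) := c in read_bits (h :: r).

Definition encode_graph (n : nat) (e : rel 'I_n) : seq bool :=
  [seq e i j | i <- enum 'I_n, j <- enum 'I_n].

Definition encode_set (n : nat) (C : {set 'I_n}) : seq bool :=
  [seq i \in C | i <- enum 'I_n].

Definition encode_coloring (n : nat) (f : 'I_n -> 'I_n) : seq bool :=
  [seq f i == j | i <- enum 'I_n, j <- enum 'I_n].

(* M solves the promise problem "on circle intersection graphs, output a
   word satisfying Good" in polynomial time: there is c such that on every
   circle intersection graph with n vertices (input length n*n), M halts
   within c * (n*n + 1)^c steps with an output satisfying Good. *)
Definition polytime_on_circle_graphs (M : TM)
    (Good : forall n : nat, rel 'I_n -> seq bool -> Prop) : Prop :=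
  exists c : nat, forall (n : nat) (e : rel 'I_n), is_circle_graph e ->
    exists (t : nat) (cf : config M),
      t <= c * (n * n).+1 ^ c /\
      @run M t (init_config M (encode_graph e)) = Some cf /\
      Good n e (output cf).

Definition good_vertex_cover (n : nat) (e : rel 'I_n) (out : seq bool) : Prop :=
  exists C : {set 'I_n}, out = encode_set C /\ is_vertex_cover e C /\
    forall C' : {set 'I_n}, is_vertex_cover e C' -> 3 * #|C| <= 5 * #|C'|.

Definition good_coloring (n : nat) (e : rel 'I_n) (out : seq bool) : Prop :=
  exists f : 'I_n -> 'I_n, out = encode_coloring f /\ is_proper_coloring e f /\
    forall (k : nat) (g : 'I_n -> 'I_k), is_proper_coloring e g ->
      colors_used f <= 6 * k.

Definition good_independent_set (n : nat) (e : rel 'I_n) (out : seq bool) : Prop :=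
  exists I : {set 'I_n}, out = encode_set I /\ is_independent e I /\
    forall I' : {set 'I_n}, is_independent e I' -> #|I'| <= 5 * #|I|.

(* Main.v *)
(** Call a vertex good, relative to a set of alive vertices, when it has no six
    independent alive neighbours. In a circle graph a vertex of smallest radius
    is always good: seen from the centre of its disk, independent neighbours are
    more than 60 degrees apart. Deciding goodness takes six nested loops.
    - Independent set: take good vertices greedily, removing their neighbours;
      a competitor loses at most five vertices for each one taken.
    - Coloring: remove good vertices one after the other and color first-fit in
      the reverse order. The later neighbours of a vertex meet each class of a
      k-coloring in at most five vertices, so 5k+1 <= 6k colors suffice.
    - Vertex cover: put disjoint triangles in the cover, at ratio 3/2, until
      none is left. A minimum vertex cover of the bipartite double cover of the
      rest, found by an auction, splits the rest (Nemhauser and Trotter) into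
      vertices to take, vertices to leave, and a set H, such that every cover
      of the rest is at least as large as the first set plus half of H. In H
      good vertices have degree at most 5, hence the greedy independent set
      leaves at most 5/6 of H to cover.
    The algorithms are written in a small language of loops over the vertices,
    in which every program runs in polynomial time. The tape holds the matrix of
    the pairs of vertices, one block of bits per entry; the value of a variable
    is kept as marks on its row and its column, so that each primitive operation
    is a sweep of a finite automaton over the matrix. *)
From Stdlib Require Import Reals Lra FunctionalExtensionality.
From mathcomp Require Import all_boot zify.
Require Import Defs.

Set Implicit Arguments.
Unset Strict Implicit.
Unset Printing Implicit Defensive.

(** * Turing machine fragments *)

(** The machine is given neither the disks nor n. The disks are never reconstructed: every nonempty
    set of vertices contains a good one, and goodness is decided on the adjacency matrix, so any
    good vertex may be removed, whatever its radius. The number n is the row length of an unmarked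
    word of N = n*n bits and has to be recovered before rows and columns make sense; for N > 0 it is
    the least al such that the ceiling of N/al is al.

    Blanks have to serve as delimiters, so the alphabet has no symbol to spare for markers. Each
    input bit is therefore widened to a block of bits, and since rewriting may change lengths, a
    word is copied block by block to fresh cells.

    The language has bounded loops only. A loop that should run until nothing changes is replaced by
    as many rounds as a measure can increase.

    The ratio 5/3 outside the triangles comes from comparing, for b vertices taken and h = |H|, the
    cost b + 5h/6 with the lower bound b + h/2: the half-integral part alone loses 5/3, the rest
    loses nothing. *)

Definition stream := nat -> sym.
Definition scons (a : sym) (s : stream) : stream :=
  fun i => if i is j.+1 then s j else a.
Definition stail (s : stream) : stream := fun i => s i.+1.

(* A tape with its blank ends made infinite: the cells left of the head,
   nearest first, and the scanned cell followed by those right of it. *)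
Definition itape := (stream * stream)%type.

Definition itape_of (t : tape) : itape :=
  let: (l, h, r) := t in (nth Blank l, nth Blank (h :: r)).

Definition imove (t : itape) (w : sym) (m : move) : itape :=
  match m with
  | Stay => (t.1, scons w (stail t.2))
  | MoveL => (stail t.1, scons (t.1 0) (scons w (stail t.2)))
  | MoveR => (scons w t.1, stail t.2)
  end.

Lemma itape_of_move t w m : itape_of (move_head t w m) = imove (itape_of t) w m.
Proof.
case: t => [[l h] r]; case: m => /=.
- case: l => [|a l] /=; congr pair; apply: functional_extensionality => i;
  by case: i => [|[|i]] //=; rewrite nth_nil.
- case: r => [|a r] /=; congr pair; apply: functional_extensionality => i;
  by case: i => [|[|i]] //=; rewrite nth_nil.
- by congr pair; apply: functional_extensionality => i; case: i.
Qed.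

(** Results leave through the finite control: an exit carries a label in [X], takes no step and
    leaves the tape alone. Fragments then compose like a monad, with [ret] and [bind]. *)
Record frag (X : Type) := Frag {
  fstate : finType;
  finit : fstate;
  fdelta : fstate -> sym -> (fstate * sym * move) + X }.
Arguments finit {X f}.
Arguments fdelta {X} f.

(* [k] is only an upper bound on the number of steps. *)
Inductive runs (X Q : Type) (delta : Q -> sym -> (Q * sym * move) + X) :
    Q -> itape -> nat -> X -> itape -> Prop :=
| runs_exit q t k x : delta q (t.2 0) = inr x -> runs delta q t k x t
| runs_step q t k x t' q' w m :
    delta q (t.2 0) = inl (q', w, m) ->
    runs delta q' (imove t w m) k x t' -> runs delta q t k.+1 x t'.

Definition ex (X : Type) (F : frag X) t k x t' :=
  runs (fdelta F) finit t k x t'.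

Lemma runs_leq X Q delta q t k k' x t' :
  k <= k' -> @runs X Q delta q t k x t' -> runs delta q t k' x t'.
Proof.
move=> + r; elim: r k' => {q t k x t'} [q t k x e k' _|].
  exact: runs_exit e.
by move=> q t k x t' q' w m e _ IH [//|k'] le; apply: runs_step e (IH _ le).
Qed.

Lemma ex_leq X (F : frag X) t k k' x t' :
  k <= k' -> ex F t k x t' -> ex F t k' x t'.
Proof. exact: runs_leq. Qed.

Section Ret.
Variables (X : Type) (x : X).
Definition ret : frag X := @Frag X unit tt (fun _ _ => inr x).
Lemma ex_ret t k : ex ret t k x t.
Proof. exact: runs_exit. Qed.
End Ret.

Definition sym_bit (s : sym) : option bool :=
  match s with Blank => None | B0 => Some false | B1 => Some true end.
Definition bit_sym_opt (b : option bool) : sym :=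
  if b is Some b' then bit_sym b' else Blank.

Lemma sym_bitK : cancel sym_bit bit_sym_opt. Proof. by case. Qed.
Lemma bit_symK b : sym_bit (bit_sym b) = Some b. Proof. by case: b. Qed.

Section Tick.
Variable g : option bool -> option bool * move.
Definition tick : frag (option bool) :=
  @Frag _ (option (option bool)) None (fun q s =>
    if q is Some b then inr b
    else inl (Some (sym_bit s), bit_sym_opt (g (sym_bit s)).1, (g (sym_bit s)).2)).
Lemma ex_tick t a : t.2 0 = a ->
  ex tick t 1 (sym_bit a)
    (imove t (bit_sym_opt (g (sym_bit a)).1) (g (sym_bit a)).2).
Proof. by move=> <-; apply: runs_step; [reflexivity|apply: runs_exit]. Qed.
End Tick.

Section Bind.
Variables (X : finType) (Y : Type) (F : frag X) (K : X -> frag Y).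
(** The result [x] is remembered as the index of the dependent sum, so [X] must be finite. Handing
    over takes one step that rewrites the scanned symbol in place; this is the strict inequality of
    [ex_bind]. *)
Definition bind : frag Y :=
  @Frag Y (fstate F + {x : X & fstate (K x)})%type (inl finit) (fun q s =>
    match q with
    | inl q1 => match fdelta F q1 s with
                | inl (q', w, m) => inl (inl q', w, m)
                | inr x => inl (inr (Tagged (fun x => fstate (K x)) (@finit _ (K x))), s, Stay)
                end
    | inr (existT x q2) => match fdelta (K x) q2 s with
                | inl (q', w, m) => inl (inr (Tagged (fun x => fstate (K x)) q'), w, m)
                | inr y => inr y
                end
    end).

Lemma imove_stay t : imove t (t.2 0) Stay = t.
Proof.
case: t => l r; congr pair; apply: functional_extensionality.
by case.
Qed.

Lemma ex_bind t k x t1 k1 y t2 k2 :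
  ex F t k x t1 -> ex (K x) t1 k1 y t2 -> k + k1 < k2 -> ex bind t k2 y t2.
Proof.
move=> r1 r2 lek; apply: (@runs_leq _ _ _ _ _ (k + k1).+1) => //.
have {}r2 : runs (fdelta bind) (inr (Tagged (fun x => fstate (K x)) (@finit _ (K x)))) t1 k1 y t2.
  elim: r2 {k k2 r1 lek} => {t1 k1 y t2} [q t1 k1 y e|q t1 k1 y t2 q' w m e _ IH].
    by apply: runs_exit => /=; rewrite e.
  by apply: runs_step IH => /=; rewrite e.
rewrite /ex /=; elim: r1 r2 {lek} => {t x t1 k} [q t1 k x e r2|q t k x t1 q' w m e _ IH r2].
  apply: (@runs_leq _ _ _ _ _ k1.+1); first by rewrite ltnS leq_addl.
  apply: runs_step; first by rewrite /= e.
  by rewrite imove_stay.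
by apply: runs_step (IH r2) => /=; rewrite e.
Qed.
End Bind.

Section Loop.
Variables (S : finType) (Y : Type) (F : S -> frag (S + Y)).
Definition loop (s : S) : frag Y :=
  @Frag Y {s : S & fstate (F s)} (Tagged (fun s => fstate (F s)) (@finit _ (F s)))
    (fun '(existT s' q) a =>
       match fdelta (F s') q a with
       | inl (q', w, m) => inl (Tagged (fun s => fstate (F s)) q', w, m)
       | inr (inl s1) =>
           inl (Tagged (fun s => fstate (F s)) (@finit _ (F s1)), a, Stay)
       | inr (inr y) => inr y
       end).

Lemma ex_loop_done s t k y t1 : ex (F s) t k (inr y) t1 -> ex (loop s) t k y t1.
Proof.
rewrite /ex /=; move: (finit) => q; move ey: (inr y) => z r.
elim: r ey => {t k t1 q z} [q t k x e ey|q t k x t1 q' w m e _ IH /IH r].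
  by apply: runs_exit; rewrite /= e -ey.
by apply: runs_step r; rewrite /= e.
Qed.

Lemma ex_loop_next s t k s1 t1 k1 y t2 k2 :
  ex (F s) t k (inl s1) t1 -> ex (loop s1) t1 k1 y t2 -> k + k1 < k2 ->
  ex (loop s) t k2 y t2.
Proof.
rewrite /ex /= => r1 r2 lek.
apply: (@runs_leq _ _ _ _ _ (k + k1).+1) => //.
move: (finit) r1 => q; move ex1: (inl s1) => z r1.
elim: r1 ex1 r2 {lek} => {q t z t1 k} [q t1 k x e ex1 r2|q t k x t1 q' w m e _ IH ex1 r2].
  apply: (@runs_leq _ _ _ _ _ k1.+1); first by rewrite ltnS leq_addl.
  apply: runs_step; first by rewrite /= e -ex1.
  by rewrite imove_stay.
by apply: runs_step (IH ex1 r2) => /=; rewrite e.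
Qed.
End Loop.

Section Machine.
Variables (X : Type) (F : frag X).

(* State 0 only jumps to the initial state of the fragment, which need not be
   the first one in the enumeration of its states. *)
Definition machine : TM :=
  @Build_TM #|fstate F| (fun i s =>
    match unlift ord0 i with
    | None => Some (lift ord0 (enum_rank (@finit _ F)), s, Stay)
    | Some j => match fdelta F (enum_val j) s with
                | inl (q, w, m) => Some (lift ord0 (enum_rank q), w, m)
                | inr _ => None
                end
    end).

(** The final lists are controlled only up to trailing blanks, which suffices since the output is
    read up to the first blank. The additional step is the jump out of state 0. *)
Lemma machine_run t k x t' : ex F (itape_of t) k x t' ->
  exists j (cf : config machine), [/\ j <= k.+1, @run machine j (ord0, t) = Some cf
    & itape_of cf.2 = t'].
Proof.
move=> r.
suff [j [cf [lej rj et]]] : exists j (cf : config machine),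
    [/\ j <= k, @run machine j (lift ord0 (enum_rank (@finit _ F)), t) = Some cf
    & itape_of cf.2 = t'].
  exists j.+1, cf; split=> //.
  rewrite -rj; case: t {r rj} => [[l h] r] /=.
  by rewrite unlift_none.
rewrite /ex in r; move: (finit) r => q; move et0: (itape_of t) => u r.
elim: r t et0 => {q u k x t'} [q u k x e t eu|q u k x t' q' w m e _ IH t eu].
  exists 0, (lift ord0 (enum_rank q), t); split=> //.
  have -> c : @run machine 0 c = if step c is Some _ then None else Some c.
    by rewrite /=; case: step.
  rewrite -eu in e; case: t {eu} e => [[l h] r] /= e.
  by rewrite liftK enum_rankK e.
have [j [cf [lej rj et]]] := IH (move_head t w m) ltac:(by rewrite itape_of_move eu).
exists j.+1, cf; split=> //.
rewrite -rj -eu in e *; case: t {rj eu} e => [[l h] r] /= e.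
by rewrite liftK enum_rankK e.
Qed.
End Machine.

(** * Rewriting a word block by block *)

Notation bits := (map bit_sym).

Definition mk (l x : seq sym) : itape := (nth Blank l, nth Blank x).

(* The head scans the first cell of [l]. *)
Definition mkL (l x : seq sym) : itape := mk (behead l) (head Blank l :: x).

Lemma mk_moveR l x w : imove (mk l x) w MoveR = mk (w :: l) (behead x).
Proof.
congr pair; apply: functional_extensionality; first by case.
by case: x => //= i; rewrite !nth_nil.
Qed.

Lemma mkL_moveR l x w : imove (mkL l x) w MoveR = mk (w :: behead l) x.
Proof. by rewrite /mkL mk_moveR. Qed.

Lemma mk_moveL l x w : imove (mk l x) w MoveL = mkL l (w :: behead x).
Proof.
congr pair; apply: functional_extensionality.
  by case: l => //= i; rewrite !nth_nil.
by case=> [|[|i]]; case: l => [|? ?]; case: x => //= *; rewrite !nth_nil.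
Qed.

Lemma mkL_moveL l x w : imove (mkL l x) w MoveL = mkL (behead l) (w :: x).
Proof. by rewrite /mkL mk_moveL. Qed.

Lemma mk_head l x : (mk l x).2 0 = head Blank x. Proof. by case: x. Qed.

Lemma nth_cat_Blank l k : nth Blank (l ++ nseq k Blank) = nth Blank l.
Proof.
apply: functional_extensionality => i; rewrite nth_cat nth_nseq if_same.
by case: ltnP => // le; rewrite nth_default.
Qed.

Lemma mk_catl l k x : mk (l ++ nseq k Blank) x = mk l x.
Proof. by rewrite /mk nth_cat_Blank. Qed.
Lemma mk_catr l k x : mk l (x ++ nseq k Blank) = mk l x.
Proof. by rewrite /mk nth_cat_Blank. Qed.
Lemma mkL_catl l x : mkL (l ++ [:: Blank]) x = mkL l x.
Proof. by case: l => // a l; rewrite /mkL /= (mk_catl l 1). Qed.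
Lemma mkL_catr l k x : mkL l (x ++ nseq k Blank) = mkL l x.
Proof. exact: (mk_catr _ _ (_ :: x)). Qed.

Lemma mk_stay l x : imove (mk l x) (head Blank x) Stay = mk l x.
Proof. by rewrite -(mk_head l x) imove_stay. Qed.

Definition scan (m1 m2 : move) : frag unit :=
  loop (fun _ : unit => bind (tick (fun b => (b, if b then m1 else m2)))
    (fun b => ret (if b then inl tt else inr tt))) tt.

Lemma ex_scan_stop m1 m2 t : t.2 0 = Blank ->
  ex (scan m1 m2) t 2 tt (imove t Blank m2).
Proof.
move=> t0; apply: ex_loop_done.
have := ex_tick (fun b => (b, if b then m1 else m2)) t0.
by move=> H; apply: (ex_bind H) => {H}; [apply: (ex_ret _ _ 0)|].
Qed.

Lemma ex_scan_step m1 m2 t k t1 b : t.2 0 = bit_sym b ->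
  ex (scan m1 m2) (imove t (bit_sym b) m1) k tt t1 -> ex (scan m1 m2) t k.+3 tt t1.
Proof.
move=> t0 H; apply: (ex_loop_next (k := 2) _ H) => {H} //.
have := ex_tick (fun b => (b, if b then m1 else m2)) t0.
rewrite bit_symK /=.
by move=> H; apply: (ex_bind H) => {H}; [apply: (ex_ret _ _ 0)|].
Qed.

Lemma ex_scanR m2 l s x :
  ex (scan MoveR m2) (mk l (bits s ++ Blank :: x)) (3 * size s + 2) tt
    (imove (mk (rev (bits s) ++ l) (Blank :: x)) Blank m2).
Proof.
elim: s l => [|b s IH] l; first exact: ex_scan_stop.
rewrite /= mulnS; apply: ex_scan_step; first by rewrite mk_head.
by rewrite mk_moveR /= rev_cons cat_rcons; apply: IH.
Qed.

Lemma ex_scanL l s x :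
  ex (scan MoveL MoveL) (mkL (rev (bits s) ++ Blank :: l) x) (3 * size s + 2) tt
    (mkL l (Blank :: bits s ++ x)).
Proof.
elim/last_ind: s x => [|s b IH] x.
  by rewrite -(mkL_moveL (Blank :: l)); apply: ex_scan_stop.
rewrite map_rcons rev_rcons size_rcons mulnS /=; apply: (@ex_scan_step _ _ _ _ _ b); first by rewrite mk_head.
by rewrite mkL_moveL /= cat_rcons; apply: IH.
Qed.

(** The bits are erased while they are read, so that the next block becomes the right end of the
    word. *)
Fixpoint read_back k : frag (k.-tuple bool) :=
  if k is k'.+1 then
    bind (tick (fun _ => (None, MoveL))) (fun b =>
      bind (read_back k') (fun t => ret (rcons_tuple t (odflt false b))))
  else ret [tuple].

Lemma ex_read_back k (u : k.-tuple bool) l x :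
  ex (read_back k) (mkL (rev (bits u) ++ l) x) (3 * k) u (mkL l (nseq k Blank ++ x)).
Proof.
elim: k u x => [|k IH] u x; first by rewrite (tuple0 u); apply: ex_ret.
case/tupleP: u => a u.
have [v [b ev]] : exists (v : k.-tuple bool) b, val u = behead (rcons v b) /\ a = head a (rcons v b).
  by exists [tuple of belast a u], (last a u); rewrite -lastI.
have eu : [tuple of a :: u] = rcons_tuple v b.
  apply: val_inj => /=; case: ev => -> {1}->.
  by case: (rcons v b) (size_rcons v b).
rewrite eu /= map_rcons rev_rcons mulnS.
apply: (ex_bind (t1 := mkL (rev (bits v) ++ l) (Blank :: x)) (x := Some b) (k := 1) (k1 := 3 * k + 1)).
- have := ex_tick (fun _ => (None, MoveL)) (mk_head _ _ : (mkL (bit_sym b :: rev (bits v) ++ l) x).2 0 = _).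
  by rewrite mkL_moveL /= bit_symK.
- have := IH v (Blank :: x); rewrite -[Blank :: x](cat1s) catA -(nseqD k 1) addn1.
  by move=> H; apply: (ex_bind H) => {H}; [apply: (ex_ret _ _ 0)|rewrite addn0 addn1].
- by lia.
Qed.

Fixpoint write_back (s : seq bool) : frag unit :=
  if s is b :: s' then bind (tick (fun _ => (Some b, MoveL))) (fun _ => write_back s')
  else ret tt.

Lemma ex_write_back s x :
  ex (write_back s) (mkL [::] x) (2 * size s) tt (mkL [::] (bits (rev s) ++ x)).
Proof.
elim: s x => [|b s IH] x; first exact: ex_ret.
have := ex_tick (fun _ => (Some b, MoveL)) (erefl ((mkL [::] x).2 0)).
rewrite mkL_moveL /= => H; apply: (ex_bind H) => {H}.
- by rewrite rev_cons map_rcons cat_rcons; apply: IH.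
- by rewrite mulnS add2n.
Qed.

Definition go m : frag unit := bind (tick (fun b => (b, m))) (fun _ => ret tt).
Lemma ex_go m t : ex (go m) t 2 tt (imove t (t.2 0) m).
Proof.
have := ex_tick (fun b => (b, m)) (erefl (t.2 0)).
by rewrite /= sym_bitK => H; apply: (ex_bind H) => {H}; [apply: (ex_ret _ _ 0)|].
Qed.

Section Transfer.
Variables (k : nat) (Q : finType) (f : Q -> k.-tuple bool -> Q * seq bool).
Hypothesis k_gt0 : 0 < k.

(** The state travels from right to left, following the order in which the machine takes the
    blocks. *)
Fixpoint xfold (q : Q) (w : seq (k.-tuple bool)) : Q * seq bool :=
  if w is t :: w' then
    let: (q1, o1) := xfold q w' in let: (q2, o) := f q1 t in (q2, o ++ o1)
  else (q, [::]).

Lemma xfold_rcons q w t :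
  xfold q (rcons w t) = ((xfold (f q t).1 w).1, (xfold (f q t).1 w).2 ++ (f q t).2).
Proof.
elim: w => [|u w IH] /=; first by case: (f q t) => q' o; rewrite /= cats0.
by rewrite IH; case: (xfold _ w) => q1 o1 /=; case: (f q1 u) => q2 o /=; rewrite catA.
Qed.

Definition xfer_body (q : Q) : frag (Q + Q) :=
  bind (tick (fun b => (b, if b then Stay else MoveL))) (fun b =>
  if b is None then ret (inr q) else
  bind (scan MoveR MoveL) (fun _ =>
  bind (read_back k) (fun t =>
  bind (scan MoveL MoveL) (fun _ =>
  bind (scan MoveL MoveL) (fun _ =>
  bind (go MoveR) (fun _ =>
  bind (write_back (rev (f q t).2)) (fun _ =>
  bind (go MoveR) (fun _ =>
  bind (scan MoveR MoveR) (fun _ => ret (inl (f q t).1)))))))))).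

(* Blocks are taken one at a time from the right end of the word and the
   output is written leftwards, beyond a blank cell left of the word. *)
Definition xfer (q : Q) : frag Q :=
  bind (loop xfer_body q) (fun q' =>
  bind (go MoveL) (fun _ =>
  bind (scan MoveL MoveL) (fun _ =>
  bind (go MoveR) (fun _ =>
  bind (go MoveR) (fun _ => ret q'))))).

Definition unblock (w : seq (k.-tuple bool)) : seq bool := flatten (map val w).

Lemma size_unblock w : size (unblock w) = k * size w.
Proof. by elim: w => [|t w IH]; rewrite ?muln0 //= size_cat IH size_tuple mulnS. Qed.

(** Loop invariant of the tape: output, one blank, remaining input, with the head at the start of
    the latter. An exhausted input is recognized by a blank under the head. *)
Definition mid (out raw : seq bool) : itape :=
  mk (Blank :: rev (bits out)) (bits raw).

Lemma ex_xfer_body q out w t :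
  ex (xfer_body q) (mid out (unblock (rcons w t)))
     (40 + 6 * (size out + k * (size w).+1 + size (f q t).2))
     (inl (f q t).1) (mid ((f q t).2 ++ out) (unblock w)).
Proof.
have eqw : unblock (rcons w t) = unblock w ++ t.
  by rewrite /unblock map_rcons flatten_rcons.
have sz : size (unblock w ++ t) = k * (size w).+1.
  by rewrite size_cat size_unblock size_tuple mulnS addnC.
have [c [s es]] : exists c s, unblock w ++ t = c :: s.
  by case: (_ ++ _) sz => [|c s] sz; [move: sz; rewrite mulnS /=; lia|exists c, s].
pose o := (f q t).2.
have : (mid out (unblock (rcons w t))).2 0 = bit_sym c by rewrite eqw es.
move/(ex_tick (fun b => (b, if b then Stay else MoveL))).
rewrite eqw es bit_symK /=.
have := mk_stay (Blank :: rev (bits out)) (bits (c :: s)).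
rewrite /= => -> H; apply: (ex_bind H) => {H}.
  rewrite -[bit_sym c :: _]/(bits (c :: s)) -es map_cat.
- have := ex_scanR MoveL (Blank :: rev (bits out)) (c :: s) [::].
  rewrite (mk_catr _ 1) mk_moveL -es map_cat rev_cat -catA => H1; apply: (ex_bind H1).
  have := ex_read_back t (rev (bits (unblock w)) ++ Blank :: rev (bits out)) [:: Blank].
  rewrite -(nseqD k 1) -[nseq _ _]cat0s mkL_catr => H2; apply: (ex_bind H2).
  have := ex_scanL (rev (bits out)) (unblock w) [::] => H3; apply: (ex_bind H3).
  have := ex_scanL [::] out (Blank :: bits (unblock w) ++ [::]).
  rewrite mkL_catl => H4; apply: (ex_bind H4).
  have := ex_go MoveR (mkL [::] (Blank :: bits out ++ Blank :: bits (unblock w) ++ [::])).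
  rewrite mk_head mkL_moveR /= => H5; apply: (ex_bind H5).
  have := ex_write_back (rev o) (bits out ++ Blank :: bits (unblock w) ++ [::]).
  rewrite (_ : mkL [::] _ = mk [:: Blank] (Blank :: bits out ++ Blank :: bits (unblock w) ++ [::])); last first.
    exact: esym (mk_catl [::] 1 _).
  rewrite revK => H6; apply: (ex_bind H6).
  have := ex_go MoveR (mkL [::] (bits o ++ bits out ++ Blank :: bits (unblock w) ++ [::])).
  rewrite mk_head mkL_moveR /= (mk_catl [::] 1) => H7; apply: (ex_bind H7).
  have := ex_scanR MoveR [::] (o ++ out) (bits (unblock w) ++ [::]).
  rewrite !cats0 map_cat -catA mk_moveR /= => H8; apply: (ex_bind H8).
  + by rewrite /mid map_cat; apply: (ex_ret _ _ 0).
  1-8: exact: ltnSn.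
  rewrite sz size_rev size_unblock size_cat -/o mulnS; lia.
Qed.
(** [M] bounds the length of output and remaining input during the whole run, since a block adds at
    most [L] bits of output. Each iteration walks over both a bounded number of times. *)
Lemma ex_xfer_loop L M q out w :
  (forall q t, size (f q t).2 <= L) -> size out + (L + k) * size w <= M ->
  ex (loop xfer_body q) (mid out (unblock w)) ((size w).+1 * (50 + 6 * M))
    (xfold q w).1 (mkL (Blank :: rev (bits ((xfold q w).2 ++ out))) [:: Blank]).
Proof.
move=> leL; elim/last_ind: w q out => [|w t IH] q out leM.
  rewrite mul1n; apply: ex_leq (leq_addr _ _) _; apply: ex_loop_done.
  have H := ex_tick (fun b => (b, if b then Stay else MoveL)) (erefl Blank : (mid out [::]).2 0 = Blank).
  by rewrite mk_moveL in H; apply: (ex_bind H); first exact: (ex_ret _ _ 0).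
rewrite xfold_rcons -catA /=.
move: (IH (f q t).1 ((f q t).2 ++ out)) => /= {}IH.
have := leL q t; rewrite size_rcons in leM * => leLt.
apply: ex_loop_next (ex_xfer_body q out w t) _ _; first apply: IH.
  by rewrite size_cat; rewrite mulnS in leM; lia.
by rewrite mulSn; move: leM; rewrite !mulnDl !mulnS; lia.
Qed.

Lemma ex_xfer : exists c, forall w q,
  ex (xfer q) (mk [::] (bits (unblock w))) (c * (size w).+1 ^ 2)
    (xfold q w).1 (mk [::] (bits (xfold q w).2)).
Proof.
pose L := \max_(p : Q * k.-tuple bool) size (f p.1 p.2).2.
exists (80 + 12 * (L + k)) => w q; pose o := (xfold q w).2.
have leL q' t : size (f q' t).2 <= L.
  exact: (@leq_bigmax _ (fun p : Q * k.-tuple bool => size (f p.1 p.2).2) (q', t)).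
have := @ex_xfer_loop L _ q [::] w leL (leqnn _).
rewrite cats0 -/o /mid (mk_catl [::] 1) => H0; apply: (ex_bind H0).
  have := ex_go MoveL (mkL (Blank :: rev (bits o)) [:: Blank]).
  rewrite mk_head mkL_moveL /= => H1; apply: (ex_bind H1).
  have := ex_scanL [::] o [:: Blank; Blank].
  rewrite mkL_catl => H2; apply: (ex_bind H2).
  have := ex_go MoveR (mkL [::] (Blank :: bits o ++ [:: Blank; Blank])).
  rewrite mk_head mkL_moveR /= => H3; apply: (ex_bind H3).
  have := ex_go MoveR (mk [:: Blank] (Blank :: bits o ++ [:: Blank; Blank])).
  rewrite mk_head mk_moveR /= (mk_catr _ 2) (mk_catl [::] 2) => H4; apply: (ex_bind H4).
  exact: (ex_ret _ _ 0).
1-4: exact: ltnSn.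
have : size o <= L * size w.
  rewrite /o; elim: w {o H0} q => [|t w IH] q //=.
  case e: (xfold q w) => [q1 o1]; case e2: (f q1 t) => [q2 o2] /=.
  by rewrite size_cat mulnS leq_add //; [have := leL q1 t; rewrite e2|have := IH q; rewrite e].
rewrite /= add0n; move: (size w) (size o) (L) => s so l; nia.
Qed.
End Transfer.

(** The form of bound demanded by [polytime_on_circle_graphs], with one number as factor and
    exponent. [pb_add] leaves room for the step of a [bind], and [pb_mul] absorbs a loop. *)
Definition pb c n := c * (n * n).+1 ^ c.

Lemma leq_pb a b n : a <= b -> pb a n <= pb b n.
Proof. by move=> ab; rewrite leq_mul // leq_pexp2l. Qed.

Lemma pb_add a b n : pb a n + pb b n < pb (a + b).+1 n.
Proof.
rewrite /pb mulSn -add1n leq_add ?expn_gt0 //.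
by rewrite mulnDl leq_add // leq_mul // leq_pexp2l //; lia.
Qed.

Lemma pb_mul a n m : m <= (n * n).+1 -> m * pb a n <= pb a.+1 n.
Proof.
move=> le; rewrite /pb expnS mulnCA.
by rewrite leq_mul // leq_mul.
Qed.

Lemma leq_pb_const k n : k <= pb k n.
Proof. by rewrite leq_pmulr // expn_gt0. Qed.

(** * Automata sweeping over a word of cells *)

Section Cells.
Variable I : finType.
Hypothesis I_gt0 : 0 < #|I|.
Notation cell := {ffun I -> bool}.

Definition tp (w : seq cell) : itape :=
  mk [::] (bits (unblock (map (@fgraph _ _) w))).

Section Sweep.
Variables (Q : finType) (f : Q -> cell -> Q * cell).

Fixpoint mealy (q : Q) (w : seq cell) : Q * seq cell :=
  if w is g :: w' then
    let: (q1, w1) := mealy q w' in let: (q2, g') := f q1 g in (q2, g' :: w1)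
  else (q, [::]).

Definition sweep : Q -> frag Q :=
  xfer (fun q t => ((f q (Finfun t)).1, val (fgraph (f q (Finfun t)).2))).

(** A closed formula [st] for the state at each position certifies the sweep, so each automaton
    below is verified by a local check at a single entry. The index decreases because the sweep goes
    leftwards. *)
Lemma ex_sweep : exists c, forall n (c1 c2 : nat -> cell) st,
  (forall p, p < n * n -> f (st p.+1) (c1 p) = (st p, c2 p)) ->
  ex (sweep (st (n * n))) (tp (mkseq c1 (n * n))) (pb c n) (st 0)
    (tp (mkseq c2 (n * n))).
Proof.
have [c Hc] := ex_xfer (fun q t => ((f q (Finfun t)).1, val (fgraph (f q (Finfun t)).2))) I_gt0.
exists c.+2 => n c1 c2 st Hst.
have xE q w : xfold (fun q t => ((f q (Finfun t)).1, val (fgraph (f q (Finfun t)).2))) q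
     (map (@fgraph _ _) w) =
  ((mealy q w).1, unblock (map (@fgraph _ _) (mealy q w).2)).
  elim: w => //= g w ->; case: (mealy q w) => q1 w1 /=.
  by rewrite fgraphK; case: (f q1 g).
have mE : mealy (st (n * n)) (mkseq c1 (n * n)) = (st 0, mkseq c2 (n * n)).
  elim: (n * n) c1 c2 st Hst => //= N IH c1 c2 st Hst.
  have iota1 (T : Type) (h : nat -> T) : map h (iota 1 N) = mkseq (fun p => h p.+1) N.
    by rewrite -[1]addn0 iotaDl -map_comp.
  have := IH (fun p => c1 p.+1) (fun p => c2 p.+1) (fun p => st p.+1) (fun p lt => Hst p.+1 lt).
  by rewrite /mkseq /= !iota1 => ->; rewrite Hst.
have := Hc (map (@fgraph _ _) (mkseq c1 (n * n))) (st (n * n)).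
rewrite xE mE /= size_map size_mkseq; apply: ex_leq.
by rewrite /pb leq_mul // ?leq_pexp2l //; lia.
Qed.
End Sweep.

Lemma ex_load (g : bool -> cell) : exists F : frag unit, exists c, forall n s,
  size s = n * n -> ex F (mk [::] (bits s)) (pb c n) tt (tp (map g s)).
Proof.
pose f (q : unit) (t : 1.-tuple bool) := (tt, val (fgraph (g (thead t)))).
have [c Hc] := ex_xfer f (isT : 0 < 1).
exists (xfer f tt), c.+2 => n s sz.
have := Hc [seq [tuple b] | b <- s] tt.
have -> : unblock [seq [tuple b] | b <- s] = s by elim: (s) => //= b s' {2}<-.
have -> : xfold f tt [seq [tuple b] | b <- s] = (tt, unblock (map (@fgraph _ _) (map g s))).
  by elim: (s) => //= b s' ->; rewrite theadE.
rewrite /= size_map sz; apply: ex_leq.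
by rewrite /pb leq_mul // ?leq_pexp2l //; lia.
Qed.

Lemma ex_unload (g : cell -> seq bool) : exists F : frag unit, exists c, forall n w,
  size w = n * n -> ex F (tp w) (pb c n) tt (mk [::] (bits (flatten (map g w)))).
Proof.
pose f (q : unit) (t : #|I|.-tuple bool) := (tt, g (Finfun t)).
have [c Hc] := ex_xfer f I_gt0.
exists (xfer f tt), c.+2 => n w sz.
have := Hc (map (@fgraph _ _) w) tt.
have -> : xfold f tt (map (@fgraph _ _) w) = (tt, flatten (map g w)).
  by elim: (w) => //= b s' ->; rewrite fgraphK.
rewrite /= size_map sz; apply: ex_leq.
by rewrite /pb leq_mul // ?leq_pexp2l //; lia.
Qed.
End Cells.

(** * A language of loops over the vertices *)

Definition data := nat -> nat -> nat -> bool.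

(* Variables are de Bruijn levels, and [Ex] and [For] bind the next level. *)
Inductive bexp :=
| Cell of nat & nat & nat
| Lt of nat & nat
| Not of bexp
| And of bexp & bexp
| Ex of bexp.

Inductive stmt :=
| Set_ of nat & nat & nat & bexp
| Seq of stmt & stmt
| If of bexp & stmt
| For of stmt.

Definition upd (d : data) a x y b : data :=
  fun a' x' y' => if [&& a' == a, x' == x & y' == y] then b else d a' x' y'.

Section Semantics.
Variable n : nat.

Fixpoint bev (b : bexp) (rho : seq nat) (d : data) : bool :=
  match b with
  | Cell a x y => d a (nth 0 rho x) (nth 0 rho y)
  | Lt x y => nth 0 rho x < nth 0 rho y
  | Not b => ~~ bev b rho d
  | And b c => bev b rho d && bev c rho d
  | Ex b => has (fun i => bev b (rcons rho i) d) (iota 0 n)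
  end.

Fixpoint exec (s : stmt) (rho : seq nat) (d : data) : data :=
  match s with
  | Set_ a x y b => upd d a (nth 0 rho x) (nth 0 rho y) (bev b rho d)
  | Seq s1 s2 => exec s2 rho (exec s1 rho d)
  | If b s => if bev b rho d then exec s rho d else d
  | For s => foldr (fun i d => exec s (rcons rho i) d) d (iota 0 n)
  end.
End Semantics.

(** * Compilation of programs into sweeps *)

Section Compile.
Variables K A : nat.

Fixpoint bwf (b : bexp) (k : nat) : bool :=
  match b with
  | Cell a x y => [&& a <= A, x < k & y < k]
  | Lt x y => (x < k) && (y < k)
  | Not b => bwf b k
  | And b c => bwf b k && bwf c k
  | Ex b => (k <= K) && bwf b k.+1
  end.

Fixpoint swf (s : stmt) (k : nat) : bool :=
  match s with
  | Set_ a x y b => [&& a <= A, x < k, y < k & bwf b k]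
  | Seq s1 s2 => swf s1 k && swf s2 k
  | If b s => bwf b k && swf s k
  | For s => (k <= K) && swf s k.+1
  end.

(* The bits of a matrix entry: the last one of its row, the row and the column
   marks of the variables, and the data. *)
Definition idx : finType := option (('I_K.+1 * bool) + 'I_A.+1).
Notation cell := {ffun idx -> bool}.

Definition row v : idx := Some (inl (inord v, false)).
Definition col v : idx := Some (inl (inord v, true)).
Definition dat a : idx := Some (inr (inord a)).

Lemma idx_gt0 : 0 < #|idx|. Proof. by apply/card_gt0P; exists None. Qed.

(* A variable that is marked nowhere has value 0 in [e], the others have their
   value plus one. *)
Definition entry n (e : seq nat) (d : data) (p : nat) : cell :=
  [ffun i : idx => match i : option (('I_K.+1 * bool) + 'I_A.+1) with
   | None => (p %% n).+1 == n
   | Some (inl (v, false)) => nth 0 e v == (p %/ n).+1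
   | Some (inl (v, true)) => nth 0 e v == (p %% n).+1
   | Some (inr a) => d a (p %/ n) (p %% n)
   end].

Definition wrd n e d := tp (mkseq (entry n e d) (n * n)).

Lemma entryP n p : p < n * n ->
  exists i j, [/\ i < n, j < n, p = i * n + j, p %/ n = i & p %% n = j].
Proof.
move=> lt; exists (p %/ n), (p %% n); have n0 : 0 < n by case: n lt.
by rewrite ltn_divLR // ltn_pmod // -divn_eq.
Qed.

Lemma entry_lt n i j : i < n -> j < n -> i * n + j < n * n.
Proof. by move=> *; nia. Qed.

Lemma entry_row n e d p v : v <= K -> entry n e d p (row v) = (nth 0 e v == (p %/ n).+1).
Proof. by move=> le; rewrite ffunE /= inordK. Qed.
Lemma entry_col n e d p v : v <= K -> entry n e d p (col v) = (nth 0 e v == (p %% n).+1).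
Proof. by move=> le; rewrite ffunE /= inordK. Qed.
Lemma entry_dat n e d p a : a <= A -> entry n e d p (dat a) = d a (p %/ n) (p %% n).
Proof. by move=> le; rewrite ffunE /= inordK. Qed.
Lemma entry_end n e d p : entry n e d p None = ((p %% n).+1 == n).
Proof. by rewrite ffunE. Qed.

(** The marked row of [x] and the marked column of [y] cross in a single entry, so a disjunction
    over the whole matrix reads that entry. *)
Definition get a x y : frag bool :=
  sweep (fun (q : bool) (g : cell) =>
    (q || [&& g (row x), g (col y) & g (dat a)], g)) false.

Lemma ex_get a x y : a <= A -> x <= K -> y <= K -> exists c, forall n rho d,
  all (ltn^~ n) rho -> x < size rho -> y < size rho ->
  ex (get a x y) (wrd n (map S rho) d) (pb c n)
     (d a (nth 0 rho x) (nth 0 rho y)) (wrd n (map S rho) d).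
Proof.
move=> leA leK leK'.
have [c Hc] := ex_sweep idx_gt0 (fun (q : bool) (g : cell) =>
    (q || [&& g (row x), g (col y) & g (dat a)], g)).
exists c => n rho d.
move/(all_nthP 0) => lt lx ly.
have [i ei0] : exists i, nth 0 rho x = i by eexists.
have [j ej0] : exists j, nth 0 rho y = j by eexists.
have lti0 : i < n by rewrite -ei0; apply: lt.
have ltj0 : j < n by rewrite -ej0; apply: lt.
rewrite ei0 ej0.
pose st p := (p <= i * n + j) && d a i j.
have := Hc n (entry n (map S rho) d) (entry n (map S rho) d) st.
have -> : st (n * n) = false by rewrite /st leqNgt entry_lt.
have -> : st 0 = d a i j by [].
rewrite /st; apply=> p /entryP [i' [j' [lti ltj ep ei ej]]].
rewrite entry_row // entry_col // entry_dat // ei ej !(nth_map 0) // ei0 ej0 !eqSS.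
congr pair; case: (ltngtP p (i * n + j)) => //=.
- by case: eqP => [<-|_] /=; [case: eqP => [<-|_] /=|]; rewrite ?orbF ?orbb.
- move=> ltp; case: eqP => //= ei'; case: eqP => //= ej'; nia.
rewrite ep => e.
have ii : i = i' by nia.
have jj : j = j' by nia.
by rewrite -ii -jj !eqxx.
Qed.

Lemma entryS n i j p : i < n -> j < n -> p = i * n + j ->
  p.+1 = (if j.+1 == n then i.+1 else i) * n + (if j.+1 == n then 0 else j.+1).
Proof. by case: eqP => [<-|_] _ _ ->; rewrite ?mulSn; lia. Qed.

Lemma ltn_row i j c n : j < n -> (i * n + j < c * n) = (i < c).
Proof. by move=> lt; apply/idP/idP => H; nia. Qed.

Lemma ltS_row i j c n p : i < n -> j < n -> p = i * n + j ->
  (p.+1 < c * n) = if j.+1 == n then i.+1 < c else i < c.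
Proof.
move=> lti ltj ep; rewrite (entryS lti ltj ep).
case: eqP => e1; rewrite ltn_row //; first exact: leq_ltn_trans lti.
by rewrite ltn_neqAle ltj (introF eqP e1).
Qed.

(** The sweep meets the last rows first: [x] is smaller when its row is met after the row of [y] and
    is a different one. *)
Definition lt_vars x y : frag bool :=
  bind (sweep (fun (q : bool * bool) (g : cell) =>
    ((q.1 || g (row y), q.2 || [&& q.1, g (row x) & ~~ g (row y)]), g)) (false, false))
  (fun q => ret q.2).

Lemma ex_lt_vars x y : x <= K -> y <= K -> exists c, forall n rho d,
  all (ltn^~ n) rho -> x < size rho -> y < size rho ->
  ex (lt_vars x y) (wrd n (map S rho) d) (pb c n)
     (nth 0 rho x < nth 0 rho y) (wrd n (map S rho) d).
Proof.
move=> leK leK'.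
have [c Hc] := ex_sweep idx_gt0 (fun (q : bool * bool) (g : cell) =>
    ((q.1 || g (row y), q.2 || [&& q.1, g (row x) & ~~ g (row y)]), g)).
exists (c + 0).+1 => n rho d.
move/(all_nthP 0) => lt lx ly.
have [i ei0] : exists i, nth 0 rho x = i by eexists.
have [j ej0] : exists j, nth 0 rho y = j by eexists.
have lti0 : i < n by rewrite -ei0; apply: lt.
have ltj0 : j < n by rewrite -ej0; apply: lt.
rewrite ei0 ej0.
pose st p := (p < j.+1 * n, (i < j) && (p < i.+1 * n)).
have := Hc n (entry n (map S rho) d) (entry n (map S rho) d) st.
have -> : st (n * n) = (false, false).
  by rewrite /st !ltnNge !leq_mul2r lti0 ltj0 !orbT andbF.
have -> : st 0 = (true, i < j).
  by rewrite /st !muln_gt0 (leq_ltn_trans (leq0n _) lti0) !andbT.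
move=> H; eapply ex_bind; [apply: H|exact: (ex_ret _ _ 0)|]; last first.
  exact: (pb_add c 0 n).
move=> p /entryP [i' [j' [lti ltj ep ei ej]]].
rewrite !entry_row // ei !(nth_map 0) // ei0 ej0 !eqSS /st.
rewrite /= !(ltS_row _ lti ltj ep) ep !ltn_row // {Hc lt st ep ei ej}.
congr pair; congr pair; case: ifP => _; apply/idP/idP => H; lia.
Qed.

Definition put a x y b : frag unit :=
  sweep (fun (q : unit) (g : cell) =>
    (q, [ffun i => if [&& i == dat a, g (row x) & g (col y)] then b else g i])) tt.

Lemma ex_put a x y b : a <= A -> x <= K -> y <= K -> exists c, forall n rho d,
  all (ltn^~ n) rho -> x < size rho -> y < size rho ->
  ex (put a x y b) (wrd n (map S rho) d) (pb c n) tt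
     (wrd n (map S rho) (upd d a (nth 0 rho x) (nth 0 rho y) b)).
Proof.
move=> leA leK leK'.
have [c Hc] := ex_sweep idx_gt0 (fun (q : unit) (g : cell) =>
    (q, [ffun i => if [&& i == dat a, g (row x) & g (col y)] then b else g i])).
exists c => n rho d lt lx ly; apply: (Hc _ _ _ (fun _ => tt)) => p ltp.
congr pair; apply/ffunP => k; rewrite ffunE entry_row // entry_col //.
rewrite !(nth_map 0) // !eqSS.
case: k => [[[v b']|a']|]; rewrite !ffunE //.
rewrite /upd (_ : (Some (inr a') == dat a) = (a' == a :> nat)) ?(eq_sym (p %/ n)) ?(eq_sym (p %% n)) //.
by apply/eqP/eqP => [[->]|e]; rewrite ?inordK //; congr (Some (inr _)); apply: val_inj; rewrite /= inordK.
Qed.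

Definition any x : frag bool :=
  sweep (fun (q : bool) (g : cell) => (q || g (row x), g)) false.

Lemma ex_any x : x <= K -> exists c, forall n e d, nth 0 e x <= n ->
  ex (any x) (wrd n e d) (pb c n) (0 < nth 0 e x) (wrd n e d).
Proof.
move=> leK.
have [c Hc] := ex_sweep idx_gt0 (fun (q : bool) (g : cell) => (q || g (row x), g)).
exists c => n e d len.
pose st p := p < nth 0 e x * n.
have := Hc n (entry n e d) (entry n e d) st.
have -> : st (n * n) = false by rewrite /st ltnNge leq_mul2r len orbT.
have -> : st 0 = (0 < nth 0 e x).
  by rewrite /st muln_gt0 andb_idr // => /leq_trans; apply.
apply=> p /entryP [i [j [lti ltj ep ei ej]]].
rewrite entry_row // ei /st (ltS_row _ lti ltj ep) ep ltn_row //; congr pair.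
by case: ifP => _; apply/idP/idP => H; lia.
Qed.

Lemma nth0_rcons e m u : nth 0 (rcons e m) u = if u == size e then m else nth 0 e u.
Proof. by rewrite nth_rcons; case: ltngtP => // lt; rewrite nth_default // ltnW. Qed.

Lemma entry_rcons0 n e d : wrd n (rcons e 0) d = wrd n e d.
Proof.
congr tp; apply: eq_mkseq => p; apply/ffunP => k; rewrite !ffunE.
case: k => [[[v []]|a]|] //; rewrite nth0_rcons; case: (eqVneq (v : nat) (size e)) => // ->;
  by rewrite nth_default.
Qed.

(** The first component tells that one row end has been met, [q'.2] that two have been met. The
    second fails exactly in the last row. *)
Definition push v : frag unit :=
  bind (sweep (fun (q : bool * bool) (g : cell) =>
    let q' := (g None || q.1, if g None then q.1 else q.2) in
    (q', [ffun i => if i == row v then ~~ q'.2 else if i == col v then g None else g i]))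
    (false, false))
  (fun _ => ret tt).

Lemma row_eq v (u : 'I_K.+1) b : v <= K ->
  (Some (inl (u, b)) == row v) = (u == v :> nat) && ~~ b.
Proof.
move=> le; apply/eqP/andP => [[-> ->]|[/eqP e /negbTE ->]]; first by rewrite inordK.
by congr (Some (inl (_, _))); apply: val_inj; rewrite /= inordK.
Qed.

Lemma col_eq v (u : 'I_K.+1) b : v <= K ->
  (Some (inl (u, b)) == col v) = (u == v :> nat) && b.
Proof.
move=> le; apply/eqP/andP => [[-> ->]|[/eqP e ->]]; first by rewrite inordK.
by congr (Some (inl (_, _))); apply: val_inj; rewrite /= inordK.
Qed.

Lemma ex_push v : v <= K -> exists c, forall n e d, size e = v ->
  ex (push v) (wrd n e d) (pb c n) tt (wrd n (rcons e n) d).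
Proof.
move=> leK.
have [c Hc] := ex_sweep idx_gt0 (fun (q : bool * bool) (g : cell) =>
    let q' := (g None || q.1, if g None then q.1 else q.2) in
    (q', [ffun i => if i == row v then ~~ q'.2 else if i == col v then g None else g i])).
exists (c + 0).+1 => n e d sz.
pose st p := (p < n * n, p < n.-1 * n).
have := Hc n (entry n e d) (entry n (rcons e n) d) st.
have -> : st (n * n) = (false, false).
  by rewrite /st ltnn ltnNge leq_mul2r leq_pred orbT.
move=> H; eapply ex_bind; [apply: H|exact: (ex_ret _ _ 0)|]; last first.
  exact: (pb_add c 0 n).
move=> p /[dup] ltp /entryP [i [j [lti ltj ep ei ej]]].
have st1 : ((j.+1 == n) || (p.+1 < n * n)) = (p < n * n).
  by rewrite (ltS_row _ lti ltj ep) ltp lti; case: ifP.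
have st2 : (if j.+1 == n then p.+1 < n * n else p.+1 < n.-1 * n) = (p < n.-1 * n).
  rewrite !(ltS_row _ lti ltj ep) ep ltn_row //; case: (j.+1 == n) => //.
  by rewrite ltn_predRL.
have st3 : (p < n.-1 * n) = (i.+1 != n).
  by rewrite ep ltn_row //; apply/idP/idP; lia.
rewrite /= entry_end ej /st st1 st2; congr pair; apply/ffunP => k; rewrite !ffunE st3 negbK.
case: k => [[[u b]|a]|] /=; rewrite ?ei ?ej //.
by rewrite row_eq // col_eq // nth0_rcons sz; case: (eqVneq (u : nat) v); case: b => //=; rewrite eq_sym.
Qed.

(** A column mark is copied from the cell just scanned, within the row. A row mark has to be carried
    over a whole row: at a row end [nxt] takes the mark of the cell just scanned, which lies in the
    row below, and keeps it up to the next row end. From value 1 the mark disappears. *)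
Definition shift v : frag unit :=
  bind (sweep (fun (q : bool * bool * bool) (g : cell) =>
    let nxt := if g None then q.1.2 else q.1.1 in
    ((nxt, g (row v), g (col v)),
     [ffun i => if i == row v then nxt else
                if i == col v then ~~ g None && q.2 else g i]))
    (false, false, false))
  (fun _ => ret tt).

Lemma ex_shift v : v <= K -> exists c, forall n e d m, size e = v -> m < n ->
  ex (shift v) (wrd n (rcons e m.+1) d) (pb c n) tt (wrd n (rcons e m) d).
Proof.
move=> leK.
have [c Hc] := ex_sweep idx_gt0 (fun (q : bool * bool * bool) (g : cell) =>
    let nxt := if g None then q.1.2 else q.1.1 in
    ((nxt, g (row v), g (col v)),
     [ffun i => if i == row v then nxt else
                if i == col v then ~~ g None && q.2 else g i])).
exists (c + 0).+1 => n e d m sz ltm.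
pose st p := ((p < n * n) && (m == (p %/ n).+1), (p < n * n) && (m == p %/ n),
  (p < n * n) && (m == p %% n)).
have := Hc n (entry n (rcons e m.+1) d) (entry n (rcons e m) d) st.
have -> : st (n * n) = (false, false, false) by rewrite /st ltnn.
move=> H; eapply ex_bind; [apply: H|exact: (ex_ret _ _ 0)|]; last first.
  exact: (pb_add c 0 n).
move=> p /[dup] ltp /entryP [i [j [lti ltj ep ei ej]]].
have n0 : 0 < n by apply: leq_ltn_trans lti.
rewrite /= entry_end entry_row // entry_col // nth0_rcons sz eqxx !eqSS ei ej.
have nxt : (if j.+1 == n then (st p.+1).1.2 else (st p.+1).1.1) = (m == i.+1).
  rewrite /st /= (entryS lti ltj ep) divnMDl //.
  case: eqP => e1; first rewrite div0n !addn0.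
    rewrite ltn_mul2r n0 /=; case: (ltngtP i.+1 n) lti => //= -> _.
    by rewrite ltn_eqF.
  have lt1 : j.+1 < n by rewrite ltn_neqAle ltj (introF eqP e1).
  by rewrite entry_lt // divn_small // addn0.
have nxc : (j.+1 != n) && (st p.+1).2 = (m == j.+1).
  rewrite /st /= (entryS lti ltj ep) modnMDl.
  case: eqP => e1 /=; first by rewrite e1 ltn_eqF.
  have lt1 : j.+1 < n by rewrite ltn_neqAle ltj (introF eqP e1).
  by rewrite entry_lt // modn_small.
rewrite nxt nxc; congr pair; first by rewrite /st ltp ei ej.
apply/ffunP => k; rewrite !ffunE.
case: k => [[[u b]|a]|] //=; rewrite ?ei ?ej // row_eq // col_eq // !nth0_rcons sz.
by case: (u == v :> nat); case: b.
Qed.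

Definition each_body (T : finType) k (F : T -> frag T) (s : T) : frag (T + T) :=
  bind (any k) (fun b =>
    if b then bind (F s) (fun s' => bind (shift k) (fun _ => ret (inl s')))
    else ret (inr s)).

(** The variable starts at the last vertex and moves down until its marks have left the matrix; this
    is the order in which [foldr] treats [iota 0 n]. The state in [T] serves as accumulator for
    [Ex]. *)
Definition each (T : finType) k (F : T -> frag T) (s : T) : frag T :=
  bind (push k) (fun _ => loop (each_body k F) s).

Lemma ex_each (T : finType) k (F : T -> frag T)
    (g : nat -> seq nat -> nat -> T * data -> T * data) : k <= K ->
  (exists c, forall n rho d s i, all (ltn^~ n) rho -> size rho = k -> i < n ->
     ex (F s) (wrd n (map S (rcons rho i)) d) (pb c n) (g n rho i (s, d)).1
       (wrd n (map S (rcons rho i)) (g n rho i (s, d)).2)) ->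
  exists c, forall n rho d s, all (ltn^~ n) rho -> size rho = k ->
    ex (each k F s) (wrd n (map S rho) d) (pb c n)
      (foldr (g n rho) (s, d) (iota 0 n)).1
      (wrd n (map S rho) (foldr (g n rho) (s, d) (iota 0 n)).2).
Proof.
move=> leK [c Hc].
have [a Ha] := ex_any leK; have [h Hh] := ex_shift leK; have [p Hp] := ex_push leK.
pose b := (a + (c + h).+1).+1 + 4.
exists (p + b.+2).+1 => n rho d s lt sz.
have leb : pb a n + pb c n + pb h n + 4 < pb b.+1 n.
  have := pb_add c h n; have := pb_add a (c + h).+1 n; have := leq_pb_const 4 n.
  have := pb_add (a + (c + h).+1).+1 4 n; rewrite -/b; lia.
have Hl m s1 d1 : m <= n ->
    ex (loop (each_body k F) s1) (wrd n (rcons (map S rho) m) d1) (m.+1 * pb b.+1 n)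
      (foldr (g n rho) (s1, d1) (iota 0 m)).1
      (wrd n (rcons (map S rho) 0) (foldr (g n rho) (s1, d1) (iota 0 m)).2).
  have szS : size (map S rho) = k by rewrite size_map.
  elim: m s1 d1 => [|m IH] s1 d1 le.
    have := Ha n (rcons (map S rho) 0) d1; rewrite nth0_rcons szS eqxx => /(_ isT) H.
    apply: ex_loop_done; rewrite /each_body; apply: (ex_bind H); first exact: (ex_ret _ _ 0).
    by rewrite mul1n; move: leb; lia.
  have -> : iota 0 m.+1 = iota 0 m ++ [:: m] by rewrite -addn1 iotaD.
  rewrite foldr_cat /=.
  have := Ha n (rcons (map S rho) m.+1) d1; rewrite nth0_rcons szS eqxx => /(_ le) H.
  have := Hc n rho d1 s1 m lt sz le; rewrite map_rcons => HF.
  case: (g n rho m (s1, d1)) HF => s2 d2 /= HF.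
  have Hs := Hh n (map S rho) d2 m szS le.
  eapply ex_loop_next; [|exact: IH (ltnW le)|].
    rewrite /each_body; apply: (ex_bind H); first apply: (ex_bind HF).
    - by apply: (ex_bind Hs); [exact: (ex_ret _ _ 0)|exact: ltnSn].
    - exact: ltnSn.
    - exact: ltnSn.
  by rewrite [m.+2 * _]mulSn; move: leb; lia.
have HP := Hp n (map S rho) d; rewrite size_map in HP.
apply: (ex_bind (HP sz)).
  by have := Hl n s d (leqnn n); rewrite entry_rcons0; apply.
apply: leq_ltn_trans (pb_add p b.+2 n); rewrite leq_add2l.
by apply: pb_mul; nia.
Qed.

Fixpoint cbexp (b : bexp) (k : nat) : frag bool :=
  match b with
  | Cell a x y => get a x y
  | Lt x y => lt_vars x y
  | Not b => bind (cbexp b k) (fun r => ret (~~ r))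
  | And b c => bind (cbexp b k) (fun r => if r then cbexp c k else ret false)
  | Ex b => each k (fun acc => bind (cbexp b k.+1) (fun r => ret (acc || r))) false
  end.

Fixpoint cstmt (s : stmt) (k : nat) : frag unit :=
  match s with
  | Set_ a x y b => bind (cbexp b k) (fun r => put a x y r)
  | Seq s1 s2 => bind (cstmt s1 k) (fun _ => cstmt s2 k)
  | If b s => bind (cbexp b k) (fun r => if r then cstmt s k else ret tt)
  | For s => each k (fun _ => cstmt s k.+1) tt
  end.

Lemma ex_cbexp b k : k <= K.+1 -> bwf b k ->
  exists c, forall n rho d, all (ltn^~ n) rho -> size rho = k ->
    ex (cbexp b k) (wrd n (map S rho) d) (pb c n) (bev n b rho d)
      (wrd n (map S rho) d).
Proof.
elim: b k => [a x y|x y|b IH|b IHb b' IHb'|b IH] k lek /=.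
- case/and3P=> leA lex ley.
  have [c Hc] := @ex_get a x y leA (leq_trans lex lek) (leq_trans ley lek).
  by exists c => n rho d lt sz; apply: Hc; rewrite ?sz.
- case/andP=> lex ley.
  have [c Hc] := @ex_lt_vars x y (leq_trans lex lek) (leq_trans ley lek).
  by exists c => n rho d lt sz; apply: Hc; rewrite ?sz.
- move=> /(IH _ lek)[c Hc]; exists (c + 0).+1 => n rho d lt sz.
  by apply: (ex_bind (Hc n rho d lt sz)) (pb_add _ _ _); apply: ex_ret.
- case/andP=> /(IHb _ lek)[c Hc] /(IHb' _ lek)[c' Hc'].
  exists (c + c').+1 => n rho d lt sz.
  apply: (ex_bind (Hc n rho d lt sz)) (pb_add _ _ _).
  by case: (bev n b rho d); [apply: Hc'|apply: ex_ret].
- case/andP=> leK /IH [//|c Hc].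
  have [|c' Hc'] := @ex_each _ k (fun acc => bind (cbexp b k.+1) (fun r => ret (acc || r)))
    (fun n rho i sd => (sd.1 || bev n b (rcons rho i) sd.2, sd.2)) leK.
    exists (c + 0).+1 => n rho d s i lt sz lti.
    apply: ex_bind (Hc n (rcons rho i) d _ _) _ (pb_add _ _ _); first last.
    - by apply: ex_ret.
    - by rewrite size_rcons sz.
    - by rewrite all_rcons; apply/andP.
  exists c' => n rho d lt sz; have := Hc' n rho d false lt sz.
  have -> : foldr (fun i sd => (sd.1 || bev n b (rcons rho i) sd.2, sd.2))
    (false, d) (iota 0 n) = (has (fun i => bev n b (rcons rho i) d) (iota 0 n), d).
    by elim: (iota 0 n) => //= i s ->; rewrite orbC.
  by [].
Qed.

(** The constant is chosen before n, by induction on the program: a composition adds two bounds, a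
    loop multiplies one by at most n + 1. *)
Lemma ex_cstmt s k : k <= K.+1 -> swf s k ->
  exists c, forall n rho d, all (ltn^~ n) rho -> size rho = k ->
    ex (cstmt s k) (wrd n (map S rho) d) (pb c n) tt
      (wrd n (map S rho) (exec n s rho d)).
Proof.
elim: s k => [a x y b|s IHs s' IHs'|b s IHs|s IHs] k lek /=.
- case/and4P=> leA lex ley /(ex_cbexp lek)[c Hc].
  have [c1 Hc1] := @ex_put a x y true leA (leq_trans lex lek) (leq_trans ley lek).
  have [c0 Hc0] := @ex_put a x y false leA (leq_trans lex lek) (leq_trans ley lek).
  exists (c + (c1 + c0)).+1 => n rho d lt sz.
  apply: (ex_bind (Hc n rho d lt sz)) (pb_add _ _ _).
  case: (bev n b rho d).
    by apply: ex_leq (Hc1 n rho d lt _ _); rewrite ?sz // leq_pb // leq_addr.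
  by apply: ex_leq (Hc0 n rho d lt _ _); rewrite ?sz // leq_pb // leq_addl.
- case/andP=> /(IHs _ lek)[c Hc] /(IHs' _ lek)[c' Hc'].
  exists (c + c').+1 => n rho d lt sz.
  by apply: (ex_bind (Hc n rho d lt sz)) (pb_add _ _ _); apply: Hc'.
- case/andP=> /(ex_cbexp lek)[c Hc] /(IHs _ lek)[c' Hc'].
  exists (c + c').+1 => n rho d lt sz.
  apply: (ex_bind (Hc n rho d lt sz)) (pb_add _ _ _).
  by case: (bev n b rho d); [apply: Hc'|apply: ex_ret].
- case/andP=> leK /IHs [//|c Hc].
  have [|c' Hc'] := @ex_each _ k (fun _ => cstmt s k.+1)
    (fun n rho i sd => (tt, exec n s (rcons rho i) sd.2)) leK.
    exists c => n rho d [] i lt sz lti.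
    by apply: Hc; rewrite ?size_rcons ?sz // all_rcons; apply/andP.
  exists c' => n rho d lt sz; have := Hc' n rho d tt lt sz.
  have -> : foldr (fun i sd => (tt, exec n s (rcons rho i) sd.2))
    (tt, d) (iota 0 n) = (tt, foldr (fun i d => exec n s (rcons rho i) d) d (iota 0 n)).
    by elim: (iota 0 n) => //= i s' ->.
  by [].
Qed.
End Compile.

(** * Finding the row length *)

Section Rows.
Variables K A : nat.
Hypothesis K_ge3 : 3 <= K.
Notation cell := {ffun idx K A -> bool}.
Notation row := (row K A).

(* Here positions are counted from the right end of the word, of length [N].
   The row marks of the variables 0, 1, 2, 3 serve as one-dimensional pointers,
   again with 0 for an absent mark. *)
Definition rcell (e : nat -> bool) (zs : seq nat) (D : nat -> bool) (r : nat) : cell :=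
  [ffun i : idx K A => match i : option (('I_K.+1 * bool) + 'I_A.+1) with
   | None => e r
   | Some (inl (v, b)) => ~~ b && (nth 0 zs v == r.+1)
   | Some (inr a) => (a == 0 :> nat) && D r
   end].

Definition rwrd N e zs D := tp (mkseq (fun p => rcell e zs D (N.-1 - p)) N).

Definition pmark (g : cell) e z c y a : cell :=
  [ffun i => if i == None then e else if i == row 0 then z else
     if i == row 1 then c else if i == row 2 then y else
     if i == row 3 then a else g i].

Lemma rcell_row e zs D r v : v <= K -> rcell e zs D r (row v) = (nth 0 zs v == r.+1).
Proof. by move=> le; rewrite ffunE /= inordK. Qed.

Lemma rcell_pmark e z c y a D r e' z' c' y' a' E Z C Y Al :
  E = e' r -> Z = (z' == r.+1) -> C = (c' == r.+1) -> Y = (y' == r.+1) ->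
  Al = (a' == r.+1) ->
  pmark (rcell e [:: z; c; y; a] D r) E Z C Y Al = rcell e' [:: z'; c'; y'; a'] D r.
Proof.
move=> -> -> -> -> ->; apply/ffunP => k; rewrite !ffunE.
case: k => [[[v b]|k]|] //.
rewrite -[_ == None]/false !row_eq ?(leq_trans _ K_ge3) //.
by case: v b => [[|[|[|[|v]]]] lt] [].
Qed.

Lemma ex_sweepR (Q : finType) (f : Q -> cell -> Q * cell) : exists c, forall n,
  let N := n * n in forall (c1 c2 : nat -> cell) (st : nat -> Q),
  (forall r, r < N -> f (st r) (c1 r) = (st r.+1, c2 r)) ->
  ex (sweep f (st 0)) (tp (mkseq (fun p => c1 (N.-1 - p)) N)) (pb c n) (st N)
    (tp (mkseq (fun p => c2 (N.-1 - p)) N)).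
Proof.
have [c Hc] := ex_sweep (idx_gt0 K A) f; exists c => n N c1 c2 st H.
have := Hc n (fun p => c1 (N.-1 - p)) (fun p => c2 (N.-1 - p)) (fun p => st (N - p)).
rewrite subnn subn0; apply=> p ltp.
rewrite -/N in ltp.
have -> : N - p.+1 = N.-1 - p by lia.
have -> : N - p = (N.-1 - p).+1 by lia.
by apply: H; lia.
Qed.

(** Equality test of unary pointers. With [x] = [y] it asks whether the pointer is still inside the
    word, and so serves as the loop test. *)
Definition meet x y : frag bool :=
  sweep (fun (q : bool) (g : cell) => (q || (g (row x) && g (row y)), g)) false.

Lemma ex_meet x y : x <= K -> y <= K -> exists c, forall n e zs D,
  ex (meet x y) (rwrd (n * n) e zs D) (pb c n)
    [&& nth 0 zs x <= n * n, 0 < nth 0 zs x & nth 0 zs x == nth 0 zs y]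
    (rwrd (n * n) e zs D).
Proof.
move=> lex ley.
have [c Hc] := ex_sweepR (fun (q : bool) (g : cell) => (q || (g (row x) && g (row y)), g)).
exists c => n e zs D; move ex : (nth 0 zs x) => i; move ey : (nth 0 zs y) => j.
have := Hc n (rcell e zs D) (rcell e zs D) (fun r => [&& i <= r, 0 < i & i == j]).
have -> : [&& i <= 0, 0 < i & i == j] = false by case: i {ex}.
apply=> r ltr; rewrite !rcell_row // ex ey {Hc}; congr pair.
by apply/idP/idP; lia.
Qed.

Definition first_sweep (h : bool -> cell -> cell) : frag unit :=
  bind (sweep (fun (q : bool) g => (false, h q g)) true) (fun _ => ret tt).

Lemma ex_first_sweep h : exists c, forall n (c1 c2 : nat -> cell),
  (forall r, r < n * n -> h (r == 0) (c1 r) = c2 r) ->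
  ex (first_sweep h) (tp (mkseq (fun p => c1 ((n * n).-1 - p)) (n * n))) (pb c n) tt
    (tp (mkseq (fun p => c2 ((n * n).-1 - p)) (n * n))).
Proof.
have [c Hc] := ex_sweepR (fun (q : bool) g => (false, h q g)).
exists (c + 0).+1 => n c1 c2 H.
eapply ex_bind; [apply: (Hc n c1 c2 (fun r => r == 0))|exact: (ex_ret _ _ 0)|exact: (pb_add c 0 n)].
by move=> r ltr; rewrite H.
Qed.

(** Pointer 0 is the position, 1 a counter that runs through the period, 2 the number of marks made,
    3 the candidate period. The counter is 1 when its mark is on the rightmost cell, which is
    scanned first; [c0'] remembers this for the rest of the sweep. *)
Definition advance (b : bool) : frag unit :=
  bind (sweep (fun (q : bool * bool * bool * bool * bool) (g : cell) =>
    let: (fst, pz, pc, py, c0) := q in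
    let c0' := if fst then g (row 1) else c0 in
    ((false, g (row 0), g (row 1), g (row 2), c0'),
     pmark g (g None || (g (row 0) && c0')) (~~ fst && pz)
       (if b then fst else ~~ fst && pc)
       (if c0' then (if fst then g (row 0) else py) else g (row 2)) (g (row 3))))
    (true, false, false, false, false))
  (fun _ => ret tt).

(** A pointer of value 0 has no mark that could be moved. Pointer 2 therefore enters at the
    rightmost cell together with the first mark made, which the automaton recognizes by the position
    pointer being there; hence the condition relating [y] and [z]. *)
Lemma ex_advance_const b : exists k, forall n e z c y a D,
  0 < z -> 0 < c -> (c == 1 -> (y == 0) = (z == 1)) ->
  ex (advance b) (rwrd (n * n) e [:: z; c; y; a] D) (pb k n) tt
    (rwrd (n * n) (fun r => e r || ((z == r.+1) && (c == 1)))
       [:: z.+1; if b then 1 else c.+1; if c == 1 then y.+1 else y; a] D).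
Proof.
have [k Hk] := ex_sweepR (fun (q : bool * bool * bool * bool * bool) (g : cell) =>
    let: (fst, pz, pc, py, c0) := q in
    let c0' := if fst then g (row 1) else c0 in
    ((false, g (row 0), g (row 1), g (row 2), c0'),
     pmark g (g None || (g (row 0) && c0')) (~~ fst && pz)
       (if b then fst else ~~ fst && pc)
       (if c0' then (if fst then g (row 0) else py) else g (row 2)) (g (row 3)))).
exists (k + 0).+1 => n e z c y a D z0 c0 ycond.
eapply ex_bind; [|exact: (ex_ret _ _ 0)|exact: (pb_add k 0 n)].
apply: (Hk n (rcell _ _ D) (rcell _ _ D) (fun r => (r == 0, (0 < r) && (z == r),
  (0 < r) && (c == r), (0 < r) && (y == r), (0 < r) && (c == 1)))).
move=> r ltr {Hk}; have rE v : v <= 3 -> rcell e [:: z; c; y; a] D r (row v) =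
    (nth 0 [:: z; c; y; a] v == r.+1).
  by move=> le; rewrite rcell_row // (leq_trans le K_ge3).
rewrite !rE //=.
have c0E : (if r == 0 then c == r.+1 else (0 < r) && (c == 1)) = (c == 1) by case: r {ltr rE}.
rewrite c0E; congr pair; apply: rcell_pmark => //.
- by rewrite ffunE.
- by case: r {ltr rE c0E} => //=; case: z z0 {ycond}.
- by case: b; case: r {ltr rE c0E} => //=; case: c c0 {ycond}.
- case: (c == 1) ycond => //= /(_ isT) e1.
  by case: r {ltr rE c0E} => //=; rewrite -e1; case: y {e1}.
Qed.

Lemma ex_advance : exists k, forall b n e z c y a D,
  0 < z -> 0 < c -> (c == 1 -> (y == 0) = (z == 1)) ->
  ex (advance b) (rwrd (n * n) e [:: z; c; y; a] D) (pb k n) tt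
    (rwrd (n * n) (fun r => e r || ((z == r.+1) && (c == 1)))
       [:: z.+1; if b then 1 else c.+1; if c == 1 then y.+1 else y; a] D).
Proof.
have [t Ht] := ex_advance_const true; have [f Hf] := ex_advance_const false.
exists (t + f) => -[] n e z c y a D z0 c0 ycond.
  exact: ex_leq (leq_pb n (leq_addr f t)) (Ht n e z c y a D z0 c0 ycond).
exact: ex_leq (leq_pb n (leq_addl t f)) (Hf n e z c y a D z0 c0 ycond).
Qed.

Definition inner_body : frag (unit + unit) :=
  bind (meet 0 0) (fun go_on =>
    if go_on then bind (meet 1 3) (fun b => bind (advance b) (fun _ => ret (inl tt)))
    else ret (inr tt)).

Definition period_marks al z := fun r => (r < z) && (r %% al == 0).

(** Situation after [z] positions: the counter is [z] modulo [al], shifted by one, and the number of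
    marks is the ceiling of z/al. *)
Definition inner_state N D al z : itape :=
  rwrd N (period_marks al z) [:: z.+1; (z %% al).+1; z %/ al + (0 < z %% al); al] D.

Lemma period_step al z : 0 < al ->
  [/\ (z.+1 %% al).+1 = if (z %% al).+1 == al then 1 else (z %% al).+2,
      z.+1 %/ al + (0 < z.+1 %% al) = (z %/ al + (0 < z %% al)) + (z %% al == 0) &
      forall r, period_marks al z.+1 r =
        period_marks al z r || ((z.+1 == r.+1) && ((z %% al).+1 == 1))].
Proof.
move=> al0; have ltv := ltn_pmod z al0.
have zE : z.+1 = (z %/ al) * al + (z %% al).+1 by rewrite addnS -divn_eq.
split.
- rewrite {1}zE modnMDl; case: eqP => [->|ne]; first by rewrite modnn.
  by rewrite modn_small // ltn_neqAle ltv (introF eqP ne).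
- rewrite [in LHS]zE divnMDl // modnMDl; case: (eqVneq (z %% al).+1 al) => [e|ne].
    by rewrite e modnn divnn al0; case: (z %% al) => [|v] /=; lia.
  have lt1 : (z %% al).+1 < al by rewrite ltn_neqAle ltv ne.
  rewrite (divn_small lt1) (modn_small lt1); case: (z %% al) => [|v] /=; lia.
- move=> r; rewrite /period_marks !eqSS ltnS leq_eqVlt andb_orl orbC; congr orb.
  by rewrite [z == r]eq_sym; case: (eqVneq r z) => // ->.
Qed.

Lemma ex_inner : exists k, forall n D al, 0 < al <= n * n ->
  ex (loop (fun _ : unit => inner_body) tt) (inner_state (n * n) D al 0) (pb k n) tt
    (inner_state (n * n) D al (n * n)).
Proof.
have [a Ha] := ex_meet (leq0n K) (leq0n K).
have [b Hb] := ex_meet (leq_trans (isT : 1 <= 3) K_ge3) K_ge3.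
have [t Ht] := ex_advance.
pose B := (a + (b + (t + 0).+1).+1).+1.
exists (B + 0).+2 => n D al /andP[al0 leal].
pose N := n * n.
have Hl m z : z + m = N -> ex (loop (fun _ : unit => inner_body) tt)
    (inner_state N D al z) (m.+1 * pb (B + 0).+1 n) tt (inner_state N D al N).
  elim: m z => [|m IH] z.
    rewrite addn0 => ->; apply: ex_loop_done; rewrite mul1n.
    have := Ha n (period_marks al N) [:: N.+1; (N %% al).+1; N %/ al + (0 < N %% al); al] D.
    rewrite /= ltnn /= => H; apply: (ex_bind H); first exact: (ex_ret _ _ 0).
    apply: leq_trans (pb_add a 0 n) _; apply: leq_pb; rewrite /B; lia.
  move=> ez; have ltz : z < N by lia.
  have [E1 E2 E3] := period_step z al0.
  have := Ha n (period_marks al z) [:: z.+1; (z %% al).+1; z %/ al + (0 < z %% al); al] D.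
  rewrite /= -/N ltz eqxx /= => H.
  have := Hb n (period_marks al z) [:: z.+1; (z %% al).+1; z %/ al + (0 < z %% al); al] D.
  rewrite /= -/N (leq_ltn_trans (leq_mod _ _) ltz) /= => H'.
  have ycond : (z %% al).+1 == 1 -> (z %/ al + (0 < z %% al) == 0) = (z.+1 == 1).
    rewrite !eqSS => /eqP v0; rewrite v0 addn0 {2}(divn_eq z al) v0 addn0 muln_eq0.
    by rewrite [al == 0]gtn_eqF // orbF.
  pose y := z %/ al + (0 < z %% al).
  have eqt : rwrd N (fun r => period_marks al z r || ((z.+1 == r.+1) && ((z %% al).+1 == 1)))
      [:: z.+2; if (z %% al).+1 == al then 1 else (z %% al).+2;
          if (z %% al).+1 == 1 then y.+1 else y; al] D = inner_state N D al z.+1.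
    rewrite /inner_state E1 E2 (functional_extensionality _ _ E3).
    by congr (rwrd _ _ [:: _; _; _; _] _); rewrite -/y; case: (z %% al) => [|v] /=; lia.
  have := Ht ((z %% al).+1 == al) n (period_marks al z) _ _ _ al D (ltn0Sn z) (ltn0Sn _) ycond.
  rewrite eqt.
  move=> H''; eapply ex_loop_next; [|by apply: (IH z.+1); lia|].
    apply: (ex_bind H _ (pb_add a (b + (t + 0).+1).+1 n)).
    apply: (ex_bind H' _ (pb_add b (t + 0).+1 n)).
    by apply: (ex_bind H'' _ (pb_add t 0 n)); exact: ex_ret.
  by rewrite [m.+2 * _]mulSn ltn_add2r; apply: leq_ltn_trans (pb_add B 0 n); apply: leq_addr.
by apply: ex_leq (Hl N 0 (add0n _)); apply: pb_mul.
Qed.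

Definition reset : frag unit :=
  first_sweep (fun q g => pmark g false q q false (g (row 3))).
Definition next_period : frag unit :=
  bind (sweep (fun (q : bool) g =>
    (g (row 3), pmark g (g None) (g (row 0)) (g (row 1)) (g (row 2)) q)) false)
  (fun _ => ret tt).

Lemma row3_rcell e z c y a D r : rcell e [:: z; c; y; a] D r (row 3) = (a == r.+1).
Proof. by rewrite rcell_row. Qed.

Lemma ex_reset : exists k, forall n e z c y al D, 
  ex reset (rwrd (n * n) e [:: z; c; y; al] D) (pb k n) tt (inner_state (n * n) D al 0).
Proof.
have [k Hk] := ex_first_sweep (fun q g => pmark g false q q false (g (row 3))).
exists k => n e z c y al D; apply: (Hk n (rcell _ _ _) (rcell _ _ _)) => r ltr.
by apply: rcell_pmark; rewrite ?row3_rcell ?mod0n ?div0n // eqSS eq_sym.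
Qed.

Lemma ex_next_period : exists k, forall n e z c y al D, 0 < al ->
  ex next_period (rwrd (n * n) e [:: z; c; y; al] D) (pb k n) tt
    (rwrd (n * n) e [:: z; c; y; al.+1] D).
Proof.
have [k Hk] := ex_sweepR (fun (q : bool) g =>
    (g (row 3), pmark g (g None) (g (row 0)) (g (row 1)) (g (row 2)) q)).
exists (k + 0).+1 => n e z c y al D al0.
eapply ex_bind; [|exact: (ex_ret _ _ 0)|exact: (pb_add k 0 n)].
apply: (Hk n (rcell _ _ D) (rcell _ _ D) (fun r => (0 < r) && (al == r))).
move=> r ltr; rewrite row3_rcell; congr pair.
apply: rcell_pmark; rewrite ?rcell_row ?(leq_trans _ K_ge3) ?ffunE //.
by case: r {ltr} => //=; case: al al0.
Qed.

(* The periods [al] = 1, 2, ... are tried until there are [al] marks. *)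
Definition outer_body : frag (unit + unit) :=
  bind (meet 3 3) (fun nonempty => if nonempty then
    bind reset (fun _ =>
    bind (loop (fun _ : unit => inner_body) tt) (fun _ =>
    bind (meet 2 3) (fun found =>
      if found then ret (inr tt) else bind next_period (fun _ => ret (inl tt)))))
  else ret (inr tt)).

(** For al < n the quotient of n*n by al is at least al + 1, so there are too many marks. At al = n
    the two numbers agree for the first time. *)
Lemma ex_outer : exists k, forall n D, exists z c y,
  ex (loop (fun _ : unit => outer_body) tt)
    (rwrd (n * n) (fun _ => false) [:: 0; 0; 0; 1] D) (pb k n) tt
    (rwrd (n * n) (period_marks n (n * n)) [:: z; c; y; n] D).
Proof.
have [a Ha] := ex_meet K_ge3 K_ge3.
have [r Hr] := ex_reset.
have [i Hi] := ex_inner.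
have [b Hb] := ex_meet (leq_trans (isT : 2 <= 3) K_ge3) K_ge3.
have [x Hx] := ex_next_period.
pose B := (a + (r + (i + (b + (x + 0).+1).+1).+1).+1).+1.
exists (B + 0).+2 => n D; pose N := n * n.
(* In the empty word no pointer is inside, so the first test ends the loop. *)
have [n0|n0] := posnP n.
  exists 0, 0, 0; subst n; apply: ex_loop_done.
  have H := Ha 0 (fun _ => false) [:: 0; 0; 0; 1] D.
  apply: ex_leq (leq_pb 0 (leqnSn (B + 0).+1)) _.
  apply: ex_leq (ltnW (leq_ltn_trans (leq_addr _ _) (pb_add B 0 0))) _.
  by apply: (ex_bind H _ (pb_add _ _ _)); apply: ex_ret.
exists N.+1, (N %% n).+1, (N %/ n + (0 < N %% n)).
have Hl m al e z c y : al + m = n -> 0 < al ->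
    ex (loop (fun _ : unit => outer_body) tt) (rwrd N e [:: z; c; y; al] D)
      (m.+1 * pb (B + 0).+1 n) tt (inner_state N D n N).
  elim: m al e z c y => [|m IH] al e z c y eal al0.
    rewrite addn0 in eal; subst al.
    rewrite mul1n; apply: ex_loop_done.
    have := Ha n e [:: z; c; y; n] D; rewrite /= leq_pmulr // n0 eqxx => H.
    apply: ex_leq (ltnW (leq_ltn_trans (leq_addr _ _) (pb_add B 0 n))) _.
    apply: (ex_bind H _ (pb_add _ _ _)).
    apply: (ex_bind (Hr n e z c y n D) _ (pb_add _ _ _)).
    apply: (ex_bind (Hi n D n _) _ (pb_add _ _ _)); first by rewrite n0 leq_pmulr.
    have := Hb n (period_marks n N) [:: N.+1; (N %% n).+1; N %/ n + (0 < N %% n); n] D.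
    have y0 : N %/ n + (0 < N %% n) = n by rewrite /N modnMl mulnK // addn0.
    rewrite /= [X in ex _ _ _ X _](_ : _ = true) => [H'|]; last first.
      by rewrite y0 leq_pmulr // n0 eqxx.
    by apply: (ex_bind H' _ (pb_add _ _ _)); apply: ex_ret.
  have ltal : al < n by lia.
  have leal : al <= n * n by nia.
  have := Ha n e [:: z; c; y; al] D; rewrite /= leal al0 eqxx => H.
  have := Hb n (period_marks al N) [:: N.+1; (N %% al).+1; N %/ al + (0 < N %% al); al] D.
  have ne : (N %/ al + (0 < N %% al) == al) = false.
    suff: al.+1 <= N %/ al by move=> le; rewrite gtn_eqF // (leq_trans le) // leq_addr.
    by rewrite leq_divRL // leq_mul // ltnW.
  rewrite /= -/N ne !andbF => H'.
  have ea : al.+1 + m = n by rewrite addSnnS.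
  eapply ex_loop_next; [|exact: (IH al.+1 (period_marks al N) N.+1 (N %% al).+1
    (N %/ al + (0 < N %% al)) ea isT)|].
    apply: (ex_bind H _ (pb_add _ _ _)).
    apply: (ex_bind (Hr n e z c y al D) _ (pb_add _ _ _)).
    apply: (ex_bind (Hi n D al _) _ (pb_add _ _ _)); first by rewrite al0.
    apply: (ex_bind H' _ (pb_add _ _ _)).
    by apply: (ex_bind (Hx n _ _ _ _ _ D al0) _ (pb_add x 0 n)); exact: ex_ret.
  by rewrite [m.+2 * _]mulSn ltn_add2r; apply: leq_ltn_trans (pb_add B 0 n); apply: leq_addr.
apply: ex_leq (Hl n.-1 1 _ 0 0 0 _ isT); last by rewrite add1n prednK.
by rewrite prednK //; apply: pb_mul; nia.
Qed.

Definition rows : frag unit :=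
  bind (first_sweep (fun q g => pmark g false false false false q)) (fun _ =>
  bind (loop (fun _ : unit => outer_body) tt) (fun _ =>
  first_sweep (fun _ g => pmark g (g None) false false false false))).

Definition input_data n (s : seq bool) : data :=
  fun a x y => (a == 0) && nth false s (x * n + y).

Lemma ex_rows : exists k, forall n s, size s = n * n ->
  ex rows (tp (map (fun b => [ffun i : idx K A => (i == dat K A 0) && b]) s)) (pb k n) tt
    (wrd K A n [::] (input_data n s)).
Proof.
have [f Hf] := ex_first_sweep (fun q g => pmark g false false false false q).
have [o Ho] := ex_outer.
have [l Hl] := ex_first_sweep (fun _ g => pmark g (g None) false false false false).
exists (f + (o + l).+1).+1 => n s sz.
pose D r := nth false s ((n * n).-1 - r).
have -> : tp (map (fun b => [ffun i : idx K A => (i == dat K A 0) && b]) s) =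
    rwrd (n * n) (fun _ => false) [:: 0; 0; 0; 0] D.
  congr tp; apply: (@eq_from_nth _ [ffun => false]); first by rewrite size_map size_mkseq.
  move=> p; rewrite size_map sz => ltp.
  rewrite (nth_map false) ?sz // nth_mkseq //; apply/ffunP => k; rewrite !ffunE.
  have -> : D ((n * n).-1 - p) = nth false s p by congr (nth _ _ _); lia.
  case: k => [[[v b]|k]|] //.
    have -> : nth 0 [:: 0; 0; 0; 0] v = 0.
      by case: (val v) => [|[|[|[|u]]]] //=; rewrite nth_nil.
    by rewrite andbF.
  congr andb; apply/eqP/eqP => [[->]|e]; first by rewrite inordK.
  by congr (Some (inr _)); apply: val_inj; rewrite /= inordK.
have step1 : ex (first_sweep (fun q g => pmark g false false false false q))
    (rwrd (n * n) (fun _ => false) [:: 0; 0; 0; 0] D) (pb f n) tt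
    (rwrd (n * n) (fun _ => false) [:: 0; 0; 0; 1] D).
  by apply: (Hf n (rcell _ _ D) (rcell _ _ D)) => r ltr; apply: rcell_pmark; rewrite ?ffunE // eqSS eq_sym.
apply: (ex_bind step1 _ (pb_add _ _ _)).
have [z [c [y Hz]]] := Ho n D.
apply: (ex_bind Hz _ (pb_add _ _ _)).
have -> : wrd K A n [::] (input_data n s) = rwrd (n * n) (period_marks n (n * n)) [:: 0; 0; 0; 0] D.
  congr tp; apply/eq_in_map => p; rewrite mem_iota add0n /= => /[dup] ltp.
  case/entryP => [i [j [lti ltj ep ei ej]]]; apply/ffunP => k; rewrite !ffunE.
  case: k => [[[v b]|k]|].
  - rewrite nth_nil; have -> : nth 0 [:: 0; 0; 0; 0] v = 0.
      by case: (val v) => [|[|[|[|u]]]] //=; rewrite nth_nil.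
    by case: b; rewrite andbF.
  - by rewrite /input_data -divn_eq /D; congr (_ && nth _ _ _); lia.
  (* Counted from the right end, the multiples of n are exactly the last entries of the rows. *)
  - rewrite /period_marks ej; have -> : (n * n).-1 - p = (n.-1 - i) * n + (n.-1 - j) by nia.
    rewrite modnMDl modn_small; last by lia.
    by apply/idP/idP; nia.
apply: (Hl n (rcell _ _ D) (rcell _ _ D)) => r ltr.
by apply: rcell_pmark; rewrite ?ffunE.
Qed.
End Rows.

(** * Programs as Turing machines *)

Lemma itape_of_input (s : seq bool) :
  itape_of (match bits s with [::] => ([::], Blank, [::]) | a :: r => ([::], a, r) end)
  = mk [::] (bits s).
Proof. by case: s => //=; apply: (mk_catr [::] 1 [::]). Qed.

Lemma read_bits_stream x s : nth Blank x = nth Blank (bits s) -> read_bits x = s.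
Proof.
elim: s x => [|b s IH] [|a x] //= e.
- by have /= := congr1 (@^~ 0) e => ->.
- by have := congr1 (@^~ 0) e; case: b {e}.
have /= -> := congr1 (@^~ 0) e.
have {}e : nth Blank x = nth Blank (bits s).
  by apply: functional_extensionality => i; have := congr1 (@^~ i.+1) e.
by case: b; rewrite /= (IH _ e).
Qed.

Section Programs.
Variables (K A : nat) (s : stmt) (o : nat).
Hypotheses (K_ge3 : 3 <= K) (s_wf : swf K A s 0) (leoA : o <= A).
Notation cell := {ffun idx K A -> bool}.
Notation result n e := (exec n s [::] (input_data n (encode_graph e)) o).

Lemma size_encode_graph n (e : rel 'I_n) : size (encode_graph e) = n * n.
Proof. by rewrite size_allpairs !size_enum_ord. Qed.

Lemma ex_program (F : frag unit) (out : forall n, data -> seq bool) :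
  (exists c, forall n d, ex F (wrd K A n [::] d) (pb c n) tt (mk [::] (bits (out n d)))) ->
  exists M c, forall n (e : rel 'I_n), exists t (cf : config M),
    [/\ t <= c * (n * n).+1 ^ c, run t (init_config M (encode_graph e)) = Some cf
    & output cf = out n (exec n s [::] (input_data n (encode_graph e)))].
Proof.
move=> [c Hc].
have [F1 [c1 H1]] := @ex_load (idx K A) (idx_gt0 K A) (fun b => [ffun i => (i == dat K A 0) && b]).
have [c2 H2] := ex_rows A K_ge3.
have [c3 H3] := ex_cstmt (leq0n K.+1) s_wf.
pose P := bind F1 (fun _ => bind (rows K A) (fun _ => bind (cstmt K A s 0) (fun _ => F))).
pose B := (c1 + (c2 + (c3 + c).+1).+1).+1.
exists (machine P), (B + 0).+1 => n e.
have sz := size_encode_graph e.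
have HP : ex P (itape_of (init_config (machine P) (encode_graph e)).2) (pb B n) tt
    (mk [::] (bits (out n (exec n s [::] (input_data n (encode_graph e)))))).
  rewrite itape_of_input.
  apply: (ex_bind (H1 n _ sz) _ (pb_add _ _ _)).
  apply: (ex_bind (H2 n _ sz) _ (pb_add _ _ _)).
  by apply: (ex_bind (H3 n [::] _ isT (erefl _)) _ (pb_add _ _ _)); apply: Hc.
have [t [cf [let_ rt et]]] := machine_run HP.
exists t, cf; split=> //.
  by apply: leq_trans let_ (leq_ltn_trans (leq_addr _ _) (pb_add B 0 n)).
case: cf et {rt} => q [[l h] r] /=.
case=> _; exact: (@read_bits_stream (h :: r)).
Qed.

Lemma matrix_program : exists M c, forall n (e : rel 'I_n), exists t (cf : config M),
    [/\ t <= c * (n * n).+1 ^ c, run t (init_config M (encode_graph e)) = Some cf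
    & output cf = mkseq (fun p => result n e (p %/ n) (p %% n)) (n * n)].
Proof.
have [F [c Hc]] := ex_unload (idx_gt0 K A) (fun g => [:: g (dat K A o)]).
apply: (@ex_program F (fun n d => mkseq (fun p => d o (p %/ n) (p %% n)) (n * n))).
exists c => n d.
have := Hc n (mkseq (entry K A n [::] d) (n * n)) (size_mkseq _ _).
set out := flatten _; have -> // : out = mkseq (fun p => d o (p %/ n) (p %% n)) (n * n).
rewrite {}/out /mkseq; elim: (iota _ _) => //= p r ->.
by rewrite entry_dat.
Qed.

(** A set is encoded by n bits, not n*n. A last [push] marks the last row, and the entries without
    that mark are unloaded as empty words. *)
Lemma row_program : exists M c, forall n (e : rel 'I_n), exists t (cf : config M),
    [/\ t <= c * (n * n).+1 ^ c, run t (init_config M (encode_graph e)) = Some cf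
    & output cf = mkseq (result n e n.-1) n].
Proof.
have [F [c Hc]] := ex_unload (idx_gt0 K A) (fun g =>
  if g (row K A 0) then [:: g (dat K A o)] else [::]).
have [c' Hc'] := ex_push A (leq0n K).
apply: (@ex_program (bind (push K A 0) (fun _ => F)) (fun n d => mkseq (d o n.-1) n)).
exists (c' + c).+1 => n d; apply: (ex_bind (Hc' n [::] d (erefl _)) _ (pb_add _ _ _)).
have := Hc n (mkseq (entry K A n [:: n] d) (n * n)) (size_mkseq _ _).
set out := flatten _; have -> // : out = mkseq (d o n.-1) n.
rewrite {}/out; case: n => // n; rewrite -[n.+1.-1]/n mulSn addnC /mkseq iotaD add0n !map_cat flatten_cat.
rewrite -[X in _ = X]cat0s; congr cat.
  suff: all (ltn^~ (n * n.+1)) (iota 0 (n * n.+1)).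
    elim: (iota _ _) => //= p r IH /andP[ltp /IH ->].
    rewrite entry_row //= eqSS; case: eqP => // e; move: ltp.
    by rewrite -ltn_divLR // -e ltnn.
  by apply/allP => p; rewrite mem_iota.
rewrite -[n * n.+1]addn0 iotaDl -!map_comp.
suff: all (ltn^~ n.+1) (iota 0 n.+1).
  elim: (iota _ _) => //= p r IH /andP[ltp /IH <-].
  by rewrite entry_row //= entry_dat // divnMDl // divn_small // addn0 eqxx modnMDl modn_small.
by apply/allP => p; rewrite mem_iota.
Qed.
End Programs.

(** * Independent neighbours of a smallest disk *)

Section Plane.
Local Open Scope R_scope.

(* Squared norm, in a basis of two unit vectors at an angle of 60 degrees. *)
Definition hnorm (s t : R) := s * s + s * t + t * t.

(** Two vectors in a cone of 60 degrees. If the differences of coordinates have opposite signs and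
    absolute values x, y, the norm is x*x - x*y + y*y, at most the square of the larger; otherwise
    the difference is dominated coordinatewise by one of the vectors. *)
Lemma hnorm_cone s t s' t' : 0 <= s -> 0 <= t -> 0 <= s' -> 0 <= t' ->
  hnorm (s - s') (t - t') <= hnorm s t \/ hnorm (s - s') (t - t') <= hnorm s' t'.
Proof.
rewrite /hnorm => *.
case: (Rle_dec s s') => h1; case: (Rle_dec t t') => h2.
- right; nra.
- case: (Rle_dec (s' - s) (t - t')) => h3; [left|right]; nra.
- case: (Rle_dec (t' - t) (s - s')) => h3; [left|right]; nra.
- left; nra.
Qed.

(** The map is the rotation by 60 degrees that takes the second basis vector to the first. *)
Lemma hnorm_rot s t : hnorm (s + t) (- s) = hnorm s t.
Proof. by rewrite /hnorm; ring. Qed.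

Definition far (s t s' t' : R) :=
  hnorm s t < hnorm (s - s') (t - t') /\ hnorm s' t' < hnorm (s - s') (t - t').

Lemma far_rot s t s' t' : far s t s' t' -> far (s + t) (- s) (s' + t') (- s').
Proof.
rewrite /far !hnorm_rot.
by rewrite (_ : s + t - (s' + t') = (s - s') + (t - t'))
  1?(_ : - s - - s' = - (s - s')) ?hnorm_rot //; ring.
Qed.

Lemma far_cone s t s' t' : far s t s' t' ->
  0 <= s -> 0 <= t -> 0 <= s' -> 0 <= t' -> False.
Proof. by move=> [f f'] *; case: (@hnorm_cone s t s' t'); lra. Qed.

(** For points at least 60 degrees away from the first axis, these are the four cones of 60 degrees
    between the angles 60 and 300. *)
Definition sector (s t : R) : 'I_4 :=
  if Rle_dec 0 t then if Rle_dec 0 (s + t) then inord 0 else inord 1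
  else if Rle_dec s 0 then inord 2 else inord 3.

Lemma far_axis A s t : 0 < A -> far s t A 0 ->
  if Rle_dec 0 t then s <= 0 else 0 < s -> s + t <= 0.
Proof.
move=> A0 [f f'].
have h1 : 2 * s + t < A.
  case: (Rlt_dec (2 * s + t) A) => // h1; exfalso; move: f; rewrite /hnorm => f.
  by have := Rmult_le_compat_l A _ _ (Rlt_le _ _ A0) (Rnot_lt_le _ _ h1); lra.
have h2 : A * (2 * s + t) < hnorm s t by move: f'; rewrite /hnorm; lra.
(* Expanded, the conclusion says that s times s + t is negative, which excludes the open cones on
   both sides of the axis. *)
have h3 : 0 <= 2 * s + t -> (2 * s + t) * (2 * s + t) < hnorm s t.
  by move=> h; have := Rmult_le_compat_r _ _ _ h (Rlt_le _ _ h1); lra.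
case: Rle_dec => h.
  case: (Rle_dec s 0) => // hs; exfalso.
  by have := h3 ltac:(lra); rewrite /hnorm; nra.
move=> hs; case: (Rle_dec (s + t) 0) => // ht; exfalso.
by have := h3 ltac:(lra); rewrite /hnorm; nra.
Qed.

Lemma far_sector A s t s' t' : 0 < A -> far s t A 0 -> far s' t' A 0 ->
  far s t s' t' -> sector s t = sector s' t' -> False.
Proof.
move=> A0 /(far_axis A0) h /(far_axis A0) h' f1.
(* One to four rotations bring the sectors 0 to 3 into the cone of nonnegative coordinates. *)
have f2 := far_rot f1; have f3 := far_rot f2; have f4 := far_rot f3.
have f5 := far_rot f4.
move=> /(congr1 val); move: h h'; rewrite /sector.
case: (Rle_dec 0 t) => t0;
  [case: (Rle_dec 0 (s + t)) => s0|case: (Rle_dec s 0) => s0];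
  case: (Rle_dec 0 t') => t0';
  [case: (Rle_dec 0 (s' + t')) => s0'|case: (Rle_dec s' 0) => s0'
  |case: (Rle_dec 0 (s' + t')) => s0'|case: (Rle_dec s' 0) => s0'
  |case: (Rle_dec 0 (s' + t')) => s0'|case: (Rle_dec s' 0) => s0'
  |case: (Rle_dec 0 (s' + t')) => s0'|case: (Rle_dec s' 0) => s0'];
  rewrite /= !inordK // => h h' // _;
  first [apply: (far_cone f2); lra|apply: (far_cone f3); lra
        |apply: (far_cone f4); lra|apply: (far_cone f5); lra].
Qed.

Lemma sqrt3_inv : exists k, 3 * (k * k) = 1.
Proof.
exists (/ sqrt 3); have h : sqrt 3 * sqrt 3 = 3 by apply: sqrt_sqrt; lra.
have h0 : sqrt 3 <> 0 by move=> h0; rewrite h0 in h; lra.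
by rewrite -{1}h; field.
Qed.

Definition sqdist (x y x' y' : R) := (x - x') * (x - x') + (y - y') * (y - y').

(* Seen from the centre (x, y) of a smallest disk, two independent neighbours
   are at an angle of more than 60 degrees. *)
Lemma disks_far x y r x1 y1 r1 x2 y2 r2 :
  0 < r -> r <= r1 -> r <= r2 ->
  sqdist x y x1 y1 <= (r + r1) * (r + r1) -> sqdist x y x2 y2 <= (r + r2) * (r + r2) ->
  ~ sqdist x1 y1 x2 y2 <= (r1 + r2) * (r1 + r2) ->
  sqdist x y x1 y1 < sqdist x1 y1 x2 y2 /\ sqdist x y x2 y2 < sqdist x1 y1 x2 y2.
Proof. by move=> *; split; nra. Qed.

(* The coordinates of (x, y) in the basis made of (a, b) and its rotation by 60
   degrees, multiplied by the squared length of (a, b); here [k] is 1/sqrt 3. *)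
Definition hcoord1 k a b x y := (x * a + y * b) - k * (a * y - b * x).
Definition hcoord2 k a b x y := 2 * k * (a * y - b * x).

Lemma hnorm_hcoord k a b x y : 3 * (k * k) = 1 ->
  hnorm (hcoord1 k a b x y) (hcoord2 k a b x y) = (a * a + b * b) * (x * x + y * y).
Proof.
(* With the cross product [c] and the dot product [d], the claim becomes Lagrange's identity. *)
move=> k3; pose c := a * y - b * x; pose d := x * a + y * b.
have -> : hnorm (hcoord1 k a b x y) (hcoord2 k a b x y) = d * d + 3 * (k * k) * (c * c).
  by rewrite /hnorm /hcoord1 /hcoord2 /c /d; ring.
by rewrite k3 /c /d; ring.
Qed.

Lemma far_hcoord k a b x y x' y' : 3 * (k * k) = 1 -> 0 < a * a + b * b ->
  x * x + y * y < sqdist x y x' y' -> x' * x' + y' * y' < sqdist x y x' y' ->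
  far (hcoord1 k a b x y) (hcoord2 k a b x y) (hcoord1 k a b x' y') (hcoord2 k a b x' y').
Proof.
move=> k3 A0; rewrite /far /sqdist.
have -> : hcoord1 k a b x y - hcoord1 k a b x' y' = hcoord1 k a b (x - x') (y - y').
  by rewrite /hcoord1; ring.
have -> : hcoord2 k a b x y - hcoord2 k a b x' y' = hcoord2 k a b (x - x') (y - y').
  by rewrite /hcoord2; ring.
by rewrite !hnorm_hcoord //; split; apply: Rmult_lt_compat_l.
Qed.
End Plane.

Local Delimit Scope R_scope with real.

(** The geometric content that the algorithms rely on. It is stated for all [U] because it is
    applied to whatever vertices are still alive. *)
Definition sparse n (e : rel 'I_n) := forall U : {set 'I_n}, U != set0 ->
  exists2 v, v \in U & forall S : {set 'I_n}, S \subset U ->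
    (forall x, x \in S -> e v x) -> is_independent e S -> #|S| <= 5.

Lemma exists_smallest n (r : 'I_n -> R) (U : {set 'I_n}) : U != set0 ->
  exists2 v, v \in U & forall u, u \in U -> (r v <= r u)%real.
Proof.
case/set0Pn=> x; rewrite -mem_enum => Ux.
suff [v Uv min] : exists2 v, v \in enum U & forall u, u \in enum U -> (r v <= r u)%real.
  by exists v => [|u Uu]; [rewrite -mem_enum|apply: min; rewrite mem_enum].
elim: (enum U) x Ux => // y s IH x _.
case: s IH => [_|z s /(_ z (mem_head _ _))[v sv min]].
  by exists y; rewrite ?mem_head // => u; rewrite inE => /eqP->; lra.
case: (Rle_dec (r y) (r v)) => h.
  exists y; first exact: mem_head.
  by move=> u; rewrite inE => /predU1P[->|/min]; lra.
exists v; first by rewrite inE sv orbT.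
by move=> u; rewrite inE => /predU1P[->|/min //]; lra.
Qed.

Lemma circle_irr n (e : rel 'I_n) : is_circle_graph e -> irreflexive e.
Proof. by case=> h _ i; apply/negbTE. Qed.

Lemma circle_sym n (e : rel 'I_n) : is_circle_graph e -> symmetric e.
Proof.
case=> h [x [y [r [r0 he]]]] i j; case: (eqVneq i j) => [->//|/eqP ne].
have ne' : j <> i by move=> e1; apply: ne.
have [h1 h2] := he _ _ ne; have [h3 h4] := he _ _ ne'.
by apply/idP/idP => [/h1 H|/h3 H]; [apply: h4|apply: h2]; lra.
Qed.

(** One of the independent neighbours, [a], gives the first axis. The others are more than 60
    degrees away from it and from each other, so each of the four sectors holds at most one: 5 = 1 +
    4. *)
Lemma circle_sparse n (e : rel 'I_n) : is_circle_graph e -> sparse e.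
Proof.
move=> [irr [x [y [r [r0 he]]]]] U /(exists_smallest r)[v Uv min].
exists v => // S sSU nS iS; rewrite leqNgt; apply/negP => gt5.
have [a Sa] : exists a, a \in S by apply/card_gt0P; apply: leq_trans gt5.
have nv i : i \in S -> v <> i by move=> Si e1; have := nS _ Si; rewrite -e1 (negbTE (irr v)).
have farS i j : i \in S -> j \in S -> i <> j ->
    (sqdist (x v) (y v) (x i) (y i) < sqdist (x i) (y i) (x j) (y j) /\
     sqdist (x v) (y v) (x j) (y j) < sqdist (x i) (y i) (x j) (y j))%real.
  move=> Si Sj ne; apply: (@disks_far _ _ (r v) _ _ (r i) _ _ (r j)) => //.
  - by apply: min; apply: (subsetP sSU).
  - by apply: min; apply: (subsetP sSU).
  - by apply/(he _ _ (nv _ Si)); apply: nS.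
  - by apply/(he _ _ (nv _ Sj)); apply: nS.
  - by move=> h; have := iS _ _ Si Sj (introN eqP ne); rewrite (proj2 (he _ _ ne) h).
have [k k3] := sqrt3_inv.
pose p i := (x i - x v)%real; pose q i := (y i - y v)%real.
pose h1 i := hcoord1 k (p a) (q a) (p i) (q i).
pose h2 i := hcoord2 k (p a) (q a) (p i) (q i).
have gt4 : 4 < #|S :\ a| by move: gt5; rewrite (cardsD1 a) Sa.
(* If [a] and [v] had the same centre, a second neighbour would be equally far from both, against
   [farS]. *)
have A0 : (0 < p a * p a + q a * q a)%real.
  have [b] : exists b, b \in S :\ a by apply/card_gt0P; apply: leq_trans gt4.
  rewrite !inE => /andP[/eqP ba Sb].
  case: (Rlt_dec 0 (p a * p a + q a * q a)) => // h; exfalso.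
  have := Rle_0_sqr (p a); have := Rle_0_sqr (q a); rewrite /Rsqr => q0 p0.
  have px : x a = x v by apply: Rminus_diag_uniq; apply: Rsqr_0_uniq; rewrite /Rsqr -/(p a); lra.
  have qx : y a = y v by apply: Rminus_diag_uniq; apply: Rsqr_0_uniq; rewrite /Rsqr -/(q a); lra.
  by have := farS _ _ Sb Sa ba; rewrite /sqdist px qx; lra.
have farh i j : i \in S -> j \in S -> i <> j -> far (h1 i) (h2 i) (h1 j) (h2 j).
  move=> Si Sj ne; have [f1 f2] := farS _ _ Si Sj ne.
  by apply: far_hcoord => //; move: f1 f2; rewrite /sqdist /p /q; lra.
have h1a : h1 a = (p a * p a + q a * q a)%real by rewrite /h1 /hcoord1; ring.
have h2a : h2 a = 0%real by rewrite /h2 /hcoord2; ring.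
suff inj : {in S :\ a &, injective (fun i => sector (h1 i) (h2 i))}.
  have := max_card [in (fun i => sector (h1 i) (h2 i)) @: (S :\ a)].
  by rewrite card_in_imset // card_ord leqNgt gt4.
move=> i j; rewrite !inE => /andP[/eqP ia Si] /andP[/eqP ja Sj] eqs.
apply/eqP; apply/negPn/negP => /eqP ne.
have := farh _ _ Si Sa ia; have := farh _ _ Sj Sa ja; rewrite h1a h2a => fj fi.
exact: far_sector A0 fi fj (farh _ _ Si Sj ne) eqs.
Qed.

(** * Reasoning on programs *)

Lemma mem_tl (X : eqType) (x y : X) s : y \in s -> y \in x :: s.
Proof. by rewrite inE => ->; rewrite orbT. Qed.

Definition round (T X : Type) (C : T -> X -> bool) (act : T -> X -> T) (L : seq X) (t : T) : T :=
  foldr (fun x t => if C t x then act t x else t) t L.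

(* Each action increases a measure that is bounded by the number of rounds. *)
Lemma greedy (T : Type) (X : eqType) (C : T -> X -> bool) (act : T -> X -> T)
    (Inv : T -> Prop) (m : T -> nat) (L : seq X) (Y : Type) (rounds : seq Y) t0 :
  (forall t x, x \in L -> Inv t -> C t x -> Inv (act t x) /\ m t < m (act t x)) ->
  (forall t, Inv t -> m t <= size rounds) -> Inv t0 ->
  let t := foldr (fun _ t => round C act L t) t0 rounds in
  Inv t /\ forall x, x \in L -> ~~ C t x.
Proof.
move=> actP mP I0 t.
have roundP t1 : Inv t1 -> Inv (round C act L t1) /\ m t1 <= m (round C act L t1) /\
    ((forall x, x \in L -> ~~ C t1 x) /\ round C act L t1 = t1 \/ m t1 < m (round C act L t1)).
  rewrite /round => I1; have: {subset L <= L} by [].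
  elim: {1 3 4 5 6 7}L => [_|x s IH sub] /=; first by split=> //; split=> //; left.
  have [I2 [le H]] := IH (fun y sy => sub y (mem_tl x sy)).
  set t2 := foldr _ _ _ in I2 le H *.
  case: ifP => [c|nc]; last first.
    split=> //; split=> //; case: H => [[H e]|H]; [left|by right].
    split=> // y; rewrite inE => /predU1P[->|]; last exact: H.
    by rewrite -e nc.
  have [I3 lt] := actP _ _ (sub x (mem_head _ _)) I2 c.
  by have lt' := leq_ltn_trans le lt; split=> //; split; [exact: ltnW|right].
(* After an idle round all later ones are idle. If no round is idle, each gains at least one, and in
   the end the measure has reached its bound, where no action can increase it. *)
have [It H] : Inv t /\ ((forall x, x \in L -> ~~ C t x) \/ size rounds <= m t).
  rewrite {}/t; elim: (rounds) => [|r s [I1 H1]] /=; first by split=> //; right.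
  set t1 := foldr _ _ _ in I1 H1 *.
  have [I2 [le H2]] := roundP _ I1; split=> //.
  case: H2 => [[T2 e]|lt]; first by left; rewrite e.
  case: H1 => [T1|le1]; last by right; apply: leq_ltn_trans lt.
  suff e : round C act L t1 = t1 by rewrite e ltnn in lt.
  rewrite /round; elim: (L) T1 => //= x s' IH T1.
  rewrite IH ?(negbTE (T1 _ (mem_head _ _))) // => y sy; apply: T1; exact: mem_tl.
split=> // x Lx; case: H => [|le]; first exact.
apply/negP => c; have [I1 lt] := actP _ _ Lx It c.
by have := mP _ I1; rewrite leqNgt (leq_ltn_trans le lt).
Qed.

Lemma foldr_allpairs (T : Type) (X Y : Type) (f : X -> Y -> T -> T) t s1 s2 :
  foldr (fun x t => foldr (fun y t => f x y t) t s2) t s1 =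
  foldr (fun xy t => f xy.1 xy.2 t) t [seq (x, y) | x <- s1, y <- s2].
Proof.
by elim: s1 => //= x s1 ->; rewrite foldr_cat foldr_map.
Qed.

Lemma eq_in_foldr (T : Type) (X : eqType) (f g : X -> T -> T) t s :
  (forall x t, x \in s -> f x t = g x t) -> foldr f t s = foldr g t s.
Proof.
elim: s => //= x s IH H; rewrite H ?mem_head // IH // => y u sy.
by apply: H; exact: mem_tl.
Qed.

(* A loop of assignments to distinct entries is a simultaneous assignment when
   the expression does not read entries that are assigned before. *)
Lemma foldr_upd (X : eqType) (d : data) a (px py : X -> nat) (phi : X -> data -> bool)
    (s : seq X) :
  uniq s -> {in s &, forall i j, px i = px j -> py i = py j -> i = j} ->
  (forall i d', i \in s -> (forall b x y,
     ~ (b = a /\ exists j, [/\ j \in s, j != i, x = px j & y = py j]) ->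
     d' b x y = d b x y) -> phi i d' = phi i d) ->
  let r := foldr (fun i d => upd d a (px i) (py i) (phi i d)) d s in
  (forall i, i \in s -> r a (px i) (py i) = phi i d) /\
  (forall b x y, ~ (b = a /\ exists j, [/\ j \in s, x = px j & y = py j]) ->
     r b x y = d b x y).
Proof.
elim: s => [|i s IH] /=; first by split.
case/andP=> nis us inj ext.
have [||H1 H2] := IH us.
- by move=> j k sj sk; apply: inj; exact: mem_tl.
- move=> j d' sj H; apply: ext; first exact: mem_tl.
  move=> b x y nb; apply: H => -[eb [k [sk kj ex ey]]]; apply: nb; split=> //.
  by exists k; split=> //; exact: mem_tl.
set r := foldr _ _ _ in H1 H2 *.
have phir : phi i r = phi i d.
  apply: ext; first exact: mem_head.
  move=> b x y nb; apply: H2 => -[eb [k [sk ex ey]]]; apply: nb; split=> //.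
  exists k; split=> //; first exact: mem_tl.
  by apply: contraNneq nis => <-.
split.
- move=> j; rewrite inE => /predU1P[->|sj]; first by rewrite /upd !eqxx.
  rewrite /upd eqxx /=; case: andP => [[/eqP e1 /eqP e2]|_]; last exact: H1.
  by have := inj j i (mem_tl i sj) (mem_head _ _) e1 e2 => ->.
- move=> b x y nb; rewrite /upd; case: and3P => [[/eqP e0 /eqP e1 /eqP e2]|_].
    by case: nb; split=> //; exists i; rewrite mem_head.
  apply: H2 => -[eb [k [sk ex ey]]]; apply: nb; split=> //.
  by exists k; split=> //; exact: mem_tl.
Qed.

Section Vertices.
Variable n : nat.

Lemma has_iota (P : pred nat) : has P (iota 0 n) = [exists i : 'I_n, P i].
Proof.
apply/hasP/existsP => [[i]|[i Pi]].
  by rewrite mem_iota add0n => lt Pi; exists (Ordinal lt).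
by exists (val i) => //; rewrite mem_iota ltn_ord.
Qed.

Lemma allpairs_mkseq (T : Type) (G : nat -> nat -> T) (g : 'I_n -> 'I_n -> T) :
  (forall i j : 'I_n, G i j = g i j) ->
  [seq g i j | i <- enum 'I_n, j <- enum 'I_n] =
  mkseq (fun p => G (p %/ n) (p %% n)) (n * n).
Proof.
move=> Gg.
have -> : [seq g i j | i <- enum 'I_n, j <- enum 'I_n] =
    [seq G i j | i <- iota 0 n, j <- iota 0 n].
  rewrite -val_enum_ord allpairs_mapl.
  by congr flatten; apply: eq_map => i; rewrite -map_comp; apply: eq_map => j; rewrite /= Gg.
have H m : [seq G i j | i <- iota 0 m, j <- iota 0 n] = mkseq (fun p => G (p %/ n) (p %% n)) (m * n).
  elim: m => // m IH; rewrite -addn1 iotaD map_cat flatten_cat IH mulnDl mul1n.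
  rewrite /mkseq iotaD map_cat /= add0n cats0; congr cat.
  rewrite -[m * n]addn0 (iotaDl (m * n)) -map_comp; apply/eq_in_map => j.
  rewrite mem_iota add0n /= => lt.
  have n0 : 0 < n by apply: leq_ltn_trans lt.
  by rewrite divnMDl // modnMDl divn_small // modn_small // addn0.
exact: H.
Qed.

Lemma nth_encode (e : rel 'I_n) (i j : 'I_n) : nth false (encode_graph e) (i * n + j) = e i j.
Proof.
have n0 : 0 < n by apply: leq_ltn_trans (ltn_ord i).
rewrite /encode_graph (allpairs_mkseq
  (G := fun x y => if (insub x, insub y) is (Some i, Some j) then e i j else false)); last first.
  by move=> i' j'; rewrite !valK.
rewrite nth_mkseq ?entry_lt // divnMDl // modnMDl divn_small // modn_small // addn0.
by rewrite !valK.
Qed.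

Lemma encode_setE (C : {set 'I_n}) (f : nat -> bool) :
  (forall i : 'I_n, f i = (i \in C)) -> mkseq f n = encode_set C.
Proof.
move=> H; rewrite /mkseq -val_enum_ord -map_comp; apply: eq_map => i; exact: H.
Qed.

Lemma encode_coloringE (f : 'I_n -> 'I_n) (G : nat -> nat -> bool) :
  (forall i j : 'I_n, G i j = (f i == j)) ->
  mkseq (fun p => G (p %/ n) (p %% n)) (n * n) = encode_coloring f.
Proof. by move=> H; rewrite -(allpairs_mkseq H). Qed.

End Vertices.

Definition True_ := Not (Lt 0 0).
Definition Or a b := Not (And (Not a) (Not b)).
Definition Imp a b := Not (And a (Not b)).
Definition All b := Not (Ex (Not b)).

Section Formulas.
Variable n : nat.
Notation bev := (bev n).
Notation exec := (exec n).

Lemma bev_true rho d : bev True_ rho d. Proof. by rewrite /= ltnn. Qed.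
Lemma bev_or a b rho d : bev (Or a b) rho d = bev a rho d || bev b rho d.
Proof. by rewrite /= negb_and !negbK. Qed.
Lemma bev_imp a b rho d : bev (Imp a b) rho d = (bev a rho d ==> bev b rho d).
Proof. by rewrite /= negb_and negbK implybE. Qed.
Lemma bev_ex b rho d : bev (Ex b) rho d = [exists i : 'I_n, bev b (rcons rho i) d].
Proof. exact: (has_iota _ (fun i => bev b (rcons rho i) d)). Qed.
Lemma bev_all b rho d : bev (All b) rho d = [forall i : 'I_n, bev b (rcons rho i) d].
Proof. by rewrite /= (has_iota _ (fun i => ~~ bev b (rcons rho i) d)) negb_exists; apply: eq_forallb => i; rewrite negbK. Qed.

Lemma nth_last_rcons (rho : seq nat) i : nth 0 (rcons rho i) (size rho) = i.
Proof. by rewrite nth_rcons ltnn eqxx. Qed.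

Lemma exec_for_diag a b rho d k : size rho = k ->
  (forall i d', i < n ->
     (forall c x y, ~ [/\ c = a, x = y & x != i] -> d' c x y = d c x y) ->
     bev b (rcons rho i) d' = bev b (rcons rho i) d) ->
  let r := exec (For (Set_ a k k b)) rho d in
  (forall i, i < n -> r a i i = bev b (rcons rho i) d) /\
  (forall c x y, c != a -> r c x y = d c x y).
Proof.
move=> <- ext r.
have rE : r = foldr (fun i d => upd d a i i (bev b (rcons rho i) d)) d (iota 0 n).
  by apply: eq_in_foldr => i t _ /=; rewrite nth_last_rcons.
have [|i d' ii H|H1 H2] := @foldr_upd _ d a id id (fun i d => bev b (rcons rho i) d) (iota 0 n) (iota_uniq 0 n).
- by move=> i j _ _.
- apply: ext => [|c x y nc]; first by move: ii; rewrite mem_iota.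
  apply: H => -[ec [j [_ ne ex ey]]]; apply: nc; split=> //; first by rewrite ex ey.
  by rewrite ex.
split=> [i lt|c x y ne]; rewrite rE; first by apply: H1; rewrite mem_iota.
by apply: H2 => -[ec _]; rewrite ec eqxx in ne.
Qed.

Lemma exec_for_row a v b rho d k : size rho = k -> v < k ->
  (forall i d', i < n ->
     (forall c x y, ~ [/\ c = a, x = nth 0 rho v & y != i] -> d' c x y = d c x y) ->
     bev b (rcons rho i) d' = bev b (rcons rho i) d) ->
  let r := exec (For (Set_ a v k b)) rho d in
  (forall i, i < n -> r a (nth 0 rho v) i = bev b (rcons rho i) d) /\
  (forall c x y, (c != a) || (x != nth 0 rho v) -> r c x y = d c x y).
Proof.
move=> <- ltv ext r.
have rE : r = foldr (fun i d => upd d a (nth 0 rho v) i (bev b (rcons rho i) d)) d (iota 0 n).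
  by apply: eq_in_foldr => i t _ /=; rewrite nth_last_rcons nth_rcons ltv.
have [|i d' ii H|H1 H2] := @foldr_upd _ d a (fun _ => nth 0 rho v) id
  (fun i d => bev b (rcons rho i) d) (iota 0 n) (iota_uniq 0 n).
- by move=> i j _ _.
- apply: ext => [|c x y nc]; first by move: ii; rewrite mem_iota.
  apply: H => -[ec [j [_ ne ex ey]]]; apply: nc; split=> //.
  by rewrite ey.
split=> [i lt|c x y ne]; rewrite rE; first by apply: H1; rewrite mem_iota.
by apply: H2 => -[ec [j [_ ex _]]]; move: ne; rewrite ec ex !eqxx.
Qed.

Fixpoint tuples k : seq (seq nat) :=
  if k is k'.+1 then [seq i :: t | i <- iota 0 n, t <- tuples k'] else [:: [::]].

Lemma size_tuples k : size (tuples k) = n ^ k.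
Proof. by elim: k => //= k IH; rewrite size_allpairs size_iota IH expnS. Qed.

Lemma mem_tuples k t : (t \in tuples k) = (size t == k) && all (ltn^~ n) t.
Proof.
elim: k t => [|k IH] [|i t] //=.
  by apply/allpairsP => -[[? ?] []].
rewrite eqSS; apply/allpairsP/and3P => [[[j u] /= [+ + [-> ->]]]|[sz lti ltt]].
  by rewrite mem_iota IH => lt /andP[-> ->]; split.
by exists (i, t); split; rewrite // ?mem_iota // IH sz.
Qed.

Fixpoint nest k s := if k is k'.+1 then For (nest k' s) else s.

Lemma exec_nest k s rho d :
  exec (nest k s) rho d = foldr (fun t d => exec s (rho ++ t) d) d (tuples k).
Proof.
elim: k rho d => [|k IH] rho d /=; first by rewrite cats0.
transitivity (foldr (fun i d => foldr (fun t d => exec s (rcons rho i ++ t) d) d (tuples k)) d (iota 0 n)).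
  by apply: eq_in_foldr => i t _; exact: IH.
rewrite foldr_allpairs -[in RHS](map_allpairs (fun p : nat * seq nat => p.1 :: p.2) pair).
by rewrite foldr_map; apply: eq_in_foldr => -[i t] d' _; rewrite cat_rcons.
Qed.

(** The [a] outer loops only count n^a rounds; their variables can be set to 0, which makes all
    rounds the same function as [greedy] requires. *)
Lemma exec_greedy a b cond body d0 :
  (forall r t d, size r = a -> size t = b ->
     exec body (r ++ t) d = exec body (nseq a 0 ++ t) d) ->
  (forall r t d, size r = a -> size t = b ->
     bev cond (r ++ t) d = bev cond (nseq a 0 ++ t) d) ->
  exec (nest a (nest b (If cond body))) [::] d0 =
  foldr (fun _ d => round (fun d t => bev cond (nseq a 0 ++ t) d)
    (fun d t => exec body (nseq a 0 ++ t) d) (tuples b) d) d0 (tuples a).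
Proof.
move=> Hb Hc; rewrite exec_nest; apply: eq_in_foldr => r d.
rewrite mem_tuples => /andP[/eqP szr _]; rewrite exec_nest.
apply: eq_in_foldr => t d'; rewrite mem_tuples => /andP[/eqP szt _].
by rewrite -(Hb r) // -(Hc r).
Qed.

(** The same word is written into every row, so that in particular row [n.-1], the one unloaded by
    [row_program], contains it. *)
Lemma exec_output b d (out : nat -> bool) :
  (forall z i d', i < n -> (forall c x y, c != 9 -> d' c x y = d c x y) ->
     bev b [:: z; i] d' = out i) ->
  forall z i, z < n -> i < n -> exec (For (For (Set_ 9 0 1 b))) [::] d 9 z i = out i.
Proof.
move=> bout z i ltz lti.
rewrite [exec _ _ _](foldr_allpairs (fun z i d => upd d 9 z i (bev b [:: z; i] d))).
have [||p d' /allpairsP[[z' i'] /= [_ + ->]] H|H _] := @foldr_upd _ d 9 fst snd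
  (fun p d => bev b [:: p.1; p.2] d) [seq (x, y) | x <- iota 0 n, y <- iota 0 n].
- by apply: allpairs_uniq (iota_uniq 0 n) (iota_uniq 0 n) _ => -[? ?] [? ?].
- by move=> [? ?] [? ?] _ _ /= -> ->.
- rewrite mem_iota => lti' /=; rewrite (bout z' i' d') // ?(bout z' i' d) //.
  by move=> c x y ne; apply: H => -[ec]; rewrite ec eqxx in ne.
rewrite (H (z, i)) /=; first exact: bout.
by apply: allpairs_f; rewrite mem_iota.
Qed.

(** * Vertices without six independent neighbours *)

(* Track 0 is adjacency, the diagonal of track 1 marks dead vertices, that of
   track 8 an independent set, and track 9 is the output if it is a set. *)
Definition alive_nbr v x := And (Cell 0 v x) (Not (Cell 1 x x)).

(** The members are chosen in increasing order, which makes them distinct; [prev] lists the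
    variables of those already chosen. *)
Fixpoint indep j k v (prev : seq nat) : bexp :=
  if j is j'.+1 then
    Ex (foldr (fun p b => And (And (Lt p k) (Not (Cell 0 p k))) b)
      (And (alive_nbr v k) (indep j' k.+1 v (k :: prev))) prev)
  else True_.

Definition later_indep (d : data) (x y : nat) := (x < y) && ~~ d 0 x y.

Lemma bev_indep j k v prev rho (d : data) : size rho = k -> v < k -> all (ltn^~ k) prev ->
  reflect (exists s : seq 'I_n, [/\ size s = j,
     all (fun x : 'I_n => d 0 (nth 0 rho v) x && ~~ d 1 x x) s,
     pairwise (fun x y : 'I_n => later_indep d x y) s &
     all (fun p => all (fun x : 'I_n => later_indep d (nth 0 rho p) x) s) prev])
    (bev (indep j k v prev) rho d).
Proof.
elim: j k prev rho => [|j IH] k prev rho szk ltv ltp.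
  rewrite bev_true; apply: ReflectT; exists [::]; split=> //.
  by elim: prev {ltp}.
have nthr i p : p < k -> nth 0 (rcons rho i) p = nth 0 rho p.
  by move=> lt; rewrite nth_rcons szk lt.
have body i : bev (foldr (fun p b => And (And (Lt p k) (Not (Cell 0 p k))) b)
      (And (alive_nbr v k) (indep j k.+1 v (k :: prev))) prev) (rcons rho i) d =
   [&& all (fun p => later_indep d (nth 0 rho p) i) prev,
       d 0 (nth 0 rho v) i && ~~ d 1 i i &
       bev (indep j k.+1 v (k :: prev)) (rcons rho i) d].
  move: (indep _ _ _ (k :: prev)) => B.
  elim: prev ltp => [|p s IHs] /=.
    by rewrite nthr // -szk !nth_last_rcons.
  by case/andP=> ltpk /IHs ->; rewrite nthr // -szk nth_last_rcons /later_indep !andbA.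
have IHi i := IH k.+1 (k :: prev) (rcons rho i).
rewrite [indep _ _ _ _]/= bev_ex; apply: (iffP existsP) => [[i]|].
  rewrite body => /and3P[Rp Ni /IHi[]].
  - by rewrite size_rcons szk.
  - exact: ltnW.
  - rewrite /= leqnn /=; apply: sub_all ltp => p; exact: ltnW.
  move=> s [sz Ns Rs]; rewrite /= -{1}szk nth_last_rcons => /andP[Ris Rps].
  exists (i :: s); split; rewrite /= ?sz //.
  - by rewrite Ni nthr // in Ns *; apply: sub_all Ns.
  - by rewrite Ris.
  - apply/allP => p pin; have lt := allP ltp _ pin.
    by rewrite /= (allP Rp) //= -(nthr i p) //; apply: (allP Rps).
case=> [] [|i s] [] //= [sz] /andP[Ni Ns] /andP[Ris Rs] Rps; exists i.
rewrite body; apply/and3P; split=> //.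
  by apply/allP => p /(allP Rps) /andP[].
apply/IHi.
- by rewrite size_rcons szk.
- exact: ltnW.
- rewrite /= leqnn /=; apply: sub_all ltp => p; exact: ltnW.
exists s; split=> //; first by rewrite nthr.
rewrite /= -{1}szk nth_last_rcons Ris; apply/allP => p pin.
have ltpk : p < k by apply: (allP ltp).
by rewrite /= nthr //; have /= /andP[] := allP Rps _ pin.
Qed.

Definition small (e : rel 'I_n) (U : {set 'I_n}) (v : 'I_n) := forall S : {set 'I_n},
  S \subset U -> (forall x, x \in S -> e v x) -> is_independent e S -> #|S| <= 5.

Definition dset (d : data) a : {set 'I_n} := [set i : 'I_n | d a i i].

Lemma bev_small (e : rel 'I_n) k v rho (d : data) (i : 'I_n) : symmetric e ->
  (forall i j : 'I_n, d 0 i j = e i j) -> size rho = k -> v < k -> nth 0 rho v = i ->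
  reflect (small e (~: dset d 1) i) (bev (Not (indep 6 k v [::])) rho d).
Proof.
move=> esym de szk ltv ei; apply: (iffP negP) => [ni S SU NS iS|sm].
  rewrite leqNgt; apply/negP => gt5; apply: ni; apply/(@bev_indep 6 k v [::] rho d szk ltv isT).
  (* The enumeration of a set is increasing, so its first six members come in the order that [indep]
     asks for. *)
  have subS : {subset take 6 (enum S) <= S} by move=> x /mem_take; rewrite mem_enum.
  exists (take 6 (enum S)); split=> //.
  - by rewrite size_takel // -cardE.
  - apply/allP => x /subS Sx; rewrite ei de NS //=.
    by have := subsetP SU _ Sx; rewrite !inE.
  - have pw : pairwise (fun x y : 'I_n => x < y) (take 6 (enum S)).
      have sub : subseq (take 6 (enum S)) (enum 'I_n).
        apply: subseq_trans (take_subseq _ _) _.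
        by rewrite [enum 'I_n]enumT; apply: filter_subseq.
      apply: subseq_pairwise sub _.
      have := iota_ltn_sorted 0 n; rewrite (sorted_pairwise ltn_trans).
      by rewrite -val_enum_ord pairwise_map.
    have nadj : {in mem (take 6 (enum S)) &, subrel (fun x y : 'I_n => x < y)
        (fun x y : 'I_n => later_indep d x y)}.
      move=> x y /subS Sx /subS Sy lt; rewrite /later_indep lt de /=.
      by apply: iS => //; apply: contraTneq lt => ->; rewrite ltnn.
    by apply: (sub_in_pairwise nadj) pw; apply/allP.
case/(@bev_indep 6 k v [::] rho d szk ltv isT) => [s [sz Ns Rs _]].
have us : uniq s.
  move: Rs; elim: s {sz Ns} => //= x s IHs /andP[/allP Rx /IHs ->]; rewrite andbT.
  by apply/negP => /Rx; rewrite /later_indep ltnn.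
suff : 6 <= 5 by [].
rewrite -{1}sz -(card_uniqP us) -cardsE; apply: sm.
- by apply/subsetP => x; rewrite !inE => /(allP Ns) /andP[].
- by move=> x; rewrite inE => /(allP Ns) /andP[]; rewrite ei de.
have nadj : {in s &, forall x y, x != y -> ~~ e x y}.
  move: Rs; elim: s {sz Ns us} => // x s IHs /= /andP[/allP Rx /IHs {}IHs] y z.
  rewrite !inE => /predU1P[->|sy] /predU1P[->|sz]; rewrite ?eqxx //.
  - by move=> _; have /andP[_] := Rx _ sz; rewrite de.
  - by move=> _; have /andP[_] := Rx _ sy; rewrite de esym.
  - exact: IHs.
by move=> x y; rewrite !inE; apply: nadj.
Qed.

End Formulas.

(** * Independent set *)

Definition elim_cond := And (Not (Cell 1 1 1)) (Not (indep 6 2 1 [::])).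
Definition elim_is_body :=
  Seq (Set_ 8 1 1 True_) (Seq (For (Set_ 1 2 2 (Or (Cell 1 2 2) (Cell 0 1 2))))
  (Set_ 1 1 1 True_)).
Definition elim_is := For (For (If elim_cond elim_is_body)).

Section IndependentSet.
Variables (n : nat) (e : rel 'I_n).
Hypotheses (esym : symmetric e) (eirr : irreflexive e).
Notation bev := (bev n).
Notation exec := (exec n).
Notation dset := (dset n).

Lemma elim_condE (d : data) (r : nat) (v : 'I_n) : (forall i j : 'I_n, d 0 i j = e i j) ->
  reflect (v \notin dset d 1 /\ small e (~: dset d 1) v) (bev elim_cond [:: r; val v] d).
Proof.
move=> de; rewrite [bev _ _ _]/(~~ d 1 v v && bev (Not (indep 6 2 1 [::])) [:: r; val v] d).
by apply: (iffP andP) => -[nv sm]; split; rewrite ?inE // in nv *;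
  apply/(@bev_small n e 2 1 [:: r; val v] d v esym de).
Qed.

Lemma elim_is_bodyE (d : data) (r : nat) (v : 'I_n) : (forall i j : 'I_n, d 0 i j = e i j) ->
  let d' := exec elim_is_body [:: r; val v] d in
  [/\ dset d' 8 = v |: dset d 8, dset d' 1 = v |: (dset d 1 :|: [set u | e v u]) &
      forall c x y, c != 1 -> c != 8 -> d' c x y = d c x y].
Proof.
move=> de.
set d1 := upd d 8 v v true.
have [|H1 H2] := @exec_for_diag n 1 (Or (Cell 1 2 2) (Cell 0 1 2)) [:: r; val v] d1 2 (erefl _).
  move=> i d' lti H; rewrite !bev_or /= !H //; first by case.
  by case=> _ _; rewrite eqxx.
have -> : exec elim_is_body [:: r; val v] d =
    upd (exec (For (Set_ 1 2 2 (Or (Cell 1 2 2) (Cell 0 1 2)))) [:: r; val v] d1) 1 v v true.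
  by rewrite /d1 -[true](@bev_true n [:: r; val v] d) /= !ltnn.
move: H1 H2; set d2 := exec _ _ d1 => H1 H2 /=; split.
- apply/setP => i; rewrite !inE /upd /= H2 // /d1 /upd /=.
  by rewrite andbb val_eqE; case: eqP.
- apply/setP => i; rewrite !inE /upd /= andbb val_eqE; case: eqP => //= _.
  by rewrite H1 // bev_or /= /d1 /upd /= -de.
- by move=> c x y n1 n8; rewrite /upd (negbTE n1) H2 // /d1 /upd (negbTE n8).
Qed.

Lemma elim_cond_rounds r v (d : data) :
  bev elim_cond [:: r; v] d = bev elim_cond [:: 0; v] d.
Proof.
rewrite [LHS]/(~~ d 1 v v && ~~ bev (indep 6 2 1 [::]) [:: r; v] d).
rewrite [RHS]/(~~ d 1 v v && ~~ bev (indep 6 2 1 [::]) [:: 0; v] d).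
have P r' := @bev_indep n 6 2 1 [::] [:: r'; v] d (erefl _) isT isT.
by congr (_ && ~~ _); apply/idP/idP => /P H; apply/P.
Qed.

(** Charging scheme of the greedy choice: each removed vertex is charged to the chosen one that
    removed it. It serves twice, with a competing independent set and c = 5 for the ratio, and with
    all vertices and c = 6 for the size of H. *)
Definition is_charge (D0 D I : {set 'I_n}) := forall (X : {set 'I_n}) c,
  (forall (U : {set 'I_n}) v, U \subset ~: D0 -> v \in U -> small e U v ->
     #|X :&: (v |: [set u in U | e v u])| <= c) ->
  #|X :&: (D :\: D0)| <= c * #|I|.

Lemma elim_isP (d0 : data) : (forall i j : 'I_n, d0 0 i j = e i j) ->
  dset d0 8 = set0 -> sparse e ->
  let d := exec elim_is [::] d0 in
  [/\ forall c x y, c != 1 -> c != 8 -> d c x y = d0 c x y,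
      is_independent e (dset d 8), [disjoint dset d 8 & dset d0 1] &
      is_charge (dset d0 1) setT (dset d 8)].
Proof.
move=> d0e d08 esp.
pose D0 := dset d0 1.
pose Inv d := [/\ forall c x y, c != 1 -> c != 8 -> d c x y = d0 c x y,
   [/\ D0 \subset dset d 1, dset d 8 \subset dset d 1, [disjoint dset d 8 & D0] &
      forall v u, v \in dset d 8 -> e v u -> u \in dset d 1],
   is_independent e (dset d 8) & is_charge D0 (dset d 1) (dset d 8)].
have InvE d : Inv d -> forall i j : 'I_n, d 0 i j = e i j.
  by case=> H _ _ _ i j; rewrite H.
rewrite [exec _ _ _](@exec_greedy n 1 1 elim_cond elim_is_body).
2: by move=> [|r [|r1 r2]] [|v [|v1 v2]] d e1 e2; try discriminate; rewrite /= !ltnn.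
2: by move=> [|r [|r1 r2]] [|v [|v1 v2]] d e1 e2; try discriminate; exact: elim_cond_rounds.
set d := foldr _ _ _.
have [] := @greedy _ _ (fun d t => bev elim_cond (nseq 1 0 ++ t) d)
  (fun d t => exec elim_is_body (nseq 1 0 ++ t) d) Inv (fun d => #|dset d 1|)
  (tuples n 1) _ (tuples n 1) d0.
- move=> t [|v' [|? ?]]; rewrite mem_tuples //= => /andP[ltv _] It.
  have te := InvE _ It; pose v := Ordinal ltv.
  case/(elim_condE 0 v te) => nv sm.
  have [e8 e1 eo] := elim_is_bodyE 0 v te.
  change (Inv (exec elim_is_body [:: 0; val v] t) /\
    #|dset t 1| < #|dset (exec elim_is_body [:: 0; val v] t) 1|).
  move: (exec _ _ _) e8 e1 eo => t' e8 e1 eo.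
  case: It => Ho [sub0 sub8 dis8 nbr] indt ch; split; last first.
    apply: proper_card; rewrite e1; apply/properP; split; last by exists v; rewrite ?setU11.
    by rewrite setUA (subset_trans (subsetUr [set v] _)) ?subsetUl.
  have vI : v \notin dset t 8 by apply: contraNN nv; apply: (subsetP sub8).
  split=> [c x y n1 n8||i j|].
  + by rewrite eo // Ho.
  + rewrite e8 e1; split.
    * by rewrite setUA (subset_trans sub0) // (subset_trans (subsetUr [set v] _)) ?subsetUl.
    * by rewrite setUS // (subset_trans sub8) // subsetUl.
    * rewrite disjoint_sym disjoints_subset; apply/subsetP => x x0; rewrite !inE negb_or.
      apply/andP; split; first by apply: contraNneq nv => <-; apply: (subsetP sub0).
      by move: dis8; rewrite disjoint_sym => /pred0P /(_ x) /=; rewrite x0 /= inE => ->.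
    * move=> w u; rewrite inE in_set1 => /predU1P[->|wI] ewu; rewrite !in_setU.
        have uN : u \in [set x | e v x] by rewrite inE.
        by rewrite uN !orbT.
      by rewrite (nbr w) ?orbT.
  + rewrite e8 !in_setU !in_set1 => /predU1P[->|iI] /predU1P[->|jI]; rewrite ?eqxx //.
    * by move=> _; apply: contraNN nv => /(etrans (esym j v)); apply: nbr.
    * by move=> _; apply: contraNN nv; apply: nbr.
    * exact: indt.
  + move=> X c Xc; rewrite e8 e1 cardsU1 vI mulnDr muln1.
    (* The vertices that die in this step are [v] and its alive neighbours; they are charged to
       [v]. *)
    apply: leq_trans (leq_add (Xc (~: dset t 1) v _ _ sm) (ch X c Xc)).
    * apply: leq_trans (leq_card_setU _ _); apply: subset_leq_card; apply/subsetP => x.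
      rewrite !(in_setI, in_setU, in_setD, in_set1, in_setC, in_set).
      by case: (x \in X); case: (x == v); case: (t 1 x x); case: (e v x); case: (x \in D0).
    * by rewrite setCS.
    * by rewrite inE nv.
- by move=> t _; rewrite size_tuples expn1 -[X in _ <= X]card_ord max_card.
- split=> //.
  + split=> //.
    * by rewrite d08 sub0set.
    * by rewrite d08 disjoints_subset sub0set.
    * by move=> v u; rewrite d08 inE.
  + by move=> i j; rewrite d08 inE.
  + by move=> X c _; rewrite setDv setI0 cards0.
rewrite -/d => -[Ho [sub0 sub8 dis8 nbr] indt ch] term; split=> //.
suff <- : dset d 1 = setT by [].
apply/eqP; rewrite -[_ == _]negbK; apply/negP => nT.
have U0 : ~: dset d 1 != set0 by rewrite -setCT (inj_eq (@setC_inj _)).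
(* As long as a vertex is alive, sparsity provides a good one, and the loop would not have ended. *)
have [v vU sm] := esp _ U0.
have de : forall i j : 'I_n, d 0 i j = e i j by move=> i j; rewrite Ho.
have vt : [:: val v] \in tuples n 1 by rewrite mem_tuples /= ltn_ord.
have /negP[] := term _ vt.
by apply/(elim_condE 0 v de); split; [rewrite -in_setC|].
Qed.
End IndependentSet.

Definition is_program := Seq elim_is (For (For (Set_ 9 0 1 (Cell 8 1 1)))).

Lemma input_dataE n (e : rel 'I_n) (i j : 'I_n) :
  input_data n (encode_graph e) 0 i j = e i j.
Proof. exact: nth_encode. Qed.

Lemma input_data0 n s c x y : c != 0 -> input_data n s c x y = false.
Proof. by rewrite /input_data => /negbTE->. Qed.

Lemma independent_set_machine :
  exists M : TM, polytime_on_circle_graphs M good_independent_set.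
Proof.
have [M [c Hc]] := @row_program 9 9 is_program 9 isT isT isT.
exists M, c => n e ce; have [t [cf [let_ rt outE]]] := Hc n e.
exists t, cf; split=> //; split=> //; rewrite outE.
have d08 : dset n (input_data n (encode_graph e)) 8 = set0.
  by apply/setP => i; rewrite !inE input_data0.
have [_ indI _ ch] := elim_isP (circle_sym ce) (@input_dataE n e) d08 (circle_sparse ce).
have -> : exec n is_program [::] (input_data n (encode_graph e)) =
  exec n (For (For (Set_ 9 0 1 (Cell 8 1 1)))) [::]
    (exec n elim_is [::] (input_data n (encode_graph e))) by [].
move: (exec n elim_is _ _) indI ch => d indI ch.
exists (dset n d 8); split; [|split=> // I' indI'].
  apply: encode_setE => i; rewrite inE.
  apply: (exec_output (out := fun i => d 8 i i)) => //.
    by move=> z i' d' _ H /=; rewrite H.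
  by rewrite ltn_predL (leq_ltn_trans _ (ltn_ord i)).
have d01 : dset n (input_data n (encode_graph e)) 1 = set0.
  by apply/setP => i; rewrite !inE input_data0.
have -> : #|I'| = #|I' :&: (setT :\: dset n (input_data n (encode_graph e)) 1)|.
  by rewrite d01 setD0 setIT.
apply: ch => U v _ vU sm.
(* If [v] belongs to the competitor, none of its neighbours does and the loss is one. Otherwise the
   loss is an independent set of alive neighbours of a good vertex. *)
have [vI|nvI] := boolP (v \in I').
  suff sub : I' :&: (v |: [set u in U | e v u]) \subset [set v].
    by apply: leq_trans (subset_leq_card sub) _; rewrite cards1.
  apply/subsetP => u; rewrite !inE => /andP[uI /orP[//|/andP[_ evu]]].
  have := indI' _ _ vI uI; rewrite evu eq_sym.
  by case: (eqVneq u v) => // _ /(_ isT).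
apply: sm.
- apply/subsetP => u; rewrite !inE => /andP[uI /orP[/eqP uv|/andP[]//]].
  by rewrite uv (negbTE nvI) in uI.
- move=> u; rewrite !inE => /andP[uI /orP[/eqP uv|/andP[]//]].
  by rewrite uv (negbTE nvI) in uI.
- by move=> x y; rewrite !in_setI => /andP[xI _] /andP[yI _]; apply: indI'.
Qed.

(** * Coloring *)

(* Track 2 links a vertex to its neighbours that are removed after it. *)
Definition elim_col_body :=
  Seq (For (Set_ 2 1 2 (And (Cell 0 1 2) (Not (Cell 1 2 2))))) (Set_ 1 1 1 True_).
Definition elim_col := For (For (If elim_cond elim_col_body)).

(* Track 3 is the coloring: a vertex gets the least color that is free among
   its later neighbours, once all these are colored. *)
Definition color_cond :=
  And (Not (Ex (Cell 3 1 3)))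
  (And (All (Imp (Cell 2 1 3) (Ex (Cell 3 3 4))))
  (And (Not (Ex (And (Cell 2 1 3) (Cell 3 3 2))))
       (All (Imp (Lt 3 2) (Ex (And (Cell 2 1 4) (Cell 3 4 3))))))).
Definition color_loop := For (For (For (If color_cond (Set_ 3 1 2 True_)))).

Section Coloring.
Variables (n : nat) (e : rel 'I_n).
Hypotheses (esym : symmetric e) (eirr : irreflexive e).
Notation bev := (bev n).
Notation exec := (exec n).
Notation dset := (dset n).

Definition later (d : data) (v : 'I_n) : {set 'I_n} := [set u : 'I_n | d 2 v u].

Lemma elim_col_bodyE (d : data) (r : nat) (v : 'I_n) : (forall i j : 'I_n, d 0 i j = e i j) ->
  let d' := exec elim_col_body [:: r; val v] d in
  [/\ forall u, later d' u = if u == v then [set x | e v x & x \notin dset d 1] else later d u,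
      dset d' 1 = v |: dset d 1 &
      forall c x y, c != 1 -> c != 2 -> d' c x y = d c x y].
Proof.
move=> de.
have [//||H1 H2] := @exec_for_row n 2 1 (And (Cell 0 1 2) (Not (Cell 1 2 2))) [:: r; val v] d 2 (erefl _).
  by move=> i d' lti H /=; rewrite !H //; case.
have -> : exec elim_col_body [:: r; val v] d =
    upd (exec (For (Set_ 2 1 2 (And (Cell 0 1 2) (Not (Cell 1 2 2))))) [:: r; val v] d) 1 v v true.
  by rewrite -[true](@bev_true n [:: r; val v] d) /= !ltnn.
move: H1 H2; set d2 := exec _ _ d => /= H1 H2 /=; split.
- move=> u; apply/setP => x; rewrite inE /upd /=; case: eqP => [->|/eqP ne].
    by rewrite H1 //= !inE de.
  by rewrite H2 ?inE // ne.
- by apply/setP => i; rewrite !inE /upd /= andbb val_eqE; case: eqP => //= _; rewrite H2.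
- by move=> c x y n1 n2; rewrite /upd (negbTE n1) H2 // n2.
Qed.

(** The order of removal is not recorded in the data. The fourth clause replaces it: the member of
    [X] removed last has all other members dead at that time. *)
Lemma elim_colP (d0 : data) : (forall i j : 'I_n, d0 0 i j = e i j) ->
  dset d0 1 = set0 -> (forall v, later d0 v = set0) -> sparse e ->
  let d := exec elim_col [::] d0 in
  [/\ forall c x y, c != 1 -> c != 2 -> d c x y = d0 c x y,
      forall v, later d v \subset [set u | e v u],
      forall v u, e v u -> (u \in later d v) || (v \in later d u),
      forall X : {set 'I_n}, X != set0 -> exists2 v, v \in X & [disjoint X & later d v] &
      forall v (S : {set 'I_n}), S \subset later d v -> is_independent e S -> #|S| <= 5].
Proof.
move=> d0e d01 d02 esp.
pose Inv d := [/\ forall c x y, c != 1 -> c != 2 -> d c x y = d0 c x y,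
   (forall v, later d v \subset [set u | e v u]) /\ (forall v, v \notin dset d 1 -> later d v = set0),
   forall v u, e v u -> v \in dset d 1 -> (u \in later d v) || (v \in later d u),
   forall X : {set 'I_n}, X != set0 -> exists2 v, v \in X & [disjoint X & later d v] &
   forall v (S : {set 'I_n}), S \subset later d v -> is_independent e S -> #|S| <= 5].
have InvE d : Inv d -> forall i j : 'I_n, d 0 i j = e i j.
  by case=> H _ _ _ _ i j; rewrite H.
rewrite [exec _ _ _](@exec_greedy n 1 1 elim_cond elim_col_body).
2: by move=> [|r [|r1 r2]] [|v [|v1 v2]] d e1 e2; try discriminate; rewrite /= !ltnn.
2: by move=> [|r [|r1 r2]] [|v [|v1 v2]] d e1 e2; try discriminate; exact: elim_cond_rounds.
set d := foldr _ _ _.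
have [] := @greedy _ _ (fun d t => bev elim_cond (nseq 1 0 ++ t) d)
  (fun d t => exec elim_col_body (nseq 1 0 ++ t) d) Inv (fun d => #|dset d 1|)
  (tuples n 1) _ (tuples n 1) d0.
- move=> t [|v' [|? ?]]; rewrite mem_tuples //= => /andP[ltv _] It.
  have te := InvE _ It; pose v := Ordinal ltv.
  case/(elim_condE esym 0 v te) => nv sm.
  have [e2 e1 eo] := elim_col_bodyE 0 v te.
  change (Inv (exec elim_col_body [:: 0; val v] t) /\
    #|dset t 1| < #|dset (exec elim_col_body [:: 0; val v] t) 1|).
  move: (exec _ _ _) e2 e1 eo => t' e2 e1 eo.
  case: It => Ho [sube out0] cov acy ind; split; last first.
    by rewrite e1 cardsU1 nv.
  have latv u : u \in later t' v = e v u && (u \notin dset t 1).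
    by rewrite e2 eqxx !inE.
  split=> [c x y n1 n2||w u ewu|X X0|w S].
  + by rewrite eo // Ho.
  + split=> w; [|rewrite e1 in_setU1 negb_or => /andP[ne nw]]; rewrite e2.
      case: eqP => [->|_]; last exact: sube.
      by apply/subsetP => u; rewrite !inE => /andP[].
    by rewrite (negbTE ne) out0.
  + rewrite e1 in_setU1; case: (eqVneq w v) => [ew _|ne /= wD].
      subst w; rewrite latv ewu /=; case: (boolP (u \in dset t 1)) => //= uD.
      have uv : u != v by apply: contraNneq nv => <-.
      by have := cov u v; rewrite e2 (negbTE uv) (out0 v) // in_set0 orbF => -> //; rewrite esym.
    rewrite e2 (negbTE ne); case/orP: (cov _ _ ewu wD) => [-> //|wu].
    case: (eqVneq u v) => [uv|uv]; last by rewrite e2 (negbTE uv) wu orbT.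
    by rewrite uv out0 // in_set0 in wu.
  + have [XD|] := boolP (X \subset dset t' 1); last first.
      case/subsetPn => w wX; rewrite e1 in_setU1 negb_or => /andP[ne nw]; exists w => //.
      by rewrite e2 (negbTE ne) out0 // disjoint_sym disjoints_subset sub0set.
    have [vX|nvX] := boolP (v \in X).
      exists v => //; rewrite disjoints_subset; apply/subsetP => u uX.
      rewrite in_setC latv negb_and negbK.
      have := subsetP XD _ uX; rewrite e1 in_setU1 => /predU1P[->|->]; last by rewrite orbT.
      by rewrite eirr.
    have [w wX dw] := acy X X0; exists w => //; rewrite e2.
    by case: eqP => // wv; rewrite -wv wX in nvX.
  + rewrite e2; case: eqP => _; last exact: ind.
    move=> sub; apply: sm.
      by apply/subsetP => x /(subsetP sub); rewrite !inE => /andP[].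
    by move=> x /(subsetP sub); rewrite !inE => /andP[].
- by move=> t _; rewrite size_tuples expn1 -[X in _ <= X]card_ord max_card.
- split=> //.
  + by split=> [v|v _]; rewrite d02 ?sub0set.
  + by move=> v u _; rewrite d01 inE.
  + by move=> X /set0Pn[v vX]; exists v => //; rewrite d02 disjoint_sym disjoints_subset sub0set.
  + by move=> v S; rewrite d02 subset0 => /eqP-> _; rewrite cards0.
rewrite -/d => -[Ho [sube out0] cov acy ind] term; split=> //.
suff dT : dset d 1 = setT by move=> v u evu; apply: cov; rewrite // dT inE.
apply/eqP; rewrite -[_ == _]negbK; apply/negP => nT.
have U0 : ~: dset d 1 != set0 by rewrite -setCT (inj_eq (@setC_inj _)).
have [v vU sm] := esp _ U0.
have de : forall i j : 'I_n, d 0 i j = e i j by move=> i j; rewrite Ho.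
have vt : [:: val v] \in tuples n 1 by rewrite mem_tuples /= ltn_ord.
have /negP[] := term _ vt.
by apply/(elim_condE esym 0 v de); split; [rewrite -in_setC|].
Qed.

Definition colored (d : data) : {set 'I_n} := [set v : 'I_n | [exists c : 'I_n, d 3 v c]].

Lemma color_condE (d : data) r (v c : 'I_n) :
  reflect [/\ v \notin colored d, later d v \subset colored d,
      forall u, u \in later d v -> ~~ d 3 u c &
      forall c' : 'I_n, c' < c -> exists2 u : 'I_n, u \in later d v & d 3 u c']
    (bev color_cond [:: r; val v; val c] d).
Proof.
have -> : bev color_cond [:: r; val v; val c] d =
  [&& v \notin colored d, [forall u, (u \in later d v) ==> (u \in colored d)],
      ~~ [exists u : 'I_n, (u \in later d v) && d 3 u c] &
      [forall c' : 'I_n, (c' < c) ==> [exists u : 'I_n, (u \in later d v) && d 3 u c']]].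
  rewrite [bev _ _ _]/[&& ~~ bev (Ex (Cell 3 1 3)) [:: r; val v; val c] d,
    bev (All (Imp (Cell 2 1 3) (Ex (Cell 3 3 4)))) [:: r; val v; val c] d,
    ~~ bev (Ex (And (Cell 2 1 3) (Cell 3 3 2))) [:: r; val v; val c] d &
    bev (All (Imp (Lt 3 2) (Ex (And (Cell 2 1 4) (Cell 3 4 3))))) [:: r; val v; val c] d].
  rewrite !bev_ex !bev_all inE; congr [&& _, _, ~~ _ & _].
  - by apply: eq_forallb => u; rewrite bev_imp bev_ex !inE.
  - by apply: eq_existsb => u; rewrite !inE.
  - apply: eq_forallb => c'; rewrite bev_imp bev_ex; congr (_ ==> _).
    by apply: eq_existsb => u; rewrite !inE.
apply: (iffP and4P) => -[nv sub free least]; split=> //.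
- by apply/subsetP => u; apply/implyP; apply: (forallP sub).
- move=> u uL; apply: contra free => uc; apply/existsP; exists u; exact/andP.
- move=> c' lt; have /implyP/(_ lt)/existsP[u /andP[]] := forallP least c'.
  by exists u.
- by apply/forallP => u; apply/implyP; apply: (subsetP sub).
- by apply/existsP => -[u /andP[uL]]; apply/negP; apply: free.
- apply/forallP => c'; apply/implyP => /least[u uL uc].
  by apply/existsP; exists u; rewrite uL.
Qed.

(** First-fit: every color below [f v] occurs at a later neighbour of [v], which gives the bound on
    [f v]. *)
Lemma color_loopP (d0 : data) :
  (forall v, v \notin later d0 v) ->
  (forall X : {set 'I_n}, X != set0 -> exists2 v, v \in X & [disjoint X & later d0 v]) ->
  (forall i j : 'I_n, ~~ d0 3 i j) ->
  exists f : 'I_n -> 'I_n, [/\ forall v c : 'I_n, exec color_loop [::] d0 3 v c = (f v == c),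
    forall v u, u \in later d0 v -> f u != f v & forall v, f v <= #|later d0 v| ].
Proof.
move=> irr acy d03.
pose Inv d := [/\ forall c x y, c != 3 -> d c x y = d0 c x y,
   forall v c c' : 'I_n, d 3 v c -> d 3 v c' -> c = c',
   forall v u c : 'I_n, u \in later d0 v -> d 3 v c -> exists2 c' : 'I_n, d 3 u c' & c' != c &
   forall v c c' : 'I_n, d 3 v c -> c' < c -> exists2 u : 'I_n, u \in later d0 v & d 3 u c'].
have lE d : Inv d -> later d =1 later d0.
  by case=> H _ _ _ v; apply/setP => u; rewrite !inE H.
rewrite [exec _ _ _](@exec_greedy n 1 2 color_cond (Set_ 3 1 2 True_)).
2: by move=> [|r [|r1 r2]] [|v [|c [|c1 c2]]] d e1 e2; try discriminate; rewrite /= !ltnn.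
2: by move=> [|r [|r1 r2]] [|v [|c [|c1 c2]]] d e1 e2; try discriminate.
set d := foldr _ _ _.
have [] := @greedy _ _ (fun d t => bev color_cond (nseq 1 0 ++ t) d)
  (fun d t => exec (Set_ 3 1 2 True_) (nseq 1 0 ++ t) d) Inv (fun d => #|colored d|)
  (tuples n 2) _ (tuples n 1) d0.
- move=> t [|v' [|c' [|? ?]]]; rewrite mem_tuples //= => /and3P[ltv ltc _] It.
  pose v := Ordinal ltv; pose c := Ordinal ltc; have l0 := lE _ It.
  case/(color_condE t 0 v c); rewrite l0 => nv sub free least.
  change (Inv (upd t 3 v c (bev True_ [:: 0; val v; val c] t)) /\
    #|colored t| < #|colored (upd t 3 v c (bev True_ [:: 0; val v; val c] t))|).
  rewrite bev_true; set t' := upd _ _ _ _ _.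
  have t'3 (w x : 'I_n) : t' 3 w x = ((w == v) && (x == c)) || t 3 w x.
    by rewrite /t' /upd -!val_eqE /=; case: ifP.
  have nvc (x : 'I_n) : ~~ t 3 v x by move: nv; rewrite inE negb_exists => /forallP/(_ x).
  case: It => Ho uni prop ff; split; last first.
    apply: proper_card; apply/properP; split.
      apply/subsetP => w; rewrite !inE => /existsP[x wx]; apply/existsP; exists x.
      by rewrite t'3 wx orbT.
    by exists v => //; rewrite inE; apply/existsP; exists c; rewrite t'3 !eqxx.
  split.
  + by move=> a x y na; rewrite /t' /upd (negbTE na) Ho.
  + move=> w x y; rewrite !t'3; case: (eqVneq w v) => [->|_] /=; last exact: uni.
    by rewrite !(negbTE (nvc _)) !orbF => /eqP-> /eqP->.
  + move=> w u x uw; rewrite t'3; case: (eqVneq w v) => [ew|nw] /=.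
      subst w; rewrite (negbTE (nvc _)) orbF => /eqP->.
      have := subsetP sub _ uw; rewrite inE => /existsP[y uy]; exists y.
        by rewrite t'3 uy orbT.
      by apply: contraTneq uy => ->; apply: free.
    by case/(prop _ _ _ uw) => y uy ne; exists y; rewrite // t'3 uy orbT.
  + move=> w x y; rewrite t'3; case: (eqVneq w v) => [->|nw] /=.
      rewrite (negbTE (nvc _)) orbF => /eqP-> /least[u uL uy].
      by exists u; rewrite // t'3 uy orbT.
    by move=> wx lt; have [u uL uy] := ff _ _ _ wx lt; exists u; rewrite // t'3 uy orbT.
- by move=> t _; rewrite size_tuples expn1 -[X in _ <= X]card_ord max_card.
- by split=> // [v c c'|v u c|v c c']; rewrite ?(negbTE (d03 _ _)) // => _; rewrite (negbTE (d03 _ _)).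
rewrite -/d => Id term; have [Ho uni prop ff] := Id.
have cT : colored d = setT.
  apply/eqP; rewrite -[_ == _]negbK; apply/negP => nT.
  have U0 : ~: colored d != set0 by rewrite -setCT (inj_eq (@setC_inj _)).
  (* Applied to the uncolored vertices, acyclicity yields one whose later neighbours are all
     colored; it could be colored now. *)
  have [v] := acy _ U0; rewrite in_setC => nv; rewrite disjoint_sym disjoints_subset setCK => sub.
  pose used := [set c : 'I_n | [exists u : 'I_n, (u \in later d0 v) && d 3 u c]].
  (* Since [v] is not its own later neighbour, at most n - 1 colors are taken, and the n vertex
     numbers suffice as colors. *)
  have used_lt : #|used| < n.
    have [g gP] : exists g : 'I_n -> 'I_n, forall u, u \in later d0 v -> d 3 u (g u).
      exists (fun u : 'I_n => odflt u [pick c : 'I_n | d 3 u c]) => u uL.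
      case: pickP => //= none; have := subsetP sub _ uL; rewrite inE => /existsP[c].
      by rewrite none.
    have : used \subset g @: later d0 v.
      apply/subsetP => c; rewrite inE => /existsP[u /andP[uL uc]].
      by apply/imsetP; exists u => //; apply: uni uc (gP _ uL).
    move/subset_leq_card => le; apply: leq_ltn_trans le _.
    apply: leq_ltn_trans (leq_imset_card _ _) _.
    rewrite -[X in _ < X]card_ord; apply: proper_card.
    by apply/properP; split; [exact/subsetP|exists v; rewrite // irr].
  have [c0 nc0] : exists c, c \notin used.
    apply/existsP; rewrite -negb_forall; apply/negP => /forallP all.
    have : #|'I_n| <= #|used| by apply/subset_leq_card/subsetP => x _; exact: all.
    by rewrite card_ord leqNgt used_lt.
  case: (@arg_minnP _ c0 [pred c | c \notin used] (fun c : 'I_n => val c) nc0) => c nc least.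
  have vct : [:: val v; val c] \in tuples n 2 by rewrite mem_tuples /= !ltn_ord.
  have /negP[] := term _ vct.
  apply/(color_condE d 0 v c); rewrite lE //; split=> //.
  - move=> u uL; apply: contra nc => uc; rewrite inE; apply/existsP; exists u; exact/andP.
  - move=> c' lt; have : c' \in used.
      by apply: contraTT lt => /least; rewrite -leqNgt.
    by rewrite inE => /existsP[u /andP[]]; exists u.
have fP (v : 'I_n) : {c : 'I_n | d 3 v c}.
  by apply/sigW; apply/existsP; have := in_setT v; rewrite -cT inE.
pose f v := sval (fP v).
have df (v : 'I_n) : d 3 v (f v) := svalP (fP v).
exists f; split.
- move=> v c; apply/idP/eqP => [vc|<-]; last exact: df.
  exact: uni (df v) vc.
- move=> v u uv; have [c uc ne] := prop _ _ _ uv (df v).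
  by rewrite (uni _ _ _ (df u) uc).
- move=> v; pose h (i : 'I_(f v)) := widen_ord (ltnW (ltn_ord (f v))) i.
  rewrite -[X in X <= _]card_ord -(card_imset _ (_ : injective h)); last first.
    by move=> i j /(congr1 val) /= /val_inj.
  apply: leq_trans (leq_imset_card f _); apply: subset_leq_card; apply/subsetP => c.
  case/imsetP=> i _ ->; have [u uL uc] := ff v (f v) (h i) (df v) (ltn_ord i).
  by apply/imsetP; exists u => //; apply: uni uc (df u).
Qed.
End Coloring.

Definition col_program := Seq elim_col color_loop.

Lemma coloring_machine : exists M : TM, polytime_on_circle_graphs M good_coloring.
Proof.
have [M [c Hc]] := @matrix_program 9 9 col_program 3 isT isT isT.
exists M, c => n e ce; have [t [cf [let_ rt outE]]] := Hc n e.
exists t, cf; split=> //; split=> //; rewrite outE.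
pose din := input_data n (encode_graph e).
have d01 : dset n din 1 = set0 by apply/setP => i; rewrite !inE /din input_data0.
have d02 v : later din v = set0 :> {set 'I_n} by apply/setP => i; rewrite !inE /din input_data0.
have [Ho sube cov acy ind] := elim_colP (circle_sym ce) (circle_irr ce)
  (@input_dataE n e) d01 d02 (circle_sparse ce).
have -> : exec n col_program [::] din = exec n color_loop [::] (exec n elim_col [::] din) by [].
move: (exec n elim_col _ _) Ho sube cov acy ind => d Ho sube cov acy ind.
have [||f [fE fprop fle]] := color_loopP _ acy.
- by move=> v; apply/negP => /(subsetP (sube v)); rewrite inE (circle_irr ce).
- by move=> i j; rewrite Ho // /din input_data0.
exists f; split; first exact: encode_coloringE.
split=> [i j _ eij|k g gP].
  by case/orP: (cov _ _ eij) => /fprop //; rewrite eq_sym.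
have later_le (v : 'I_n) : #|later d v| <= 5 * k.
  rewrite -sum1_card (partition_big g predT) //=.
  rewrite -[X in _ <= _ * X]card_ord mulnC -sum_nat_const; apply: leq_sum => x _.
  rewrite sum1dep_card; apply: (ind v).
    by apply/subsetP => u; rewrite in_set => /andP[].
  move=> i j; rewrite !in_set => /andP[_ /eqP ix] /andP[_ /eqP jx] ne.
  by apply/negP => /(gP _ _ ne); rewrite ix jx eqxx.
rewrite /colors_used.
have [n0|n0] := posnP n.
  rewrite (leq_trans (leq_imset_card _ _)) // cardsT card_ord n0 //.
(* Passing from 5k + 1 to 6k takes a positive k, hence the separate treatment of the empty graph. *)
have k0 : 0 < k := leq_ltn_trans (leq0n _) (ltn_ord (g (Ordinal n0))).
pose h (i : 'I_(5 * k).+1) : 'I_n := insubd (Ordinal n0) (val i).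
have sub : f @: [set: 'I_n] \subset h @: [set: 'I_(5 * k).+1].
  apply/subsetP => _ /imsetP[v _ ->]; apply/imsetP.
  have lt : f v < (5 * k).+1 by rewrite ltnS (leq_trans (fle v)).
  by exists (Ordinal lt) => //; apply: val_inj; rewrite val_insubd /= ltn_ord.
apply: leq_trans (subset_leq_card sub) _; apply: leq_trans (leq_imset_card _ _) _.
by rewrite cardsT card_ord; lia.
Qed.

(** * Vertex cover *)

Section CoverBound.
Variables (n : nat) (e : rel 'I_n).
Hypotheses (esym : symmetric e) (eirr : irreflexive e).
Variable T : {set 'I_n}.
Definition restr (v u : 'I_n) := [&& e v u, v \notin T & u \notin T].

(* [M u v] matches the left copy of [v] with the right copy of [u] in the
   bipartite double cover, and [pr u] is the price of the right copy of [u]. *)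
Variables (M : rel 'I_n) (pr : 'I_n -> nat).
Hypotheses (pr_le : forall u, pr u <= n)
  (M_edge : forall u v, M u v -> restr v u)
  (M_left : forall u v v', M u v -> M u v' -> v = v')
  (M_right : forall u u' v, M u v -> M u' v -> u = u')
  (M_pos : forall u, 0 < pr u -> exists v, M u v)
  (M_slack : forall u v w, M u v -> restr v w -> pr u <= (pr w).+1)
  (M_max : forall v w, (forall u, ~~ M u v) -> restr v w -> n <= pr w).

Definition matched := [set u | [exists v, M u v]].
Definition above l := [set u | l < pr u].
Definition below_nbr l := [set v | [exists w, restr v w && (pr w < l)]].

(** The n prices cannot fill the n + 1 levels from 0 to n. The least gap is taken because a program
    can recognize it: every level below it is some price. *)
Lemma free_level : exists l, [/\ l <= n, forall u, pr u != l &
  forall q, q < l -> exists u, pr u = q].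
Proof.
have ex : exists l, (l <= n) && [forall u, pr u != l].
  pose h u : 'I_n.+1 := Ordinal (pr_le u : pr u < n.+1).
  have : #|h @: [set: 'I_n]| < #|'I_n.+1|.
    by rewrite card_ord ltnS (leq_trans (leq_imset_card _ _)) // cardsT card_ord.
  rewrite ltnNge => /negP ns.
  have [l nl] : exists l, l \notin h @: [set: 'I_n].
    apply/existsP; rewrite -negb_forall; apply/negP => /forallP all.
    by apply: ns; apply/subset_leq_card/subsetP => x _; apply: all.
  exists l; rewrite -ltnS ltn_ord; apply/forallP => u; apply: contra nl => /eqP eu.
  by apply/imsetP; exists u => //; apply: val_inj.
case: (ex_minnP ex) => l /andP[ln /forallP fr] least; exists l; split=> // q ql.
have [/existsP[u /eqP]|] := boolP [exists u, pr u == q]; first by exists u.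
rewrite negb_exists => /forallP nq.
by have := least q; rewrite (ltnW (leq_trans ql ln)) leqNgt ql /= => /(_ (introT forallP nq)).
Qed.

(** An unmatched [v] has only neighbours of price at least n. A matched one paid at most one more
    than the price of a neighbour below [l], hence at most [l], and [l] itself is no price. *)
Lemma below_matched l v : l <= n -> (forall u, pr u != l) -> v \in below_nbr l ->
  exists2 u, M u v & pr u < l.
Proof.
move=> ln fr; rewrite inE => /existsP[w /andP[vw wl]].
have [/existsP[u uv]|] := boolP [exists u, M u v].
  by exists u => //; rewrite ltn_neqAle fr (leq_trans (M_slack uv vw)).
rewrite negb_exists => /forallP /M_max /(_ vw) nw.
by move: (leq_trans wl ln); rewrite ltnNge nw.
Qed.

(** Koenig's theorem: right copies above the gap and left copies with a neighbour below it cover the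
    double cover. A matching edge has at most one of its ends there, according to the side of the
    gap on which its price lies. *)
Lemma card_levels l : l <= n -> (forall u, pr u != l) ->
  #|above l| + #|below_nbr l| <= #|matched|.
Proof.
move=> ln fr; rewrite -(cardsID (above l) matched) leq_add //.
  apply/subset_leq_card/subsetP => u ul; rewrite inE ul andbT inE.
  by apply/existsP/M_pos; move: ul; rewrite inE; apply: leq_trans.
pose g v := odflt v [pick u | M u v && (pr u < l)].
have gP v : v \in below_nbr l -> M (g v) v /\ pr (g v) < l.
  move=> /(below_matched ln fr)[u uv ul]; rewrite /g; case: pickP => [x /andP[]|/(_ u)] //.
  by rewrite uv ul.
rewrite -(card_in_imset (f := g)); last first.
  move=> v v' /gP[Mv _] /gP[Mv' _] eg; rewrite eg in Mv; exact: M_left Mv Mv'.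
apply/subset_leq_card/subsetP => _ /imsetP[v /gP[Mv lt] ->].
rewrite !inE -leqNgt ltnW //; apply/existsP; by exists v.
Qed.

(** Weak duality: two copies of [C] cover the double cover. A matched vertex is sent to itself if it
    is in [C], to its partner otherwise. *)
Lemma card_matched (C : {set 'I_n}) : is_vertex_cover e C -> #|matched| <= 2 * #|C :\: T|.
Proof.
move=> vc; rewrite -(cardsID C matched) mul2n -addnn leq_add //.
  apply/subset_leq_card/subsetP => u; rewrite !inE => /andP[/existsP[v /M_edge/and3P[_ _ ->]]].
  by move=> ->.
pose g u := odflt u [pick v | M u v].
have gP u : u \in matched -> M u (g u).
  by rewrite inE => /existsP[v uv]; rewrite /g; case: pickP => [x|/(_ v)] //; rewrite uv.
rewrite -(card_in_imset (f := g)); last first.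
  move=> u u'; rewrite !in_setD => /andP[_ /gP Mu] /andP[_ /gP Mu'] eg.
  by rewrite -eg in Mu'; exact: M_right Mu Mu'.
apply/subset_leq_card/subsetP => _ /imsetP[u + ->]; rewrite in_setD => /andP[uC /gP/M_edge].
case/and3P=> edge gT _; rewrite in_setD gT /=.
have ne : g u != u by apply: contraTneq edge => ->; rewrite eirr.
by have := vc _ _ ne edge; rewrite (negbTE uC) orbF.
Qed.

(** The number of sides on which a vertex is taken, halved, is a fractional cover of the rest: 1 on
    the intersection of [HI] and [LO], 1/2 on [H], 0 elsewhere. Only the halves need rounding, and
    there [I] is left out. *)
Lemma cover_bound l (I C : {set 'I_n}) : l <= n -> (forall u, pr u != l) ->
  let HI := above l in let LO := below_nbr l in
  let H := (HI :|: LO) :\: (HI :&: LO) in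
  is_independent e I -> I \subset H -> #|H| <= 6 * #|I| ->
  is_vertex_cover e C -> 2 * #|T| <= 3 * #|C :&: T| ->
  let K := T :|: (HI :&: LO) :|: ((HI :|: LO) :\: I) in
  is_vertex_cover e K /\ 3 * #|K| <= 5 * #|C|.
Proof.
move=> ln fr HI LO H indI IH leH vc leT K; split.
  move=> v u ne evu; apply/negPn/negP; rewrite negb_or => /andP[].
  rewrite !in_setU !negb_or => /andP[/andP[vT vB] vI] /andP[/andP[uT uB] uI].
  have r1 : restr v u by rewrite /restr evu vT.
  have r2 : restr u v by rewrite /restr esym evu vT uT.
  (* Each edge is covered in both of its orientations. A vertex outside [HI] and [LO] thus forces
     its neighbours into both. *)
  have c1 : (v \in LO) || (u \in HI).
    rewrite !inE; case: (ltngtP (pr u) l) => [lt| |eq]; rewrite ?orbT //.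
      by apply/orP; left; apply/existsP; exists u; rewrite r1.
    by have := fr u; rewrite eq eqxx.
  have c2 : (u \in LO) || (v \in HI).
    rewrite !inE; case: (ltngtP (pr v) l) => [lt| |eq]; rewrite ?orbT //.
      by apply/orP; left; apply/existsP; exists v; rewrite r2.
    by have := fr v; rewrite eq eqxx.
  have := indI _ _ _ _ ne; rewrite evu; move: vB vI uB uI c1 c2.
  rewrite !in_setI !in_setD !in_setU.
  case: (v \in HI); case: (v \in LO); case: (u \in HI); case: (u \in LO);
    case: (v \in I); case: (u \in I) => //= _ _ _ _ _ _ /(_ isT isT) //.
have := card_levels ln fr; have := card_matched vc; rewrite -/HI -/LO.
have := cardsUI HI LO.
have : #|H| = #|HI :|: LO| - #|HI :&: LO|.
  rewrite cardsD (setIidPr _) //; apply: subset_trans (subsetIl _ _) _; exact: subsetUl.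
have : #|HI :&: LO| <= #|HI :|: LO|.
  by apply: subset_leq_card; apply: subset_trans (subsetIl _ _) _; exact: subsetUl.
have : #|I| <= #|H| by apply: subset_leq_card.
have := cardsID T C.
have : #|K| <= #|T| + #|HI :&: LO| + (#|H| - #|I|).
  rewrite -(setIidPr IH) -cardsD.
  have -> : K = T :|: (HI :&: LO) :|: (H :\: I).
    apply/setP => x; rewrite !(in_setU, in_setD, in_setI).
    by case: (x \in T); case: (x \in HI); case: (x \in LO); case: (x \in I).
  apply: leq_trans (leq_card_setU _ _) _; rewrite leq_add2r; exact: leq_card_setU.
(* With b the size of the intersection and h that of [H], 2b + h is at most twice the size of [C]
   outside [T], and b + 5h/6 is at most 5/3 of b + h/2. On [T] the ratio 3/2 is better than 5/3. *)
move: leH leT; rewrite setIC; lia.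
Qed.
End CoverBound.

(** * Triangle removal and the auction *)

Definition tri_cond :=
  And (And (Not (Cell 1 1 1)) (And (Not (Cell 1 2 2)) (Not (Cell 1 3 3))))
      (And (Cell 0 1 2) (And (Cell 0 2 3) (Cell 0 1 3))).
Definition tri_body := Seq (Set_ 1 1 1 True_) (Seq (Set_ 1 2 2 True_) (Set_ 1 3 3 True_)).
Definition triangles := nest 1 (nest 3 (If tri_cond tri_body)).

(* Tracks 2 and 3 hold the owners and, in unary, the prices of an auction:
   the left vertex 2 bids on the cheapest of its neighbours 3, at price 4. *)
Definition edge_ x y := And (Cell 0 x y) (And (Not (Cell 1 x x)) (Not (Cell 1 y y))).
Definition bid_cond :=
  And (Not (Ex (Cell 2 5 2)))
  (And (edge_ 2 3)
  (And (Not (Cell 3 3 4))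
  (And (All (Imp (Lt 5 4) (Cell 3 3 5)))
       (All (Imp (edge_ 2 5) (All (Imp (Lt 6 4) (Cell 3 5 6)))))))).
Definition bid_body :=
  Seq (For (Set_ 2 3 5 (And (Not (Lt 5 2)) (Not (Lt 2 5))))) (Set_ 3 3 4 True_).
Definition auction := nest 2 (nest 3 (If bid_cond bid_body)).

Section Programs.
Variables (n : nat) (e : rel 'I_n).
Hypotheses (esym : symmetric e) (eirr : irreflexive e).
Notation bev := (bev n).
Notation exec := (exec n).
Notation dset := (dset n).

Lemma trianglesP (d0 : data) : (forall i j : 'I_n, d0 0 i j = e i j) ->
  dset d0 1 = set0 ->
  let d := exec triangles [::] d0 in
  [/\ forall c x y, c != 1 -> d c x y = d0 c x y,
      forall x y z, x \notin dset d 1 -> y \notin dset d 1 -> z \notin dset d 1 ->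
        e x y -> e y z -> ~~ e x z &
      forall C : {set 'I_n}, is_vertex_cover e C -> 2 * #|dset d 1| <= 3 * #|C :&: dset d 1| ].
Proof.
move=> d0e d01.
pose Inv d := (forall c x y, c != 1 -> d c x y = d0 c x y) /\
  forall C : {set 'I_n}, is_vertex_cover e C -> 2 * #|dset d 1| <= 3 * #|C :&: dset d 1|.
have condE (d : data) (x y z : 'I_n) : Inv d -> bev tri_cond [:: 0; val x; val y; val z] d =
    [&& [&& x \notin dset d 1, y \notin dset d 1 & z \notin dset d 1], e x y, e y z & e x z].
  by case=> Ho _; rewrite !inE -!d0e -!Ho.
rewrite [exec _ _ _](@exec_greedy n 1 3 tri_cond tri_body).
2: by move=> [|r [|r1 r2]] [|x [|y [|z [|z1 z2]]]] d e1 e2; try discriminate; rewrite /= !ltnn.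
2: by move=> [|r [|r1 r2]] [|x [|y [|z [|z1 z2]]]] d e1 e2; try discriminate.
set d := foldr _ _ _.
have [] := @greedy _ _ (fun d t => bev tri_cond (nseq 1 0 ++ t) d)
  (fun d t => exec tri_body (nseq 1 0 ++ t) d) Inv (fun d => #|dset d 1|)
  (tuples n 3) _ (tuples n 1) d0.
- move=> t [|x' [|y' [|z' [|? ?]]]]; rewrite mem_tuples //= => /and4P[ltx lty ltz _] It.
  pose x := Ordinal ltx; pose y := Ordinal lty; pose z := Ordinal ltz.
  change (bev tri_cond [:: 0; val x; val y; val z] t ->
    Inv (exec tri_body [:: 0; val x; val y; val z] t) /\
    #|dset t 1| < #|dset (exec tri_body [:: 0; val x; val y; val z] t) 1|).
  rewrite condE // => /and4P[/and3P[xD yD zD] exy eyz exz].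
  have -> : exec tri_body [:: 0; val x; val y; val z] t =
      upd (upd (upd t 1 x x true) 1 y y true) 1 z z true by rewrite /= ?ltnn.
  set t' := upd _ _ _ _ _.
  have nxy : x != y by apply: contraTneq exy => ->; rewrite eirr.
  have nyz : y != z by apply: contraTneq eyz => ->; rewrite eirr.
  have nxz : x != z by apply: contraTneq exz => ->; rewrite eirr.
  have e1 : dset t' 1 = [set x; y; z] :|: dset t 1.
    apply/setP => i; rewrite !inE /t' /upd !eqxx /= !andbb -!val_eqE /=.
    by case: (_ == z'); case: (_ == y'); case: (_ == x').
  have dis : [disjoint [set x; y; z] & dset t 1].
    rewrite disjoints_subset; apply/subsetP => i; rewrite in_setC !in_setU !in_set1.
    by case/orP => [/orP[]|] /eqP->.
  have c3 : #|[set x; y; z]| = 3.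
    by rewrite setUC cardsU1 cards2 !inE nxy [z == x]eq_sym (negbTE nxz) [z == y]eq_sym (negbTE nyz).
  have e1c : #|dset t' 1| = 3 + #|dset t 1| by rewrite e1 cardsU disjoint_setI0 // cards0 subn0 c3.
  case: It => Ho bound; split; last by rewrite e1c addSnnS leq_addl.
  split=> [c a b ne|C vc]; first by rewrite /t' /upd (negbTE ne) Ho.
  have CI : (C :&: [set x; y; z]) :&: (C :&: dset t 1) = set0.
    by rewrite setIACA (disjoint_setI0 dis) setI0.
  rewrite e1c e1 setIUr cardsU CI cards0 subn0.
  rewrite !mulnDr leq_add ?bound //.
  have c1 := vc _ _ nxy exy; have c2 := vc _ _ nyz eyz; have c4 := vc _ _ nxz exz.
  have two a b : a \in [set x; y; z] -> b \in [set x; y; z] -> a != b -> a \in C -> b \in C ->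
      2 <= #|C :&: [set x; y; z]|.
    move=> ax bx nab aC bC; have := cards2 a b; rewrite nab /= => <-.
    by apply/subset_leq_card/subsetP => i; rewrite in_set2 in_setI => /orP[] /eqP->; apply/andP.
  suff le2 : 2 <= #|C :&: [set x; y; z]| by rewrite [2 * 3]mulnC leq_mul2l.
  move: c1 c2 c4; case: (boolP (x \in C)) => xC; case: (boolP (y \in C)) => yC;
    case: (boolP (z \in C)) => zC //= _ _ _;
  by [apply: (two x y); rewrite // !inE ?eqxx ?orbT|apply: (two x z); rewrite // !inE ?eqxx ?orbT
     |apply: (two y z); rewrite // !inE ?eqxx ?orbT].
- by move=> t _; rewrite size_tuples expn1 -[X in _ <= X]card_ord max_card.
- by split=> // C _; rewrite d01 setI0 cards0.
rewrite -/d => Id term; have [Ho bound] := Id; split=> // x y z xD yD zD exy eyz.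
have vt : [:: val x; val y; val z] \in tuples n 3 by rewrite mem_tuples /= !ltn_ord.
have := term _ vt; rewrite [bev _ _ _](condE d x y z Id) xD yD zD exy eyz /=.
by [].
Qed.

Definition price (d : data) (u : 'I_n) := #|[set q : 'I_n | d 3 u q]|.

Lemma bid_condE (d : data) r1 r2 (v u p : 'I_n) : (forall i j : 'I_n, d 0 i j = e i j) ->
  (forall u q : 'I_n, d 3 u q = (q < price d u)) ->
  reflect [/\ forall w : 'I_n, ~~ d 2 w v, restr e (dset d 1) v u, p = price d u :> nat &
      forall w, restr e (dset d 1) v w -> p <= price d w]
    (bev bid_cond [:: r1; r2; val v; val u; val p] d).
Proof.
move=> de dp; set rho := [:: r1; r2; val v; val u; val p].
have edgeE (x y : 'I_n) : [&& d 0 x y, ~~ d 1 x x & ~~ d 1 y y] = restr e (dset d 1) x y.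
  by rewrite /restr !inE de.
have leP (w : 'I_n) : [forall q : 'I_n, (q < p) ==> d 3 w q] = (p <= price d w).
  apply/forallP/idP => [H|le q]; last by rewrite dp; apply/implyP => /leq_trans; apply.
  rewrite leqNgt; apply/negP => lt.
  have ltn : price d w < n by apply: ltn_trans lt (ltn_ord p).
  by have := H (Ordinal ltn); rewrite dp /= lt ltnn.
have -> : bev bid_cond rho d = [&& [forall w : 'I_n, ~~ d 2 w v], restr e (dset d 1) v u,
    ~~ (p < price d u), p <= price d u &
    [forall w, restr e (dset d 1) v w ==> (p <= price d w)]].
  transitivity [&& ~~ bev (Ex (Cell 2 5 2)) rho d, [&& d 0 v u, ~~ d 1 v v & ~~ d 1 u u],
    ~~ d 3 u p, bev (All (Imp (Lt 5 4) (Cell 3 3 5))) rho d &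
    bev (All (Imp (edge_ 2 5) (All (Imp (Lt 6 4) (Cell 3 5 6))))) rho d]; first by [].
  rewrite bev_ex negb_exists !bev_all edgeE dp -leP; congr [&& _, _, _, _ & _].
  - by apply: eq_forallb => q; rewrite bev_imp.
  - apply: eq_forallb => w; rewrite bev_imp bev_all -edgeE -leP; congr (_ ==> _).
    by apply: eq_forallb => q; rewrite bev_imp.
apply: (iffP and5P) => [[/forallP H1 H2 H3 H4 /forallP H5]|[H1 H2 H3 H4]]; split=> //.
- by apply/eqP; rewrite eqn_leq H4 leqNgt.
- by move=> w; apply/implyP.
- exact/forallP.
- by rewrite H3 ltnn.
- by rewrite H3.
- by apply/forallP => w; apply/implyP/H4.
Qed.

Lemma bid_bodyE (d : data) r1 r2 (v u p : 'I_n) :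
  let d' := exec bid_body [:: r1; r2; val v; val u; val p] d in
  [/\ forall x w : 'I_n, d' 2 x w = if x == u then w == v else d 2 x w,
      forall x q : 'I_n, d' 3 x q = ((x == u) && (q == p)) || d 3 x q &
      forall c x y, c != 2 -> c != 3 -> d' c x y = d c x y].
Proof.
pose rho := [:: r1; r2; val v; val u; val p].
have [//||H1 H2] := @exec_for_row n 2 3 (And (Not (Lt 5 2)) (Not (Lt 2 5))) rho d 5 (erefl _); first by [].
have -> : exec bid_body rho d =
    upd (exec (For (Set_ 2 3 5 (And (Not (Lt 5 2)) (Not (Lt 2 5))))) rho d) 3 u p true.
  by rewrite -[true](@bev_true n rho d) /= !ltnn.
move: H1 H2; set d2 := exec _ _ d => H1 H2 d'; rewrite {}/d'; split.
- move=> x w; rewrite /upd /= -val_eqE; case: eqP => [->|/eqP ne].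
    by rewrite H1 //= -!leqNgt -val_eqE /= eqn_leq andbC.
  by rewrite H2 // ne.
- by move=> x q; rewrite /upd -!val_eqE /=; case: ifP => // _; rewrite H2.
- by move=> c x y n2 n3; rewrite /upd (negbTE n3) H2 // n2.
Qed.

(** A winner buys at the lowest price among its neighbours and raises it by one, while other prices
    never fall: this is the slack of one. Bids are vertex numbers, so a price ends at n at most;
    every bid raises the sum of prices, bounded by n*n, which explains the two loops of rounds. *)
Lemma auctionP (d0 : data) : (forall i j : 'I_n, d0 0 i j = e i j) ->
  (forall i j : 'I_n, ~~ d0 2 i j) -> (forall i j : 'I_n, ~~ d0 3 i j) ->
  let d := exec auction [::] d0 in let R := restr e (dset d0 1) in
  [/\ forall c x y, c != 2 -> c != 3 -> d c x y = d0 c x y,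
      forall u q : 'I_n, d 3 u q = (q < price d u),
      [/\ forall u v : 'I_n, d 2 u v -> R v u,
         forall u v v' : 'I_n, d 2 u v -> d 2 u v' -> v = v' &
         forall u u' v : 'I_n, d 2 u v -> d 2 u' v -> u = u'] &
      [/\ forall u, 0 < price d u -> exists v : 'I_n, d 2 u v,
         forall u v w : 'I_n, d 2 u v -> R v w -> price d u <= (price d w).+1 &
         forall v w : 'I_n, (forall u : 'I_n, ~~ d 2 u v) -> R v w -> n <= price d w]].
Proof.
move=> d0e d02 d03 d R.
pose Inv d := [/\ forall c x y, c != 2 -> c != 3 -> d c x y = d0 c x y,
      forall u q : 'I_n, d 3 u q = (q < price d u),
      [/\ forall u v : 'I_n, d 2 u v -> R v u,
         forall u v v' : 'I_n, d 2 u v -> d 2 u v' -> v = v' &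
         forall u u' v : 'I_n, d 2 u v -> d 2 u' v -> u = u'] &
      (forall u, 0 < price d u -> exists v : 'I_n, d 2 u v) /\
      (forall u v w : 'I_n, d 2 u v -> R v w -> price d u <= (price d w).+1)].
pose total d := \sum_(u : 'I_n) price d u.
have InvE t : Inv t -> (forall i j : 'I_n, t 0 i j = e i j) /\ dset t 1 = dset d0 1.
  case=> Ho _ _ _; split=> [i j|]; first by rewrite Ho.
  by apply/setP => i; rewrite !inE Ho.
have [] := @greedy _ _ (fun d t => bev bid_cond (nseq 2 0 ++ t) d)
  (fun d t => exec bid_body (nseq 2 0 ++ t) d) Inv total
  (tuples n 3) _ (tuples n 2) d0.
- move=> t [|v' [|u' [|p' [|? ?]]]]; rewrite mem_tuples //= => /and4P[ltv ltu ltp _] It.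
  have [te t1] := InvE _ It; have [Ho pref [Medge Mleft Mright] [Mpos Mslack]] := It.
  pose v := Ordinal ltv; pose u := Ordinal ltu; pose p := Ordinal ltp.
  change (bev bid_cond [:: 0; 0; val v; val u; val p] t ->
    Inv (exec bid_body [:: 0; 0; val v; val u; val p] t) /\
    total t < total (exec bid_body [:: 0; 0; val v; val u; val p] t)).
  case/(bid_condE _ _ v u p te pref); rewrite t1 -/R => free vu pE least.
  have [e2 e3 eo] := bid_bodyE t 0 0 v u p.
  move: (exec _ _ _) e2 e3 eo => t' e2 e3 eo.
  have prE w : price t' w = price t w + (w == u).
    rewrite /price; case: (eqVneq w u) => [->|ne]; last first.
      by rewrite addn0; apply: eq_card => q; rewrite !inE e3 (negbTE ne).
    have -> : [set q : 'I_n | t' 3 u q] = p |: [set q : 'I_n | t 3 u q].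
      by apply/setP => q; rewrite !inE e3 eqxx.
    by rewrite cardsU1 inE pref pE ltnn addnC.
  split; last first.
    rewrite /total; under [ltnRHS]eq_bigr => w _ do rewrite prE.
    by rewrite big_split /= -[ltnLHS]addn0 ltn_add2l (bigD1 u) //= eqxx.
  have Mu' (w : 'I_n) : t' 2 u w = (w == v) by rewrite e2 eqxx.
  have M' (x w : 'I_n) : x != u -> t' 2 x w = t 2 x w by move=> ne; rewrite e2 (negbTE ne).
  split; [|move=> w q|split|split].
  + by move=> c x y n2 n3; rewrite eo // Ho.
  + rewrite e3 prE pref; case: (eqVneq w u) => [->|_] /=; last by rewrite addn0.
    by rewrite addn1 ltnS [RHS]leq_eqVlt -pE -val_eqE.
  + move=> x w; case: (eqVneq x u) => [->|ne]; first by rewrite Mu' => /eqP->.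
    by rewrite M' //; apply: Medge.
  + move=> x w w'; case: (eqVneq x u) => [->|ne]; first by rewrite !Mu' => /eqP-> /eqP->.
    by rewrite !M' //; apply: Mleft.
  + move=> x x' w; case: (eqVneq x u) => [->|ne]; case: (eqVneq x' u) => [->|ne'] //.
    * by rewrite Mu' M' // => /eqP->; rewrite (negbTE (free x')).
    * by rewrite Mu' M' // => + /eqP wv; rewrite wv (negbTE (free x)).
    * by rewrite !M' //; apply: Mright.
  + move=> x; rewrite prE; case: (eqVneq x u) => [-> _|ne]; first by exists v; rewrite Mu'.
    by rewrite addn0 => /Mpos[w xw]; exists w; rewrite M'.
  + move=> x w y; case: (eqVneq x u) => [->|ne].
      rewrite Mu' => /eqP-> vy; rewrite !prE eqxx addn1 ltnS.
      by rewrite -pE (leq_trans (least _ vy)) // leq_addr.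
    rewrite M' // !prE (negbTE ne) addn0 => xw wy.
    by apply: leq_trans (Mslack _ _ _ xw wy) _; rewrite ltnS leq_addr.
- move=> t _; rewrite size_tuples -mulnn -[X in _ <= X * _]card_ord -sum_nat_const.
  by apply: leq_sum => u _; rewrite -[X in _ <= X]card_ord max_card.
- have pr0 u : price d0 u = 0 by apply: eq_card0 => q; rewrite !inE (negbTE (d03 _ _)).
  split=> // [u q||].
  + by rewrite pr0 (negbTE (d03 _ _)).
  + by split=> [u v|u v v'|u u' v]; rewrite (negbTE (d02 _ _)).
  + by split=> [u|u v w]; rewrite ?pr0 // (negbTE (d02 _ _)).
have <- : d = foldr (fun _ d => round (fun d t => bev bid_cond (nseq 2 0 ++ t) d)
  (fun d t => exec bid_body (nseq 2 0 ++ t) d) (tuples n 3) d) d0 (tuples n 2).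
  apply: exec_greedy.
    by move=> [|r [|r' [|r1 r2]]] [|x [|y [|z [|z1 z2]]]] d1 e1 e2; try discriminate; rewrite /= ?ltnn.
  by move=> [|r [|r' [|r1 r2]]] [|x [|y [|z [|z1 z2]]]] d1 e1 e2; try discriminate.
move=> Id term; have [te t1] := InvE _ Id.
have [Ho pref M3 [Mpos Mslack]] := Id; split=> //; split=> // v w free vw.
(* An unmatched vertex with a neighbour cheaper than n could still bid on its cheapest neighbour. *)
rewrite leqNgt; apply/negP => ltw.
have [u vu least] : exists2 u, R v u & forall w, R v w -> price d u <= price d w.
  by case: (arg_minnP (price d) (vw : (fun w => R v w) w)) => u vu least; exists u.
have ltp : price d u < n := leq_ltn_trans (least _ vw) ltw.
have vt : [:: val v; val u; price d u] \in tuples n 3 by rewrite mem_tuples /= !ltn_ord ltp.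
have /negP[] := term _ vt.
by apply/(bid_condE _ _ v u (Ordinal ltp) te pref); rewrite t1.
Qed.
End Programs.

(* Track 4 is the initial segment of the levels below the first price that does
   not occur; tracks 5 and 6 are the two sides of a minimum vertex cover of the
   bipartite double cover. *)
Definition level_expr := All (Imp (Not (Lt 0 1))
  (Ex (And (Not (Cell 3 2 1)) (All (Imp (Lt 3 1) (Cell 3 2 3)))))).
Definition above_expr := All (Imp (Cell 4 1 1) (Cell 3 0 1)).
Definition below_expr := Ex (And (edge_ 0 1) (Not (Cell 5 1 1))).
Definition marks :=
  Seq (For (Set_ 4 0 0 level_expr)) (Seq (For (Set_ 5 0 0 above_expr))
  (Seq (For (Set_ 6 0 0 below_expr))
  (Seq (For (Set_ 7 0 0 (Or (Cell 1 0 0) (And (Cell 5 0 0) (Cell 6 0 0)))))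
       (For (Set_ 1 0 0 (Or (And (Cell 5 0 0) (Cell 6 0 0))
                            (And (Not (Cell 5 0 0)) (Not (Cell 6 0 0))))))))).
Definition cover_expr :=
  Or (Cell 7 1 1) (And (Or (Cell 5 1 1) (Cell 6 1 1)) (Not (Cell 8 1 1))).
Definition cover_program :=
  Seq triangles (Seq auction (Seq marks (Seq elim_is (For (For (Set_ 9 0 1 cover_expr)))))).

Fixpoint reads a (b : bexp) : bool :=
  match b with
  | Cell c _ _ => c == a
  | Lt _ _ => false
  | Not b => reads a b
  | And b c => reads a b || reads a c
  | Ex b => reads a b
  end.

Lemma bev_fresh n a b rho (d d' : data) : ~~ reads a b ->
  (forall c x y, c != a -> d' c x y = d c x y) -> bev n b rho d' = bev n b rho d.
Proof.
move=> + H; elim: b rho => [c x y|x y|b IH|b IHb c IHc|b IH] rho //=.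
- exact: H.
- by move=> /IH ->.
- by rewrite negb_or => /andP[/IHb -> /IHc ->].
- by move=> nr; apply: eq_has => i; apply: IH.
Qed.

Lemma exec_for_set n a b (d : data) : ~~ reads a b ->
  let r := exec n (For (Set_ a 0 0 b)) [::] d in
  (forall i : 'I_n, r a i i = bev n b [:: val i] d) /\
  (forall c x y, c != a -> r c x y = d c x y).
Proof.
move=> nr r; have [|H1 H2] := @exec_for_diag n a b [::] d 0 (erefl _).
  move=> i d' lt H; apply: (@bev_fresh n a b _ d d' nr) => c x y ne; apply: H => -[ec].
  by rewrite ec eqxx in ne.
by split=> [i|]; [apply: H1|exact: H2].
Qed.

Section Marks.
Variables (n : nat) (e : rel 'I_n).

(** The level [l] can be n, which is not the value of any variable; this is why the levels below it
    are marked instead. Track 7 saves the dead vertices before track 1 is overwritten so that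
    exactly [H] is alive for [elim_is]. *)
Lemma marksP (d : data) l : (forall i j : 'I_n, d 0 i j = e i j) ->
  (forall u q : 'I_n, d 3 u q = (q < price d u)) ->
  l <= n -> (forall u : 'I_n, price d u != l) ->
  (forall q, q < l -> exists u : 'I_n, price d u = q) ->
  let d' := exec n marks [::] d in
  let T := dset n d 1 in let HI := above (@price n d) l in
  let LO := below_nbr e T (@price n d) l in
  [/\ dset n d' 5 = HI, dset n d' 6 = LO, dset n d' 7 = T :|: (HI :&: LO),
      dset n d' 1 = ~: ((HI :|: LO) :\: (HI :&: LO)) &
      forall c x y, c \notin [:: 1; 4; 5; 6; 7] -> d' c x y = d c x y].
Proof.
move=> de dp ln fr below d' T HI LO.
pose s4 := For (Set_ 4 0 0 level_expr); pose s5 := For (Set_ 5 0 0 above_expr).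
pose s6 := For (Set_ 6 0 0 below_expr).
pose s7 := For (Set_ 7 0 0 (Or (Cell 1 0 0) (And (Cell 5 0 0) (Cell 6 0 0)))).
pose s1 := For (Set_ 1 0 0 (Or (And (Cell 5 0 0) (Cell 6 0 0))
                            (And (Not (Cell 5 0 0)) (Not (Cell 6 0 0))))).
pose d4 := exec n s4 [::] d; pose d5 := exec n s5 [::] d4.
pose d6 := exec n s6 [::] d5; pose d7 := exec n s7 [::] d6.
have eqd : d' = exec n s1 [::] d7 by [].
have [H4 O4] : _ /\ _ := @exec_for_set n 4 level_expr d isT.
have [H5 O5] : _ /\ _ := @exec_for_set n 5 above_expr d4 isT.
have [H6 O6] : _ /\ _ := @exec_for_set n 6 below_expr d5 isT.
have [H7 O7] : _ /\ _ := @exec_for_set n 7 (Or (Cell 1 0 0) (And (Cell 5 0 0) (Cell 6 0 0))) d6 isT.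
have [H1 O1] : _ /\ _ := @exec_for_set n 1 (Or (And (Cell 5 0 0) (Cell 6 0 0))
                            (And (Not (Cell 5 0 0)) (Not (Cell 6 0 0)))) d7 isT.
rewrite -/s4 -/d4 in H4 O4; rewrite -/s5 -/d5 in H5 O5; rewrite -/s6 -/d6 in H6 O6.
rewrite -/s7 -/d7 in H7 O7; rewrite -/s1 -eqd in H1 O1.
have pE (u q : 'I_n) : ~~ d 3 u q && [forall q' : 'I_n, (q' < q) ==> d 3 u q'] = (price d u == q).
  rewrite dp -leqNgt eqn_leq; congr (_ && _); apply/forallP/idP => [H|le q'].
    rewrite leqNgt; apply/negP => lt; have ltn := ltn_trans lt (ltn_ord q).
    by have := H (Ordinal ltn); rewrite dp /= lt ltnn.
  by rewrite dp; apply/implyP => /leq_trans; apply.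
pose price_eq := And (Not (Cell 3 2 1)) (All (Imp (Lt 3 1) (Cell 3 2 3))).
have peE (q q' u : 'I_n) :
    bev n price_eq [:: val q; val q'; val u] d = (price d u == q').
  rewrite -pE; transitivity (~~ d 3 u q' && bev n (All (Imp (Lt 3 1) (Cell 3 2 3)))
    [:: val q; val q'; val u] d); first by [].
  by congr (_ && _); rewrite bev_all; apply: eq_forallb => x; rewrite bev_imp.
have E4 (q : 'I_n) : d4 4 q q = (q < l).
  rewrite H4 bev_all; apply/forallP/idP => [H|lt q'].
    rewrite ltnNge; apply/negP => le; have ltl := leq_ltn_trans le (ltn_ord q).
    have := H (Ordinal ltl); rewrite bev_imp bev_ex => /implyP himp.
    have [|u Hu] := existsP (himp _); first by rewrite /= -leqNgt.
    have : bev n price_eq [:: val q; val (Ordinal ltl); val u] d := Hu.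
    by rewrite peE (negbTE (fr u)).
  rewrite bev_imp bev_ex; apply/implyP => le.
  have {}le : q' <= q by rewrite leqNgt.
  have [u eu] := below q' (leq_ltn_trans le lt); apply/existsP; exists u.
  suff : bev n price_eq [:: val q; val q'; val u] d by [].
  by rewrite peE eu.
(* The left side only says that the price is at least [l]; it is larger because [l] is no price. *)
have lP (u : 'I_n) : (forall q : 'I_n, q < l -> q < price d u) <-> l < price d u.
  split=> [H|lt q ql]; last exact: ltn_trans lt.
  rewrite ltnNge leq_eqVlt (negbTE (fr u)) /=; apply/negP => lt.
  have ltn : price d u < n := leq_trans lt ln.
  by have := H (Ordinal ltn) lt; rewrite ltnn.
have E5 (u : 'I_n) : d5 5 u u = (u \in HI).
  rewrite H5 bev_all inE; apply/forallP/idP => [H|/lP H q].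
    apply/lP => q ql; have := H q; rewrite bev_imp /= E4 ql /= O4 // dp.
    exact.
  by rewrite bev_imp /= E4 O4 // dp; apply/implyP/H.
have E6 (v : 'I_n) : d6 6 v v = (v \in LO).
  rewrite H6 bev_ex inE; apply: eq_existsb => w.
  rewrite -[LHS]/([&& d5 0 v w, ~~ d5 1 v v & ~~ d5 1 w w] && ~~ d5 5 w w) E5 !O5 // !O4 // de.
  rewrite /restr /T !inE; congr (_ && _).
  by rewrite -leqNgt leq_eqVlt (negbTE (fr w)).
have E5' (u : 'I_n) : d6 5 u u = (u \in HI) by rewrite O6 ?E5.
have E7 (v : 'I_n) : d7 7 v v = (v \in T :|: (HI :&: LO)).
  have Tv : (v \in T) = d 1 v v by rewrite inE.
  by rewrite H7 bev_or /= E5' E6 O6 // O5 // O4 // !in_setU in_setI Tv.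
have E1 (v : 'I_n) : d' 1 v v = (v \notin ((HI :|: LO) :\: (HI :&: LO))).
  rewrite H1 bev_or /= !O7 // E5' E6 !(in_setD, in_setU, in_setI).
  by case: (v \in HI); case: (v \in LO).
split.
- by apply/setP => v; rewrite inE O1 // O7 // E5'.
- by apply/setP => v; rewrite inE O1 // O7 // E6.
- by apply/setP => v; rewrite inE O1 // E7.
- by apply/setP => v; rewrite inE E1 in_setC.
- move=> c x y; rewrite !inE !negb_or => /and5P[n1 n4 n5 n6 n7].
  by rewrite O1 // O7 // O6 // O5 // O4.
Qed.
End Marks.

Lemma vertex_cover_machine :
  exists M : TM, polytime_on_circle_graphs M good_vertex_cover.
Proof.
have [M [c Hc]] := @row_program 9 9 cover_program 9 isT isT isT.
exists M, c => n e ce; have [t [cf [let_ rt outE]]] := Hc n e.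
exists t, cf; split=> //; split=> //; rewrite outE.
have esym := circle_sym ce; have eirr := circle_irr ce.
pose din := input_data n (encode_graph e).
have din0 a x y : a != 0 -> din a x y = false by move=> a0; rewrite /din input_data0.
have d01 : dset n din 1 = set0 by apply/setP => i; rewrite !inE din0.
pose d1 := exec n triangles [::] din.
have [O1 tri tri_le] := trianglesP eirr (@input_dataE n e) d01; rewrite -/din -/d1 in O1 tri tri_le.
have d1e (i j : 'I_n) : d1 0 i j = e i j by rewrite O1 //; apply: input_dataE.
pose d2 := exec n auction [::] d1.
have [|| O2 pref [Medge Mleft Mright] [Mpos Mslack Mmax]] := auctionP d1e.
- by move=> i j; rewrite O1 // din0.
- by move=> i j; rewrite O1 // din0.
rewrite -/d2 in O2 pref Medge Mleft Mright Mpos Mslack Mmax.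
have d2e (i j : 'I_n) : d2 0 i j = e i j by rewrite O2.
have T2 : dset n d2 1 = dset n d1 1 by apply/setP => i; rewrite !inE O2.
have pr_le (u : 'I_n) : price d2 u <= n by rewrite -[X in _ <= X]card_ord max_card.
have [l [ln fr below]] := free_level pr_le.
pose d3 := exec n marks [::] d2.
have [E5 E6 E7 E1 O3] := marksP d2e pref ln fr below.
rewrite -/d3 T2 in E5 E6 E7 E1 O3.
set T := dset n d1 1 in tri tri_le Medge Mslack Mmax E6 E7 E1.
set HI := above _ l in E5 E7 E1; set LO := below_nbr _ _ _ _ in E6 E7 E1.
have d3e (i j : 'I_n) : d3 0 i j = e i j by rewrite O3 ?d2e.
have d38 : dset n d3 8 = set0.
  by apply/setP => i; rewrite !inE O3 // O2 // O1 // din0.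
pose d4 := exec n elim_is [::] d3.
have [O4 indI disI ch] := elim_isP esym d3e d38 (circle_sparse ce).
rewrite -/d4 E1 in O4 indI disI ch.
have -> : exec n cover_program [::] din = exec n (For (For (Set_ 9 0 1 cover_expr))) [::] d4 by [].
set I := dset n d4 8 in indI disI ch.
pose H := (HI :|: LO) :\: (HI :&: LO).
have IH : I \subset H by rewrite disjoints_subset setCK in disI.
have HT : [disjoint H & T].
  rewrite disjoints_subset; apply/subsetP => x; rewrite in_setD in_setU => /andP[_ /orP[]].
    rewrite inE => lx; have [v xv] := Mpos x (leq_ltn_trans (leq0n _) lx).
    by rewrite in_setC; have /and3P[] := Medge _ _ xv.
  by rewrite inE => /existsP[w /andP[/and3P[_ xT _] _]]; rewrite in_setC.
have leH : #|H| <= 6 * #|I|.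
  (* No triangle is left outside [T], so the alive neighbours of a good vertex are independent and
     at most five; with the vertex itself this makes six. *)
  have := ch setT 6; rewrite setTD setCK setTI; apply => U v UH vU sm.
  rewrite setTI; apply: leq_trans (leq_card_setU _ _) _; rewrite cards1 ltnS.
  have notT x : x \in U -> x \notin T.
    by move=> xU; move: HT; rewrite disjoints_subset => /subsetP/(_ x (subsetP UH _ xU)); rewrite in_setC.
  apply: sm; first by apply/subsetP => x; rewrite inE => /andP[].
    by move=> x; rewrite inE => /andP[].
  move=> x y; rewrite !in_set => /andP[xU vx] /andP[yU vy] ne; apply/negP => exy.
  by have := tri v x y (notT _ vU) (notT _ xU) (notT _ yU) vx exy; rewrite vy.
have bound C (vc : is_vertex_cover e C) := cover_bound esym eirr Medge Mleft Mright Mpos Mslack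
  Mmax ln fr indI IH leH vc (tri_le C vc).
(* [cover_bound] compares with a given cover; the set of all vertices is one, and yields that the
   output is a cover. *)
have vcT : is_vertex_cover e setT by move=> i j _ _; rewrite inE.
exists (T :|: (HI :&: LO) :|: ((HI :|: LO) :\: I)); split; last first.
  by split=> [|C vc]; [have [] := bound _ vcT|have [] := bound _ vc].
apply: encode_setE => i.
rewrite (@exec_output n cover_expr d4 (fun i => bev n cover_expr [:: 0; i] d4)) //; first last.
- by rewrite ltn_predL (leq_ltn_trans _ (ltn_ord i)).
- by move=> z j d' _ Hd; rewrite /cover_expr !bev_or /= !Hd.
have d4E a x y : a != 1 -> a != 8 -> d4 a x y = d3 a x y by apply: O4.
have m5 : d3 5 i i = (i \in HI) by rewrite -E5 inE.
have m6 : d3 6 i i = (i \in LO) by rewrite -E6 inE.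
have m7 : d3 7 i i = (i \in T :|: (HI :&: LO)) by rewrite -E7 inE.
have m8 : d4 8 i i = (i \in I) by rewrite inE.
rewrite /cover_expr bev_or /= m8 !d4E // m5 m6 m7 !(in_setU, in_setD, in_setI).
by case: (i \in I); case: (i \in HI); case: (i \in LO).
Qed.

Theorem theorem5p1 :
  (exists M : TM, polytime_on_circle_graphs M good_vertex_cover) /\
  (exists M : TM, polytime_on_circle_graphs M good_coloring) /\
  (exists M : TM, polytime_on_circle_graphs M good_independent_set).
Proof.
split; first exact: vertex_cover_machine.
by split; [exact: coloring_machine|exact: independent_set_machine].
Qed.
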